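(* Let $C:f=0$ be a reduced plane curve of even degree $d=2e$ in $\mathbb{P}^2$, not a union of lines passing through one point, and suppose that the minimal graded free resolution of $M(f)$ has the form $$0 \to S(-b-2(d-1)) \to \bigoplus_{i=1}^{3}S(-d_i-(d-1)) \to S^3(-d+1) \to S$$ with $d_1=d_2=d_3=e$. Then $C$ is almost free, $b=2-e$, $\tau(C)=3e(e-1)$, $mdr(f)=e$ and $ct(f)=st(f)=3e-2$.
   Context: $S=\mathbb{C}[x,y,z]$ with its standard grading, $f\in S$ is homogeneous of degree $d$, and $C\subset\mathbb{P}^2$ is the curve $f=0$. $J_f=(f_x,f_y,f_z)$ is the Jacobian ideal, $M(f)=S/J_f$ is the graded Milnor algebra, $I_f$ is the saturation of $J_f$ with respect to $\mathbf{m}=(x,y,z)$, and $N(f)=I_f/J_f$ (a graded $S$-module). $b$ is an integer. $\tau(C)$ is the total Tjurina number of $C$, i.e. the sum of the local Tjurina numbers of $C$ at its singular points. $C$ is almost free if $\dim N(f)=1$ when $d$ is even, and $\dim N(f)=2$ when $d$ is odd. Invariants: let $f_s\in S$ be homogeneous of degree $d$ with $f_s=0$ a smooth curve. - Coincidence threshold: $ct(f)=\max\{q:\dim M(f)_k=\dim M(f_s)_k \text{ for all } k\leq q\}$. - Stability threshold: $st(f)=\min\{q:\dim M(f)_k=\tau(C)\text{ for all }k\geq q\}$. - Minimal degree of a nontrivial (essential) syzygy: $mdr(f)=\min\{q: H^2(K^*(f))_{q+2}\neq 0\}$, where $K^*(f)$ is the Koszul complex of $f_x,f_y,f_z$ with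 its natural grading. Concretely, $H^2(K^*(f))_{q+2}$ is the space of triples $(a,b,c)\in S_q^3$ with $af_x+bf_y+cf_z=0$, modulo the Koszul relations, i.e. those lying in the $S$-submodule generated by $(f_y,-f_x,0)$, $(f_z,0,-f_x)$, $(0,f_z,-f_y)$.
   Formalization: The claims mdr(f)=e and ct(f)=3e-2 are made only when C has a singular point; this excludes just the smooth conic (e=1), which meets all hypotheses but for which mdr(f) and ct(f) are undefined. *)

(* Defs.v *)
From HB Require Import structures.
From mathcomp Require Import all_boot all_order all_algebra.
From mathcomp Require Import mpoly.

Set Implicit Arguments.
Unset Strict Implicit.
Unset Printing Implicit Defensive.
Import GRing.Theory.
Local Open Scope ring_scope.

(* [quot_dim iota V W n] : dim_F V / (V `&` W) = n, for V and W (subspaces of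
   the F-algebra A with structure map iota) given as predicates; it asserts the
   existence of a basis of V modulo W with n elements, so it also says that the
   dimension is finite. *)
Definition quot_dim (F : fieldType) (A : comNzRingType) (iota : F -> A)
    (V W : A -> Prop) (n : nat) : Prop :=
  exists v : 'I_n -> A,
    [/\ forall i, V (v i),
        forall c : 'I_n -> F, W (\sum_i iota (c i) * v i) -> forall i, c i = 0
      & forall x, V x -> exists c : 'I_n -> F, W (x - \sum_i iota (c i) * v i)].

Definition is_min (P : nat -> Prop) (q : nat) : Prop :=
  P q /\ forall q', P q' -> (q <= q')%N.
Definition is_max (P : nat -> Prop) (q : nat) : Prop :=
  P q /\ forall q', P q' -> (q' <= q)%N.

Section Curves.

Variable F : fieldType.
Notation S := {mpoly F[3]}.

(* Points of P^2 are represented by nonzero vectors, up to [same_point]. *)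
Definition same_point (p q : 'rV[F]_3) : Prop :=
  exists2 c : F, c != 0 & p = c *: q.

Definition singular_point (f : S) (p : 'rV[F]_3) : Prop :=
  [/\ p != 0, f.@[p ord0] = 0 & forall i, (f^`M(i)).@[p ord0] = 0].

Definition smooth_curve (f : S) : Prop := ~ exists p, singular_point f p.

Definition reduced_curve (d : nat) (f : S) : Prop :=
  [/\ (0 < d)%N, f \is d.-homog, f != 0
    & forall g h : S, f = g ^+ 2 * h -> exists c : F, g = c%:MP].

Definition concurrent_lines (f : S) : Prop :=
  exists2 p : 'rV[F]_3, p != 0 &
  exists2 ls : seq S,
    forall l, l \in ls -> [/\ l \is 1.-homog, l != 0 & l.@[p ord0] = 0]
  & forall q : 'rV[F]_3, q != 0 ->
      (f.@[q ord0] = 0 <-> exists2 l, l \in ls & l.@[q ord0] = 0).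

Definition jacobian (f p : S) : Prop :=
  exists h : 'I_3 -> S, p = \sum_i h i * f^`M(i).

(* The N-homogeneous polynomials span the degree N part of m^N and generate it,
   so the condition reads m^N * p \subset J_f. *)
Definition saturation (f p : S) : Prop :=
  exists N : nat, forall q : S, q \is N.-homog -> jacobian f (q * p).

Definition milnor_dim (f : S) (k n : nat) : Prop :=
  quot_dim (@mpolyC 3 F) (fun p => p \is k.-homog) (jacobian f) n.

Definition N_dim (f : S) (n : nat) : Prop :=
  quot_dim (@mpolyC 3 F) (saturation f) (jacobian f) n.

Definition almost_free (d : nat) (f : S) : Prop :=
  N_dim f (if odd d then 2 else 1).

(* The affine chart x_i = 1, the remaining coordinates being renumbered by
   [lift i]. *)
Definition dehomog (i : 'I_3) (f : S) : {mpoly F[2]} :=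
  f \mPo [tuple (if unlift i j is Some k then 'X_k else 1) | j < 3].

Definition affine_pt (i : 'I_3) (p : 'rV[F]_3) : 'I_2 -> F :=
  fun k => p ord0 (lift i k) / p ord0 i.

(* The local ring of the affine plane at a, inside the field of fractions. *)
Definition local_ring (a : 'I_2 -> F) (x : {fraction {mpoly F[2]}}) : Prop :=
  exists g s : {mpoly F[2]}, s.@[a] != 0 /\ x = tofrac g / tofrac s.

Definition tjurina_ideal (g : {mpoly F[2]}) (a : 'I_2 -> F)
    (x : {fraction {mpoly F[2]}}) : Prop :=
  exists h0 : {fraction {mpoly F[2]}}, exists h : 'I_2 -> {fraction {mpoly F[2]}},
    [/\ local_ring a h0, forall k, local_ring a (h k)
      & x = h0 * tofrac g + \sum_k h k * tofrac (g^`M(k))].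

(* The local Tjurina number dim O_p / (g, g_u, g_v), O_p being the algebraic
   local ring (the analytic one gives the same quotient at an isolated
   singularity) and g the equation of the curve in any standard chart
   containing p. *)
Definition local_tjurina (f : S) (p : 'rV[F]_3) (t : nat) : Prop :=
  forall i : 'I_3, p ord0 i != 0 ->
    quot_dim (fun c : F => tofrac (c%:MP_[2]))
      (local_ring (affine_pt i p)) (tjurina_ideal (dehomog i f) (affine_pt i p)) t.

(* s lists each singular point of P^2 exactly once. *)
Definition total_tjurina (f : S) (t : nat) : Prop :=
  exists n : nat, exists s : 'I_n -> 'rV[F]_3, exists ts : 'I_n -> nat,
    [/\ forall i, singular_point f (s i),
        forall i j, same_point (s i) (s j) -> i = j,
        forall p, singular_point f p -> exists i, same_point p (s i),
        forall i, local_tjurina f (s i) (ts i)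
      & t = (\sum_(i < n) ts i)%N].

(* For a smooth curve every q satisfies the condition defining ct, and there is
   no non-Koszul syzygy: ct (here) and mdr (below) have a value only for singular
   curves. *)
Definition is_ct (f fs : S) (q : nat) : Prop :=
  is_max (fun q => forall k, (k <= q)%N ->
    exists2 n, milnor_dim f k n & milnor_dim fs k n) q.

Definition is_st (f : S) (q : nat) : Prop :=
  exists2 t, total_tjurina f t &
    is_min (fun q => forall k, (q <= k)%N -> milnor_dim f k t) q.

Definition vec3 (a b c : S) : 'rV[S]_3 := \row_(j < 3) [:: a; b; c]`_j.

Definition koszul_syzygy (f : S) (v : 'rV[S]_3) : Prop :=
  let fx := f^`M(0) in let fy := f^`M(1) in let fz := f^`M(2%:R) in
  exists a b c : S,
    v = a *: vec3 fy (- fx) 0 + b *: vec3 fz 0 (- fx) + c *: vec3 0 fz (- fy).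

Definition is_mdr (f : S) (q : nat) : Prop :=
  is_min (fun q => exists v : 'rV[S]_3,
    [/\ forall i, v ord0 i \is q.-homog, \sum_i v ord0 i * f^`M(i) = 0
      & ~ koszul_syzygy f v]) q.

(* Homogeneity with an integer degree: S has no elements of negative degree. *)
Definition zhomog (k : int) (p : S) : Prop :=
  match k with Posz n => p \is n.-homog | Negz _ => p = 0 end.

(* A matrix A acts on row vectors by v |-> v *m A. [graded_map a b A]: A is a
   degree 0 map from the sum of the S(- a i) to the sum of the S(- b j). *)
Definition graded_map (m n : nat) (a : 'I_m -> int) (b : 'I_n -> int)
    (A : 'M[S]_(m, n)) : Prop :=
  forall i j, zhomog (a i - b j) (A i j).

Definition minimal_map (m n : nat) (A : 'M[S]_(m, n)) : Prop :=
  forall i j, (A i j)@_0%MM = 0.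

Definition exact_at (m n p : nat) (A : 'M[S]_(m, n)) (B : 'M[S]_(n, p)) : Prop :=
  forall v : 'rV[S]_n, v *m B = 0 <-> exists u : 'rV[S]_m, v = u *m A.

(* M(f) = S / J_f has a minimal graded free resolution
   0 -> S(-b-2(d-1)) -> sum_i S(- ds i -(d-1)) -> S^3(-(d-1)) -> S,
   with maps A3, A2, A1; exactness at S says that the image of A1 is J_f. *)
Definition has_min_resolution (d : nat) (f : S) (ds : 'I_3 -> int) (b : int)
    : Prop :=
  let d' : int := d%:Z - 1 in
  let s0 := fun _ : 'I_1 => 0 : int in
  let s1 := fun _ : 'I_3 => d' in
  let s2 := fun i : 'I_3 => ds i + d' in
  let s3 := fun _ : 'I_1 => b + 2 * d' in
  exists (A1 : 'M[S]_(3, 1)) (A2 : 'M[S]_(3, 3)) (A3 : 'M[S]_(1, 3)),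
    [/\ [/\ graded_map s1 s0 A1, graded_map s2 s1 A2 & graded_map s3 s2 A3],
        [/\ minimal_map A1, minimal_map A2 & minimal_map A3],
        forall v : 'rV[S]_1, v *m A3 = 0 -> v = 0,
        exact_at A3 A2 /\ exact_at A2 A1
      & forall p : S, jacobian f p <-> exists v : 'rV[S]_3, p%:M = v *m A1].

End Curves.

(* Main.v *)
Require Import Defs.
From mathcomp Require Import all_boot all_order all_algebra.
From mathcomp Require Import reals complex mpoly.
From HB Require Import structures.
From mathcomp Require Import boolp ring zify.
Import GRing.Theory Num.Theory.
Local Open Scope ring_scope.

Set Implicit Arguments.
Unset Strict Implicit.
Unset Printing Implicit Defensive.

(** Write n = 2 e - 1 for the degree of the partials, G for the column of partials
    and J for the ideal they generate. After a change of basis the resolution says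
    that the syzygies of G are generated by the rows of a 3 x 3 matrix A of forms
    of degree e, subject to a single relation l of some degree m > 0
    ([syzygy_resolution_exists]).

    The Hilbert function of M(f) then grows like (m - 1) k
    ([bounded_linear_relation]). For a reduced curve no prime divides all the
    partials ([reduced_no_common_factor]), so J contains two coprime forms and the
    function is bounded by Bezout's number ([coprime_bounded]). Hence m = 1, which
    is b = 2 - e, and all values of the Hilbert function are known: it is constant,
    equal to 3 e (e - 1), from degree 3 e - 2 on, and larger by one in degree
    3 e - 3.

    The three linear forms in l are independent, since otherwise there would be a
    syzygy of degree e - 1 ([linear_relation_unit]); so l may be taken to be
    X = (x, y, z). Exactness of the Koszul complex, with matrix K, gives A = K H and
    H G = p X for some p. Chasing the Koszul complex once more shows that an element
    which x, y and z all carry into J + F p lies in J + F p ([socle_step]); hence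
    the saturation of J is J + F p, while p is not in J. This is almost freeness.

    For the Tjurina number, J is compared with its localisations at the singular
    points. An ideal of bounded codimension contains binary forms in any two
    variables; over an algebraically closed field they split, and adjoining linear
    factors one at a time gives a graded Nullstellensatz ([nullstellensatz]). By it
    the local ideals at distinct points are comaximal and their intersection agrees
    with J in large degrees, where J is saturated; so the dimension of M(f) in a
    large degree is the sum of the local ones ([codim_sum]). Dehomogenisation
    identifies each of these with the Tjurina algebra in any chart
    ([local_tjurina_chart]).

    The syzygies of f of degree less than e vanish and the Koszul ones have degree
    at least n, which gives mdr. For a smooth curve the partials contain a coprime
    pair modulo whose ideal, which is saturated, the third partial is a
    nonzerodivisor, since the three generate all forms of large degree
    ([smooth_no_syzygy]). So below degree 2 n the smooth curve has no syzygies, and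
    the two Hilbert functions first differ in degree 3 e - 1, where A contributes. *)

(** * Dimensions of subquotients *)

Section Dimension.

Variables (F : fieldType) (E : lmodType F).
Implicit Types (V U W : E -> Prop) (m n : nat).

Definition subspace V := V 0 /\ forall c x y, V x -> V y -> V (c *: x + y).

Definition independent W n (v : 'I_n -> E) :=
  forall c : 'I_n -> F, W (\sum_i c i *: v i) -> forall i, c i = 0.

(** The dimension of V / (V cap W), for modules; the finiteness is part of it. *)
Definition sdim V W n := exists v : 'I_n -> E,
  [/\ forall i, V (v i), independent W v
    & forall x, V x -> exists c : 'I_n -> F, W (x - \sum_i c i *: v i)].

Lemma subspaceD {V} : subspace V -> forall x y, V x -> V y -> V (x + y).
Proof. by case=> _ h x y Vx Vy; rewrite -[x]scale1r; apply: h. Qed.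

Lemma subspaceZ {V} : subspace V -> forall c x, V x -> V (c *: x).
Proof. by case=> h0 h c x Vx; rewrite -[_ *: _]addr0; apply: h. Qed.

Lemma subspaceN {V} : subspace V -> forall x, V x -> V (- x).
Proof. by move=> sV x Vx; rewrite -scaleN1r; apply: subspaceZ. Qed.

Lemma subspaceB {V} : subspace V -> forall x y, V x -> V y -> V (x - y).
Proof. by move=> sV x y Vx Vy; apply: subspaceD => //; apply: subspaceN. Qed.

Lemma subspace_sum {V} : subspace V ->
  forall n (v : 'I_n -> E), (forall i, V (v i)) -> V (\sum_i v i).
Proof.
move=> sV n v Vv; elim/big_ind: _ => // [|x y Vx Vy]; first by case: sV.
exact: subspaceD.
Qed.

Lemma subspace_comb {V} : subspace V ->
  forall n (c : 'I_n -> F) (v : 'I_n -> E), (forall i, V (v i)) ->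
  V (\sum_i c i *: v i).
Proof. by move=> sV n c v Vv; apply: subspace_sum => // i; apply: subspaceZ. Qed.

(** The matrix of the coordinates of too many vectors has a nonzero left
    kernel. *)
Lemma sdim_dependent {V W n} : subspace W -> sdim V W n ->
  forall m (v : 'I_m -> E), (n < m)%N -> (forall i, V (v i)) ->
  exists2 c : 'I_m -> F, (exists i, c i != 0) & W (\sum_i c i *: v i).
Proof.
move=> sW [b [Vb ib gb]] m v ltnm Vv.
have [M hM] := choice (fun i => gb (v i) (Vv i)).
pose A : 'M[F]_(m, n) := \matrix_(i, j) M i j.
have /rowV0Pn[u /sub_kermxP uA u0] : kermx A != 0.
  rewrite -mxrank_eq0 mxrank_ker subn_eq0 -ltnNge.
  exact: leq_ltn_trans (rank_leq_col A) ltnm.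
exists (fun i => u ord0 i).
  by case/rV0Pn: u0 => i ui; exists i.
have -> : \sum_i u ord0 i *: v i =
          \sum_i u ord0 i *: (v i - \sum_j M i j *: b j).
  under [RHS]eq_bigr do rewrite scalerBr.
  rewrite big_split /= -[LHS]addr0; congr (_ + _).
  rewrite sumrN; under eq_bigr do rewrite scaler_sumr.
  rewrite exchange_big /= big1 ?oppr0 // => j _.
  under eq_bigr do rewrite scalerA.
  rewrite -scaler_suml; have -> : \sum_i u ord0 i * M i j = (u *m A) ord0 j.
    by rewrite mxE; apply: eq_bigr => i _; rewrite mxE.
  by rewrite uA mxE scale0r.
exact: subspace_comb.
Qed.

Lemma sdim_uniq V W m n : subspace W -> sdim V W m -> sdim V W n -> m = n.
Proof.
move=> sW; wlog lemn : m n / (m < n)%N => [hw dm dn|dm [v [Vv iv _]]].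
  by case: (ltngtP m n) => // h; [apply: hw|symmetry; apply: hw].
by have [c [i /eqP ci] /iv/(_ i)] := sdim_dependent sW dm lemn Vv.
Qed.

Definition fcons n (x : E) (v : 'I_n -> E) (i : 'I_n.+1) : E :=
  if unlift ord0 i is Some j then v j else x.

Lemma fcons0 n x (v : 'I_n -> E) : fcons x v ord0 = x.
Proof. by rewrite /fcons unlift_none. Qed.

Lemma fconsS n x (v : 'I_n -> E) i : fcons x v (lift ord0 i) = v i.
Proof. by rewrite /fcons liftK. Qed.

(** A maximal independent family spans, and the hypothesis bounds the size of
    the independent families. *)
Lemma sdim_exists V W N : subspace V -> subspace W ->
  (forall v : 'I_N.+1 -> E, (forall i, V (v i)) ->
    exists2 c : 'I_N.+1 -> F, (exists i, c i != 0) & W (\sum_i c i *: v i)) ->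
  exists2 n, (n <= N)%N & sdim V W n.
Proof.
move=> sV sW dep.
pose P n := `[< exists v : 'I_n -> E, (forall i, V (v i)) /\ independent W v >].
have P0 : exists n, P n.
  by exists 0%N; apply/asboolP; exists (fun _ => 0); split=> [[]|c _ []].
have Pb n : P n -> (n <= N)%N.
  move=> /asboolP[v [Vv iv]]; rewrite leqNgt; apply/negP => ltNn.
  have [c [i ci] Wc] := dep (fun i => v (widen_ord ltNn i)) (fun i => Vv _).
  pose c' (j : 'I_n) := if insub (val j) is Some i then c i else 0.
  have c'w j : c' (widen_ord ltNn j) = c j.
    by rewrite /c' insubT //= => hj; congr c; apply: val_inj.
  have := iv c' _ (widen_ord ltNn i); rewrite c'w => ci0.
  case/eqP: ci; apply: ci0.
  rewrite (bigID (fun j : 'I_n => (j < N.+1)%N)) /= [X in _ + X]big1 => [|j].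
    rewrite addr0 (big_ord_narrow ltNn).
    by under eq_bigr do rewrite c'w.
  by move=> hj; rewrite /c' insubN // scale0r.
have [n /asboolP[v [Vv iv]] maxn] := ex_maxnP P0 Pb.
exists n; first by apply: Pb; apply/asboolP; exists v.
exists v; split=> // x Vx.
apply: contrapT => nx.
have /maxn : P n.+1; last by rewrite ltnn.
apply/asboolP; exists (fcons x v); split=> [i|c].
  by rewrite /fcons; case: unliftP.
rewrite big_ord_recl fcons0; under eq_bigr do rewrite fconsS.
move=> Wc.
have c0 : c ord0 = 0.
  apply/eqP/negP => /negP c0; apply: nx.
  exists (fun i => - (c ord0)^-1 * c (lift ord0 i)).
  have -> : x - \sum_i (- (c ord0)^-1 * c (lift ord0 i)) *: v i
    = (c ord0)^-1 *: (c ord0 *: x + \sum_i c (lift ord0 i) *: v i).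
    rewrite scalerDr scalerA mulVf // scale1r; congr (_ + _).
    rewrite scaler_sumr -sumrN; apply: eq_bigr => i _.
    by rewrite mulNr scaleNr opprK scalerA.
  exact: subspaceZ.
move: Wc; rewrite c0 scale0r add0r => /iv cv i.
by case: (unliftP ord0 i) => [j|] ->.
Qed.

(** Concatenate a basis of each step. *)
Lemma sdim_tower V U W m n : subspace U -> subspace W ->
  (forall x, U x -> V x) -> (forall x, W x -> U x) ->
  sdim V U m -> sdim U W n -> sdim V W (m + n).
Proof.
move=> sU sW UV WU [v [Vv iv gv]] [u [Uu iu gu]].
pose w (i : 'I_(m + n)) := match split i with inl j => v j | inr j => u j end.
have wl i : w (lshift n i) = v i by rewrite /w (unsplitK (inl i)).
have wr i : w (rshift m i) = u i by rewrite /w (unsplitK (inr i)).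
exists w; split=> [i|c|x Vx].
- by rewrite /w; case: (split i) => j; [|apply: UV].
- rewrite big_split_ord /=.
  under eq_bigr do rewrite wl.
  under [X in _ + X]eq_bigr do rewrite wr.
  move=> Wc.
  have cl i : c (lshift n i) = 0.
    apply: (iv (fun i => c (lshift n i))).
    have -> : \sum_i c (lshift n i) *: v i =
      (\sum_i c (lshift n i) *: v i + \sum_i c (rshift m i) *: u i)
       - \sum_i c (rshift m i) *: u i by rewrite addrK.
    by apply: (subspaceB sU); [apply: WU|apply: subspace_comb].
  move: Wc; rewrite big1 ?add0r => [/iu cr i|i _]; last by rewrite cl scale0r.
  by case: (split_ordP i) => j ->.
- have [a Ua] := gv x Vx; have [b Wb] := gu _ Ua.
  exists (fun i => match split i with inl j => a j | inr j => b j end).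
  rewrite big_split_ord /=.
  have -> : \sum_i (match split (lshift n i) with inl j => a j | inr j => b j end)
      *: w (lshift n i) = \sum_i a i *: v i.
    by apply: eq_bigr => i _; rewrite wl (unsplitK (inl i)).
  have -> : \sum_i (match split (rshift m i) with inl j => a j | inr j => b j end)
      *: w (rshift m i) = \sum_i b i *: u i.
    by apply: eq_bigr => i _; rewrite wr (unsplitK (inr i)).
  by rewrite opprD addrA.
Qed.

(** Both steps are finite by [sdim_exists], because dependence modulo W of too
    many vectors of V passes to a larger W and to a smaller V. *)
Lemma sdim_split V U W n : subspace V -> subspace U -> subspace W ->
  (forall x, U x -> V x) -> (forall x, W x -> U x) ->
  sdim V W n -> exists m k, [/\ sdim V U m, sdim U W k & (m + k)%N = n].
Proof.
move=> sV sU sW UV WU dV.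
have [m _ dm] : exists2 m, (m <= n)%N & sdim V U m.
  apply: sdim_exists => // v Vv.
  have [c c0 Wc] := sdim_dependent sW dV (ltnSn n) Vv.
  by exists c => //; apply: WU.
have [k _ dk] : exists2 k, (k <= n)%N & sdim U W k.
  apply: sdim_exists => // v Uv.
  by apply: (sdim_dependent sW dV) => // i; apply: UV.
exists m, k; split=> //.
exact: sdim_uniq sW (sdim_tower sU sW UV WU dm dk) dV.
Qed.

Lemma sdim_ext V W n V' W' : (forall x, V x <-> V' x) ->
  (forall x, W x <-> W' x) -> sdim V W n -> sdim V' W' n.
Proof.
move=> eV eW; have -> : V' = V by apply/funext => x; apply/propext; split=> /eV.
by have -> : W' = W by apply/funext => x; apply/propext; split=> /eW.
Qed.

Lemma sdim0 V : (forall x, V x -> x = 0) -> V 0 -> sdim V (fun x => x = 0) 0.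
Proof.
move=> hV V0; exists (fun _ => 0); split=> [[]//|c _ []//|x /hV->].
by exists (fun _ => 0); rewrite big_ord0 subr0.
Qed.

End Dimension.

Lemma linear_comb (F : fieldType) (E E' : lmodType F) (phi : {linear E -> E'})
    n (c : 'I_n -> F) (v : 'I_n -> E) :
  phi (\sum_i c i *: v i) = \sum_i c i *: phi (v i).
Proof. by rewrite linear_sum; apply: eq_bigr => i _; rewrite linearZ. Qed.

(** The linear map induces an isomorphism between the two quotients. *)
Lemma sdim_transfer (F : fieldType) (E E' : lmodType F) (phi : {linear E -> E'})
    (V W : E -> Prop) (V' W' : E' -> Prop) n :
  subspace V -> subspace W' ->
  (forall x, V x -> V' (phi x)) ->
  (forall x, V x -> (W x <-> W' (phi x))) ->
  (forall y, V' y -> exists2 x, V x & W' (y - phi x)) ->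
  sdim V W n -> sdim V' W' n.
Proof.
move=> sV sW' VV' WW' sur [v [Vv iv gv]].
exists (fun i => phi (v i)); split=> [i|c W'c|y V'y]; first exact: VV'.
- apply: iv; apply/WW'; first exact: subspace_comb.
  by rewrite linear_comb.
- have [x Vx W'x] := sur y V'y; have [c Wc] := gv x Vx; exists c.
  have -> : y - \sum_i c i *: phi (v i)
      = (y - phi x) + phi (x - \sum_i c i *: v i).
    by rewrite linearB (linear_comb phi) addrA subrK.
  have Vz : V (x - \sum_i c i *: v i).
    by apply: (subspaceB sV) => //; apply: subspace_comb.
  by apply: (subspaceD sW') => //; apply/(WW' _ Vz).
Qed.

(** Rank-nullity: in the tower 0 <= ker <= V the upper step is isomorphic to
    the image. *)
Lemma sdim_image (F : fieldType) (E E' : lmodType F) (phi : {linear E -> E'})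
    (V : E -> Prop) n k : subspace V ->
  sdim V (fun x => x = 0) n ->
  sdim (fun x => V x /\ phi x = 0) (fun x => x = 0) k ->
  (k <= n)%N /\
  sdim (fun y => exists2 x, V x & y = phi x) (fun y => y = 0) (n - k).
Proof.
move=> sV dV dK.
have s0 (G : lmodType F) : @subspace F G (fun x => x = 0).
  by split=> // c x y -> ->; rewrite scaler0 addr0.
have sK : subspace (fun x => V x /\ phi x = 0).
  split=> [|c x y [Vx px] [Vy py]]; first by rewrite linear0; case: sV.
  split; first by case: sV => _; apply.
  by rewrite linearP px py scaler0 addr0.
have [||m [k' [dm dk' <-]]] := sdim_split sV sK (s0 E) _ _ dV.
- by move=> x [].
- by move=> x ->; rewrite linear0; split=> //; case: sV.
rewrite (sdim_uniq (s0 E) dK dk') leq_addl addnK; split=> //.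
apply: (sdim_transfer (phi := phi)) dm => //.
- by move=> x Vx; exists x.
- by move=> x Vx; split=> [[]|].
- by move=> y [x Vx ->]; exists x; rewrite ?subrr.
Qed.

(** * Factorial domains and Gauss's lemma *)

Definition divides (A : comNzRingType) (a b : A) := exists c, b = c * a.

Section Factorial.

Variable A : idomainType.
Implicit Types (a b c p q : A) (ps : seq A).

Definition prime_elt p :=
  [/\ p != 0, p \isn't a GRing.unit
    & forall a b, divides p (a * b) -> divides p a \/ divides p b].

(** The number [k] of factors is the measure by which contents are extracted. *)
Definition prime_product k a := exists u ps,
  [/\ u \is a GRing.unit, forall p, p \in ps -> prime_elt p, size ps = k
    & a = u * \prod_(p <- ps) p].

(** The existence of factorisations into prime elements already characterises
    unique factorisation domains. *)
Definition factorial_ring := forall a, a != 0 -> exists k, prime_product k a.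

Lemma dividesMl c a b : divides a b -> divides a (c * b).
Proof. by case=> d ->; exists (c * d); rewrite mulrA. Qed.

Lemma dividesMr c a b : divides a b -> divides a (b * c).
Proof. by rewrite mulrC; apply: dividesMl. Qed.

Lemma dividesD a b c : divides a b -> divides a c -> divides a (b + c).
Proof. by case=> x -> [y ->]; exists (x + y); rewrite mulrDl. Qed.

Lemma dividesB a b c : divides a b -> divides a c -> divides a (b - c).
Proof. by case=> x -> [y ->]; exists (x - y); rewrite mulrBl. Qed.

Lemma divides_trans a b c : divides a b -> divides b c -> divides a c.
Proof. by case=> x -> [y ->]; exists (y * x); rewrite mulrA. Qed.

Lemma divides_unit a b : divides a b -> b \is a GRing.unit -> a \is a GRing.unit.
Proof. by case=> c ->; rewrite unitrM => /andP[]. Qed.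

Lemma prime_product_cons p k a :
  prime_elt p -> prime_product k a -> prime_product k.+1 (p * a).
Proof.
move=> pp [u [ps [uu hps <- ->]]]; exists u, (p :: ps); split=> //.
  by move=> q; rewrite inE => /predU1P[-> //|]; apply: hps.
by rewrite big_cons mulrCA.
Qed.

Lemma prime_productM k l a b :
  prime_product k a -> prime_product l b -> prime_product (k + l) (a * b).
Proof.
move=> [u [ps [uu hps <- ->]]] [v [qs [uv hqs <- ->]]].
exists (u * v), (ps ++ qs); split; rewrite ?size_cat ?unitrM ?uu //.
  by move=> p; rewrite mem_cat => /orP[]; [apply: hps|apply: hqs].
by rewrite big_cat /= mulrACA.
Qed.

(** The prime [p] is associated to one of the factors, which drops out. *)
Lemma prime_product_cancel k p a :
  prime_elt p -> prime_product k (p * a) -> prime_product k.-1 a.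
Proof.
move=> [p0 pu pp] [u [ps [uu hps <-]]].
elim: ps hps a => [|q ps IH] hps a.
  rewrite big_nil mulr1 => eu; move: uu; rewrite -eu unitrM.
  by rewrite (negPf pu).
rewrite big_cons mulrCA => epa.
have pq : prime_elt q by apply: hps; rewrite mem_head.
have hps' r : r \in ps -> prime_elt r.
  by move=> h; apply: hps; rewrite inE h orbT.
have /pp[[w qw]|[b eb]] : divides p (q * (u * \prod_(j <- ps) j)).
    by exists a; rewrite -epa mulrC.
- case: (pq) => q0 _ qq.
  have /qq[[z wz]|[z pz]] : divides q (w * p) by exists 1; rewrite mul1r.
    case/negP: pu; apply/unitrPr; exists z; apply: (mulfI q0).
    by rewrite mulr1 [RHS]qw wz; ring.
  have wu : w \is a GRing.unit.
    apply/unitrPr; exists z; apply: (mulIf q0).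
    by rewrite mul1r -mulrA -pz -qw.
  exists (w * u), ps; split; rewrite ?unitrM ?wu //.
  by apply: (mulfI p0); rewrite epa qw; ring.
- have ab : a = q * b by apply: (mulfI p0); rewrite epa eb; ring.
  have pb := IH hps' b (etrans (mulrC _ _) (esym eb)).
  rewrite ab /=; case: ps {epa hps IH hps'} eb pb => [|r ps] eb pb; last first.
    exact: prime_product_cons.
  case/negP: pu; apply: divides_unit uu; exists b.
  by rewrite -eb big_nil mulr1.
Qed.

(** Induction along a factorisation: the form in which factoriality is used
    from here on. *)
Lemma factorial_ind (P : A -> Prop) : factorial_ring ->
  (forall u, u \is a GRing.unit -> P u) ->
  (forall p a, prime_elt p -> a != 0 -> P a -> P (p * a)) ->
  forall a, a != 0 -> P a.
Proof.
move=> fA Pu Pp a /fA[_ [u [ps [uu hps _ ->]]]].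
elim: ps hps => [|p ps IH] hps; first by rewrite big_nil mulr1; apply: Pu.
have hps' r : r \in ps -> prime_elt r.
  by move=> h; apply: hps; rewrite inE h orbT.
rewrite big_cons mulrCA; apply: Pp.
- by apply: hps; rewrite mem_head.
- rewrite mulf_neq0 //; first by apply: contraTneq uu => ->; rewrite unitr0.
  by rewrite prodf_seq_neq0; apply/allP => r /hps'[].
- exact: IH.
Qed.

End Factorial.

Section Gauss.

Variable A : idomainType.
Implicit Types (a b c p : A) (f g h : {poly A}).

Lemma divides_polyC p f : divides p%:P f <-> forall i, divides p f`_i.
Proof.
split=> [[g ->] i|h]; first by exists g`_i; rewrite coefMC.
have [g hg] := choice h; exists (\poly_(i < size f) g i).
apply/polyP => i; rewrite coefMC coef_poly; case: ltnP => // le.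
by rewrite nth_default // mul0r.
Qed.

(** By induction on the sizes: [p] divides one of the two leading coefficients,
    and this leading term may be dropped. *)
Lemma prime_polyC p : prime_elt p -> prime_elt p%:P.
Proof.
move=> [p0 pu pp]; split; first by rewrite polyC_eq0.
  by rewrite poly_unitE coefC /= (negPf pu) andbF.
move=> f g; have [n] := ubnP (size f + size g); elim: n f g => // n IH f g.
have [->|f0] := eqVneq f 0; first by left; exists 0; rewrite mul0r.
have [->|g0] := eqVneq g 0; first by right; exists 0; rewrite mul0r.
rewrite ltnS => le pfg.
have tail (u : {poly A}) : u != 0 -> divides p (lead_coef u) ->
    exists u' : {poly A}, [/\ (size u' < size u)%N, divides p%:P (u - u')
                 & u = u' + (u - u')].
  move=> u0 pu'; exists (\poly_(i < (size u).-1) u`_i); split.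
  - by rewrite -[X in (_ < X)%N]prednK ?size_poly_gt0 // ltnS size_poly.
  - apply/divides_polyC => i; rewrite coefB coef_poly.
    case: ltnP => h; first by rewrite subrr; exists 0; rewrite mul0r.
    rewrite subr0; case: (ltnP i (size u)) => h'; last first.
      by rewrite nth_default //; exists 0; rewrite mul0r.
    suff -> : i = (size u).-1 by [].
    by apply/eqP; rewrite eqn_leq h andbT -ltnS prednK ?size_poly_gt0.
  - by rewrite addrC subrK.
have /pp : divides p (lead_coef f * lead_coef g).
  by rewrite -lead_coefM; apply: (divides_polyC p (f * g)).1 pfg _.
case=> [/(tail _ f0)|/(tail _ g0)] [u [lt du eu]].
- have dug : divides p%:P (u * g).
    have -> : u * g = f * g - (f - u) * g by ring.
    by apply: dividesB => //; apply: dividesMr.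
  have [|pu'|] := IH u g _ dug; last by right.
    by apply: leq_trans le; rewrite -addSn leq_add2r.
  by left; rewrite eu; apply: dividesD.
- have dfu : divides p%:P (f * u).
    have -> : f * u = f * g - f * (g - u) by ring.
    by apply: dividesB => //; apply: dividesMl.
  have [|pu'|] := IH f u _ dfu; last by right; rewrite eu; apply: dividesD.
    by apply: leq_trans le; rewrite -addnS leq_add2l.
  by left.
Qed.

Hypothesis fA : factorial_ring A.

Definition primitive f := forall p, prime_elt p -> ~ divides p%:P f.

Lemma primitive_part f : f != 0 ->
  exists c g, [/\ c != 0, f = c%:P * g & primitive g].
Proof.
move=> f0; have [k pf] : exists k, prime_product k (lead_coef f).
  by apply: fA; rewrite lead_coef_eq0.
elim: k f f0 pf => [|k IH] f f0 pf.
  exists 1, f; rewrite oner_neq0 mul1r; split=> // p [_ pu _].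
  move/divides_polyC/(_ (size f).-1) => pl; case/negP: pu.
  apply: divides_unit pl _; case: pf => u [ps [uu _ /size0nil->]].
  by rewrite big_nil mulr1 /lead_coef => ->.
have [pr|npr] := EM (primitive f).
  by exists 1, f; rewrite oner_neq0 mul1r.
have [p pp [g fg]] : exists2 p, prime_elt p & divides p%:P f.
  apply: contrapT => h; apply: npr => p pp dp; apply: h.
  by exists p.
have p0 : p != 0 by case: pp.
have g0 : g != 0 by apply: contraNneq f0 => g0; rewrite fg g0 mul0r.
have [|c [h [c0 gh ph]]] := IH g g0.
  apply: (@prime_product_cancel _ k.+1 p) => //.
  by move: pf; rewrite fg lead_coefM lead_coefC mulrC.
exists (p * c), h; split=> //; first by rewrite mulf_neq0.
by rewrite fg gh polyCM mulrC mulrA.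
Qed.

(** Gauss's lemma: denominators are cleared one prime at a time, each of them
    dividing one of the two factors. *)
Lemma clear_denominators c f g h : c != 0 -> c%:P * f = g * h ->
  exists a b g' h',
    [/\ a != 0, b != 0, g = a%:P * g', h = b%:P * h' & f = g' * h'].
Proof.
move=> c0; move: c c0 f g h; apply: (factorial_ind fA) => [u uu|p a pp a0 IH] f g h.
  have uK : u%:P * u^-1%:P = 1 :> {poly A} by rewrite -polyCM divrr.
  move=> e; exists u, 1, (u^-1%:P * g), h; split; rewrite ?oner_neq0 ?mul1r //.
  - by apply: contraTneq uu => ->; rewrite unitr0.
  - by rewrite mulrA uK mul1r.
  - by rewrite -mulrA -e mulrA [_ * u%:P]mulrC uK mul1r.
rewrite polyCM -mulrA => e.
have p0 : p != 0 by case: pp.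
have pP0 : p%:P != 0 :> {poly A} by rewrite polyC_eq0.
have [_ _ /(_ g h)] := prime_polyC pp.
case; first by exists (a%:P * f); rewrite -e mulrC.
- case=> g1 eg; have /IH : a%:P * f = g1 * h.
    by apply: (mulfI pP0); rewrite e eg; ring.
  move=> [b [c [g' [h' [b0 c0 eg1 eh ef]]]]].
  exists (p * b), c, g', h'; rewrite mulf_neq0 //; split=> //.
  by rewrite eg eg1 polyCM; ring.
- case=> h1 eh; have /IH : a%:P * f = g * h1.
    by apply: (mulfI pP0); rewrite e eh; ring.
  move=> [b [c [g' [h' [b0 c0 eg eh1 ef]]]]].
  exists b, (p * c), g', h'; rewrite mulf_neq0 //; split=> //.
  by rewrite eh eh1 polyCM; ring.
Qed.

(** The primes of [c] are cancelled one at a time: none divides [f]. *)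
Lemma primitive_divides c f g : primitive f -> c != 0 ->
  divides f (c%:P * g) -> divides f g.
Proof.
move=> pf c0; move: c c0 g; apply: (factorial_ind fA) => [u uu|p a pp a0 IH] g.
  case=> h e; exists (u^-1%:P * h); rewrite -mulrA -e mulrA -polyCM mulVr //.
  by rewrite mul1r.
rewrite polyCM -mulrA => -[h e]; apply: IH.
have p0 : p != 0 by case: pp.
have pP0 : p%:P != 0 :> {poly A} by rewrite polyC_eq0.
have [_ _ /(_ h f)] := prime_polyC pp.
case; first by exists (a%:P * g); rewrite -e mulrC.
- by case=> h1 eh; exists h1; apply: (mulfI pP0); rewrite e eh; ring.
- by move/pf=> /(_ pp).
Qed.

(** Pseudo-division is division over the field of fractions, where the gcd of
    [f] and a polynomial is, after clearing denominators, a constant or [f] up to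
    a constant. In the first case Euclid's lemma over that field applies. *)
Lemma primitive_prime f : primitive f -> (1 < size f)%N ->
  (forall g h, f = g * h -> (size g <= 1)%N \/ (size h <= 1)%N) ->
  prime_elt f.
Proof.
move=> pf sf irr; have f0 : f != 0 by rewrite -size_poly_gt0; apply: ltnW.
split=> //.
  by rewrite poly_unitE eqn_leq leqNgt sf.
move=> g h dgh; pose r := gcdp f g.
have [c c0 fr] : exists2 c, c != 0 & exists q, c%:P * f = q * r.
  have /Pdiv.Idomain.dvdpP[[c q] /= c0 e] := dvdp_gcdl f g.
  by exists c => //; exists q; rewrite mul_polyC.
have [q /clear_denominators] := fr; case/(_ c0) => a [b [q' [r' [a0 b0 eq er ef]]]].
have [sq|sr] := irr _ _ ef.
- left; have q'0 : q' != 0 by apply: contraNneq f0 => q0; rewrite ef q0 mul0r.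
  have eq' : q' = (q'`_0)%:P by apply: size1_polyC.
  have /Pdiv.Idomain.dvdpP[[d w] /= d0 e] := dvdp_gcdr f g.
  apply: (primitive_divides (c := q'`_0 * d)) => //.
    by rewrite mulf_neq0 // -polyC_eq0 -eq'.
  exists (w * b%:P); rewrite polyCM -eq' -mulrA mul_polyC e.
  by rewrite -/r er [X in _ = _ * X]ef; ring.
- right; have r0 : r' != 0 by apply: contraNneq f0 => q0; rewrite ef q0 mulr0.
  have co : coprimep f g.
    rewrite coprimep_def -/r er mul_polyC size_scale //.
    by rewrite eqn_leq sr size_poly_gt0.
  have : f %| g * h.
    by case: dgh => w ->; apply/Pdiv.Idomain.dvdpP; exists (1, w); rewrite ?oner_neq0 ?scale1r.
  rewrite mulrC Gauss_dvdpl // => /Pdiv.Idomain.dvdpP[[d w] /= d0 e].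
  by apply: (primitive_divides (c := d)) => //; exists w; rewrite mul_polyC.
Qed.

(** Take out the content, then split into factors of positive degree as long as
    possible. *)
Theorem factorial_poly : factorial_ring {poly A}.
Proof.
have const c : c != 0 -> exists k, prime_product k c%:P.
  move: c; apply: (factorial_ind fA) => [u uu|p a pp a0 [k pk]].
    exists 0, u%:P, [::]; split=> //; last by rewrite big_nil mulr1.
    have u0 : u != 0 by apply: contraTneq uu => ->; rewrite unitr0.
    by rewrite poly_unitE coefC /= size_polyC uu u0.
  by exists k.+1; rewrite polyCM; apply: prime_product_cons => //; apply: prime_polyC.
move=> f; have [n] := ubnP (size f); elim: n f => // n IH f.
rewrite ltnS => lef f0; have [c [g [c0 fg pg]]] := primitive_part f0.
have g0 : g != 0 by apply: contraNneq f0 => g0; rewrite fg g0 mulr0.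
have sfg : size f = size g by rewrite fg mul_polyC size_scale.
have [k pk] := const c c0.
suff [l pl] : exists l, prime_product l g.
  by exists (k + l); rewrite fg; apply: prime_productM.
have [sg|sg] := leqP (size g) 1.
  by rewrite (size1_polyC sg); apply: const; rewrite -polyC_eq0 -size1_polyC.
have [irr|] := EM (forall g1 h1, g = g1 * h1 -> (size g1 <= 1)%N \/ (size h1 <= 1)%N).
  exists 1; rewrite -[g]mulr1; apply: prime_product_cons.
    exact: primitive_prime.
  by exists 1, [::]; split; rewrite ?unitr1 ?big_nil ?mulr1.
move/existsNP=> [g1 /existsNP[h1 /not_implyP[e /not_orP[]]]].
move=> /negP; rewrite -ltnNge => s1 /negP; rewrite -ltnNge => s2.
have g10 : g1 != 0 by rewrite -size_poly_gt0; apply: ltnW.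
have h10 : h1 != 0 by rewrite -size_poly_gt0; apply: ltnW.
have sz : size g = (size g1 + size h1).-1 by rewrite e size_mul.
have [||k1 pk1] := IH g1; [by move: lef s1 s2; rewrite sfg sz; lia|by []|].
have [||k2 pk2] := IH h1; [by move: lef s1 s2; rewrite sfg sz; lia|by []|].
by exists (k1 + k2)%N; rewrite e; apply: prime_productM.
Qed.

End Gauss.

(** * Factoriality of polynomial rings; coprime elements *)

Section MpolyFactorial.

Lemma mpoly_ind_ring (A : comNzRingType) n (P : {mpoly A[n]} -> Prop) :
  (forall c, P c%:MP) -> (forall p q, P p -> P q -> P (p + q)) ->
  (forall i p, P p -> P ('X_i * p)) -> forall p, P p.
Proof.
move=> PC PD PX p; rewrite [p]mpolyE; elim/big_ind: _ => [||m _]; last 1 first.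
- rewrite -mul_mpolyC mpolyXE_id mulrC.
  elim/big_rec: _ => [|i q _ Pq]; first by rewrite mul1r; apply: PC.
  rewrite -mulrA; elim: (m i) => [|k IH]; first by rewrite expr0 mul1r.
  by rewrite exprS -mulrA; apply: PX.
- by rewrite -mpolyC0; apply: PC.
- exact: PD.
Qed.

Lemma factorial_iso (A B : idomainType) (phi : {rmorphism A -> B})
    (psi : {rmorphism B -> A}) : cancel phi psi -> cancel psi phi ->
  factorial_ring B -> factorial_ring A.
Proof.
move=> phiK psiK fB a a0.
have prime_psi p : prime_elt p -> prime_elt (psi p).
  move=> [p0 pu pp]; split.
  - by apply: contraNneq p0 => h; rewrite -[p]psiK h rmorph0.
  - by apply: contraNN pu => /(rmorph_unit phi); rewrite psiK.
  - move=> x y [c e].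
    have /pp : divides p (phi x * phi y).
      by exists (phi c); rewrite -rmorphM e rmorphM psiK.
    by case=> -[z ez]; [left|right]; exists (psi z); rewrite -rmorphM -ez phiK.
have fa0 : phi a != 0 by apply: contraNneq a0 => h; rewrite -[a]phiK h rmorph0.
have [k [u [ps [uu hps _ e]]]] := fB _ fa0.
exists (size ps), (psi u), (map psi ps); rewrite size_map; split=> //.
- exact: rmorph_unit.
- by move=> _ /mapP[p /hps/prime_psi ? ->].
- by rewrite -[a]phiK e rmorphM rmorph_prod big_map.
Qed.

Variable F : fieldType.

Lemma muni_widen n (p : {mpoly F[n]}) : muni (mwiden p) = p%:P.
Proof.
elim/mpoly_ind_ring: p => [c|p q|i p] /=.
- by rewrite mwidenC muniC.
- by move=> hp hq; rewrite !rmorphD /= hp hq.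
- move=> hp; rewrite !rmorphM /= hp; congr (_ * _).
  rewrite mwidenX mnmwiden1 /muni mmapX mmap1U.
  case: splitP => j /= e; first by congr ('X_ _)%:P; apply: val_inj.
  by have := ltn_ord i; rewrite e ltnNge leq_addr.
Qed.

Lemma muni_max n : muni ('X_ord_max : {mpoly F[n.+1]}) = 'X.
Proof.
rewrite /muni mmapX mmap1U; case: splitP => j //= e.
by have := ltn_ord j; rewrite -e ltnn.
Qed.

Lemma muni_bij n : exists (phi : {rmorphism {mpoly F[n.+1]} -> {poly {mpoly F[n]}}})
    (psi : {rmorphism {poly {mpoly F[n]}} -> {mpoly F[n.+1]}}),
  cancel phi psi /\ cancel psi phi.
Proof.
have [phi [phiX phiw]] : exists phi : {rmorphism {mpoly F[n.+1]} -> {poly {mpoly F[n]}}},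
    phi 'X_ord_max = 'X /\ forall p, phi (mwiden p) = p%:P.
  by exists (@muni n F); split; [apply: muni_max|apply: muni_widen].
have [psi [psiX psiw]] : exists psi : {rmorphism {poly {mpoly F[n]}} -> {mpoly F[n.+1]}},
    psi 'X = 'X_ord_max /\ forall p, psi p%:P = mwiden p.
  exists (horner_morph (fun p : {mpoly F[n]} => mulrC 'X_ord_max (mwiden p))).
  by split=> [|p]; [apply: horner_morphX|apply: horner_morphC].
exists phi, psi; split.
  elim/mpoly_ind_ring => [c|p q hp hq|i p hp].
  - by rewrite -mwidenC phiw psiw.
  - by rewrite (rmorphD phi) (rmorphD psi) hp hq.
  rewrite (rmorphM phi) (rmorphM psi) hp; congr (_ * _).
  case: (unliftP ord_max i) => [j ->|->]; last by rewrite phiX psiX.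
  have -> : 'X_(lift ord_max j) = mwiden 'X_j :> {mpoly F[n.+1]}.
    rewrite mwidenX mnmwiden1; congr 'X__; apply: val_inj.
    by rewrite /= /bump leqNgt ltn_ord.
  by rewrite phiw psiw.
elim/poly_ind => [|p c hp]; first by rewrite (rmorph0 psi) (rmorph0 phi).
rewrite (rmorphD psi) (rmorphD phi) (rmorphM psi) (rmorphM phi) hp.
by rewrite psiX phiX psiw phiw.
Qed.

Theorem factorial_mpoly n : factorial_ring {mpoly F[n]}.
Proof.
elim: n => [|n IH].
  move=> p p0; exists 0%N, p, [::]; rewrite big_nil mulr1; split=> //.
  have ep := nvar0_mpolyC p.
  have c0 : p@_0%MM != 0 by apply: contraNneq p0 => h; rewrite ep h.
  rewrite ep; apply: (rmorph_unit (@mpolyC 0 F)); by rewrite unitfE.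
have [phi [psi [phiK psiK]]] := muni_bij n.
exact: factorial_iso phiK psiK (factorial_poly IH).
Qed.

End MpolyFactorial.

Section Coprime.

Variable A : idomainType.
Hypothesis fA : factorial_ring A.
Implicit Types a b c p : A.

Definition coprime_elt a b := forall p, prime_elt p -> divides p a -> ~ divides p b.

(** Euclid's lemma, by cancelling the prime factors of [a] one at a time. *)
Lemma coprime_divides a b c : a != 0 -> coprime_elt a b ->
  divides a (c * b) -> divides a c.
Proof.
move=> a0; move: a a0 c; apply: (factorial_ind fA) => [u uu|p a pp a0 IH] c.
  by move=> _ _; exists (c * u^-1); rewrite -mulrA mulVr // mulr1.
move=> cop [d e].
have pb : ~ divides p b.
  by apply: cop => //; exists a; rewrite mulrC.
have [p0 _ /(_ c b)] := pp; case=> //; first by exists (d * a); rewrite e; ring.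
move=> [c' ec]; have [||d' e'] := IH c'.
- move=> q pq qa; apply: cop => //; exact: dividesMl.
- exists d; apply: (mulfI p0); transitivity (c * b); first by rewrite ec; ring.
  by rewrite e; ring.
- by exists d'; rewrite ec e'; ring.
Qed.

Lemma prime_divides_prime p q : prime_elt p -> prime_elt q -> divides p q ->
  divides q p.
Proof.
move=> [p0 pu _] [q0 _ qq] [w e].
have /qq[[z ez]|//] : divides q (w * p) by exists 1; rewrite mul1r e.
case/negP: pu; apply/unitrPr; exists z; apply: (mulfI q0).
by rewrite mulr1 [RHS]e ez; ring.
Qed.

(** Each prime factor of [a] rules out at most one [t]. *)
Lemma coprime_combination a b c : a != 0 ->
  (forall k : nat, (0 < k)%N -> k%:R \is a @GRing.unit A) ->
  (forall p, prime_elt p -> divides p a -> divides p b -> ~ divides p c) ->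
  exists t : nat, coprime_elt a (b + t%:R * c).
Proof.
move=> a0 ch0 nc; have [_ [u [ps [uu hps _ ea]]]] := fA a0.
have dps p : p \in ps -> divides p a.
  move=> pps; rewrite ea (big_rem p) //=; exists (u * \prod_(j <- rem p ps) j).
  by ring.
have [bad hbad] : exists bad : seq nat, forall t, t \notin bad ->
    forall p, p \in ps -> ~ divides p (b + t%:R * c).
  elim: ps hps dps {ea} => [|p ps IH] hps dps; first by exists [::].
  have [bad hbad] := IH (fun q h => hps q (@mem_behead _ (p :: ps) q h))
    (fun q h => dps q (@mem_behead _ (p :: ps) q h)).
  have pp : prime_elt p by apply: hps; rewrite mem_head.
  have pa : divides p a by apply: dps; rewrite mem_head.
  have [[t0 ht0]|no] := EM (exists t0 : nat, divides p (b + t0%:R * c)); last first.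
    exists bad => t /hbad h q; rewrite inE => /predU1P[->|]; last exact: h.
    by move=> dp; apply: no; exists t.
  exists (t0 :: bad) => t; rewrite inE negb_or => /andP[tt0 /hbad h] q.
  rewrite inE => /predU1P[->|]; last exact: h.
  move=> ht; have dc : divides p c.
    wlog lt : t t0 ht0 tt0 ht {h} / (t < t0)%N.
      move=> hw; case: (ltngtP t t0) => [l|l|e]; first exact: (hw t t0).
        by apply: (hw t0 t) => //; rewrite eq_sym.
      by rewrite e eqxx in tt0.
    have : divides p ((t0 - t)%:R * c).
      rewrite natrB 1?ltnW //.
      have -> : (t0%:R - t%:R) * c = (b + t0%:R * c) - (b + t%:R * c) by ring.
      exact: dividesB.
    move/(dividesMl (t0 - t)%:R^-1); rewrite mulrA mulVr ?mul1r //.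
    by apply: ch0; rewrite subn_gt0.
  apply: (nc p pp pa _ dc).
  have -> : b = (b + t%:R * c) - t%:R * c by ring.
  by apply: dividesB => //; apply: dividesMl.
exists (sumn bad).+1 => p pp.
have nbad : (sumn bad).+1 \notin bad.
  apply/negP => h; have : ((sumn bad).+1 <= sumn bad)%N; last by rewrite ltnn.
  move: h; move: (sumn bad).+1 => x; elim: bad {hbad} => //= y bad IH.
  by rewrite inE => /predU1P[->|/IH h]; [rewrite leq_addr|rewrite (leq_trans h) ?leq_addl].
rewrite ea => dpa dpc.
have {dpa} [q qps dpq] : exists2 q, q \in ps & divides p q.
  elim: ps {ea hbad hps dps} dpa => [|q ps IH].
    rewrite big_nil mulr1 => h; case: pp => _ /negP pu _; case: pu.
    exact: divides_unit h uu.
  have [_ _ ph] := pp.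
  rewrite big_cons mulrCA => /ph[h|/IH[r rps h]].
    by exists q; rewrite ?mem_head.
  by exists r; rewrite // inE rps orbT.
apply: (hbad _ nbad q qps); apply: divides_trans dpc.
by apply: prime_divides_prime => //; apply: hps.
Qed.

End Coprime.

(** * Graded pieces of ideals generated by forms of one degree *)

Section Graded.

Variables (F : fieldType) (m : nat).
Notation S := {mpoly F[m.+1]}.
Implicit Types (p q : S) (k n : nat).

Lemma subspace_homog k : subspace (fun p : S => p \is k.-homog).
Proof.
split; first exact: dhomog0.
by move=> c x y hx hy; apply: dhomogD => //; apply: dhomogZ.
Qed.

Lemma subspace_zero (E : lmodType F) : subspace (fun x : E => x = 0).
Proof. by split=> // c x y -> ->; rewrite scaler0 addr0. Qed.

Lemma sdim_homog k :
  sdim (fun p : S => p \is k.-homog) (fun p => p = 0) 'C(k + m, k).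
Proof.
pose b := [seq s2m t | t : k.-tuple 'I_m.+1 <- enum (basis m.+1 k)].
have szb : size b = 'C(k + m, k) by apply: size_basis.
have ub : uniq b by apply: uniq_basis.
have hb mm : (mdeg mm == k) = (mm \in b) by apply: basis_cover.
have sumE (c : 'X_{1..m.+1} -> F) :
    \sum_(i < 'C(k + m, k)) c (nth 0%MM b i) *: 'X_[nth 0%MM b i]
    = \sum_(mm <- b) c mm *: 'X_[mm] :> S.
  by rewrite (big_nth 0%MM) szb big_mkord.
have coefE (c : 'X_{1..m.+1} -> F) mm : mm \in b ->
    (\sum_(mm <- b) c mm *: 'X_[mm] : S)@_mm = c mm.
  move=> hm; rewrite raddf_sum /= (bigD1_seq mm) //= mcoeffZ mcoeffX eqxx mulr1.
  by rewrite big1 ?addr0 // => j ne; rewrite mcoeffZ mcoeffX (negPf ne) mulr0.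
exists (fun i => 'X_[nth 0%MM b i]); split.
- by move=> i; rewrite dhomogX hb mem_nth // szb.
- move=> c; pose c' mm := if insub (index mm b) is Some i then c i else 0.
  have c'E (i : 'I_('C(k + m, k))) : c' (nth 0%MM b i) = c i.
    rewrite /c' index_uniq ?szb // insubT //= => h; congr c; exact: val_inj.
  under eq_bigr do rewrite -c'E.
  rewrite sumE => h i; rewrite -c'E -coefE ?h ?mcoeff0 //.
  by rewrite mem_nth // szb.
- move=> p hp; exists (fun i => p@_(nth 0%MM b i)).
  rewrite (sumE (fun mm => p@_mm)); apply/eqP; rewrite subr_eq0; apply/eqP.
  apply/mpolyP => mm; case: (boolP (mm \in b)) => hm; first by rewrite coefE.
  rewrite (dhomog_nemf_coeff hp) ?hb //; apply/esym/memN_msupp_eq0.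
  apply: contra hm; rewrite mcoeff_msupp raddf_sum /= => h.
  apply: contraR h => hm; rewrite big_seq big1 // => j jb.
  rewrite mcoeffZ mcoeffX; case: eqP => [e|]; last by rewrite mulr0.
  by rewrite -e jb in hm.
Qed.

Lemma sdim_fin (E : lmodType F) (T : finType) (v : T -> E) (V W : E -> Prop) :
  (forall t, V (v t)) ->
  (forall c : T -> F, W (\sum_t c t *: v t) -> forall t, c t = 0) ->
  (forall x, V x -> exists c : T -> F, W (x - \sum_t c t *: v t)) ->
  sdim V W #|T|.
Proof.
move=> Vv iv gv; have re (G : T -> E) :
    \sum_t G t = \sum_(i < #|T|) G (enum_val i).
  by rewrite (reindex (@enum_val T T)) //; apply/onW_bij/enum_val_bij.
exists (fun i => v (enum_val i)); split=> // [c|x Vx].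
  move=> Wc j; rewrite -[j]enum_valK; apply: (iv (fun t => c (enum_rank t))).
  by rewrite re; under eq_bigr do rewrite enum_valK.
have [c Wc] := gv x Vx; exists (fun i => c (enum_val i)).
by rewrite -(re (fun t => c t *: v t)).
Qed.

Lemma subspace_tuple (E : lmodType F) (V : E -> Prop) r : subspace V ->
  subspace (fun h : {ffun 'I_r -> E} => forall i, V (h i)).
Proof.
move=> [V0 sV]; split=> [i|c x y hx hy i]; first by rewrite ffunE.
by rewrite !ffunE; apply: sV.
Qed.

Lemma sdim_tuple (E : lmodType F) (V : E -> Prop) r n : subspace V ->
  sdim V (fun x => x = 0) n ->
  sdim (fun h : {ffun 'I_r -> E} => forall i, V (h i)) (fun h => h = 0) (r * n).
Proof.
move=> sV [v [Vv iv gv]].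
have -> : (r * n)%N = #|{: 'I_r * 'I_n}| by rewrite card_prod !card_ord.
pose w (t : 'I_r * 'I_n) : {ffun 'I_r -> E} := [ffun i => if i == t.1 then v t.2 else 0].
have wE (c : 'I_r * 'I_n -> F) i :
    (\sum_t c t *: w t) i = \sum_j c (i, j) *: v j.
  rewrite sum_ffunE.
  transitivity (\sum_a \sum_b (c (a, b) *: w (a, b)) i).
    by rewrite pair_bigA; apply: eq_bigr => -[].
  rewrite (bigD1 i) //= [X in _ + X]big1 ?addr0 => [|a ne].
    by apply: eq_bigr => j _; rewrite !ffunE eqxx.
  by apply: big1 => b _; rewrite !ffunE eq_sym (negPf ne) scaler0.
apply: (sdim_fin (v := w)) => [t i|c h [i j]|h Vh].
- by rewrite ffunE; case: ifP => // _; case: sV.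
- by apply: (iv (fun j => c (i, j))); rewrite -wE h ffunE.
- have [c hc] := choice (fun i => gv (h i) (Vh i)).
  exists (fun t => c t.1 t.2); apply/ffunP => i.
  by rewrite !ffunE wE.
Qed.

Lemma homog_compM p q n k : q \is n.-homog ->
  pihomog mdeg (k + n) (p * q) = pihomog mdeg k p * q.
Proof.
move=> hq; have e := pihomog_partitionE (leqnn (msize p)).
rewrite {1}e mulr_suml raddf_sum /=.
rewrite (eq_bigr (fun d : 'I_(msize p) => if val d == k then pihomog mdeg k p * q else 0)).
  rewrite -big_mkcond /=; case: (ltnP k (msize p)) => h.
    by rewrite (big_pred1 (Ordinal h)) // => i; rewrite -val_eqE.
  rewrite big_pred0 => [|i]; last by apply/negbTE; rewrite neq_ltn (leq_trans (ltn_ord i) h).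
  rewrite (_ : pihomog mdeg k p = 0) ?mul0r // pihomogE big_seq_cond big1 // => mm.
  by move=> /andP[/msize_mdeg_lt lt /eqP e']; move: lt; rewrite e' ltnNge h.
move=> d _; have hd : pihomog mdeg d p * q \is (d + n).-homog.
  exact: dhomogM (pihomogP _ _ _) hq.
case: eqP => [<-|ne]; first by rewrite pihomog_dE.
by rewrite (pihomog_ne0 _ hd) // eqn_add2r; apply/eqP.
Qed.

Lemma homog_compM0 p q n k : q \is n.-homog -> (k < n)%N ->
  pihomog mdeg k (p * q) = 0.
Proof.
move=> hq lt; rewrite {1}(pihomog_partitionE (leqnn (msize p))) mulr_suml raddf_sum /=.
apply: big1 => d _; have hd : pihomog mdeg d p * q \is (d + n).-homog.
  exact: dhomogM (pihomogP _ _ _) hq.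
by rewrite (pihomog_ne0 _ hd) // gtn_eqF // ltn_addl.
Qed.

Section Generated.

Variables (r n : nat) (g : 'I_r -> S).

Definition generated p := exists h : 'I_r -> S, p = \sum_i h i * g i.

Lemma generatedD p q : generated p -> generated q -> generated (p + q).
Proof.
move=> [a ->] [b ->]; exists (fun i => a i + b i); rewrite -big_split /=.
by apply: eq_bigr => i _; rewrite mulrDl.
Qed.

Lemma generatedM c p : generated p -> generated (c * p).
Proof.
move=> [a ->]; exists (fun i => c * a i); rewrite mulr_sumr.
by apply: eq_bigr => i _; rewrite mulrA.
Qed.

Lemma generated_gen i : generated (g i).
Proof.
exists (fun j => (i == j)%:R); rewrite (bigD1 i) //= eqxx mul1r big1 ?addr0 // => j.
by rewrite eq_sym => /negPf->; rewrite mul0r.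
Qed.

Lemma subspace_generated : subspace generated.
Proof.
split; first by exists (fun _ => 0); rewrite big1 // => i _; rewrite mul0r.
move=> c x y hx hy; apply: generatedD => //; rewrite -mul_mpolyC.
exact: generatedM.
Qed.

Hypothesis hg : forall i, g i \is n.-homog.

Lemma generated_homog k p : generated p -> p \is (k + n).-homog ->
  exists2 h : {ffun 'I_r -> S}, forall i, h i \is k.-homog & p = \sum_i h i * g i.
Proof.
move=> [h ep] hp; exists [ffun i => pihomog mdeg k (h i)].
  by move=> i; rewrite ffunE; apply: pihomogP.
rewrite -[p](pihomog_dE hp) ep raddf_sum /=; apply: eq_bigr => i _.
by rewrite ffunE (homog_compM _ _ (hg i)).
Qed.

Lemma generated_homog0 k p : generated p -> p \is k.-homog -> (k < n)%N -> p = 0.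
Proof.
move=> [h ep] hp lt; rewrite -[p](pihomog_dE hp) ep raddf_sum /=.
by apply: big1 => i _; apply: homog_compM0 (hg i) lt.
Qed.

Lemma generated_comp k p : generated p -> generated (pihomog mdeg k p).
Proof.
move=> [h ->]; have [lt|le] := ltnP k n.
  rewrite raddf_sum /= big1; first by case: subspace_generated.
  by move=> i _; apply: homog_compM0 (hg i) lt.
exists (fun i => pihomog mdeg (k - n) (h i)); rewrite raddf_sum /=.
by apply: eq_bigr => i _; rewrite -{1}(subnK le) (homog_compM _ _ (hg i)).
Qed.

(** Rank-nullity for the map from the tuples of forms of degree [k] to the forms
    of degree [k + n] given by the generators. *)
Lemma sdim_quotient k z :
  sdim (fun h : {ffun 'I_r -> S} =>
    (forall i, h i \is k.-homog) /\ \sum_i h i * g i = 0) (fun h => h = 0) z ->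
  exists2 c, sdim (fun p => p \is (k + n).-homog) generated c &
    (c + r * 'C(k + m, k))%N = ('C(k + n + m, k + n) + z)%N.
Proof.
move=> dz.
pose phi (h : {ffun 'I_r -> S}) : S := \sum_i h i * g i.
have lphi : linear phi.
  move=> c x y; rewrite /phi scaler_sumr -big_split /=; apply: eq_bigr => i _.
  by rewrite !ffunE mulrDl scalerAl.
pose phiL : {linear {ffun 'I_r -> S} -> S} :=
  HB.pack phi (GRing.isLinear.Build F {ffun 'I_r -> S} S _ phi lphi).
have sT := subspace_tuple r (subspace_homog k).
have dT := sdim_tuple r (subspace_homog k) (sdim_homog k).
have [lez dI] := sdim_image (phi := phiL) sT dT dz.
have sI : subspace (fun p => generated p /\ p \is (k + n).-homog).
  split=> [|c x y [gx hx] [gy hy]]; first by split; [case: subspace_generated|apply: dhomog0].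
  by split; [case: subspace_generated => _; apply|case: (subspace_homog (k + n)) => _; apply].
have [||a [b [da db eab]]] := sdim_split (subspace_homog (k + n)) sI
    (subspace_zero S) _ _ (sdim_homog (k + n)).
- by move=> x [].
- by move=> x ->; case: sI.
have eb : b = (r * 'C(k + m, k) - z)%N.
  apply: sdim_uniq (subspace_zero S) db _.
  apply: sdim_ext dI => // x; split=> [[h hh ->]|[gx hx]]; last first.
    by have [h hh e] := generated_homog gx hx; exists h.
  split; first by exists h.
  by apply: rpred_sum => i _; apply: dhomogM.
exists a.
  apply: (sdim_transfer (phi := idfun)) da => //.
  - exact: subspace_homog.
  - exact: subspace_generated.
  - by move=> x hx; split=> [[]|].
  - by move=> x hx; exists x => //; rewrite subrr; case: subspace_generated.
by rewrite -eab eb -addnA; congr (_ + _)%N; rewrite subnK.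
Qed.

Lemma sdim_quotient_small k : (k < n)%N ->
  sdim (fun p => p \is k.-homog) generated 'C(k + m, k).
Proof.
move=> lt; apply: (sdim_transfer (phi := idfun)) (sdim_homog k) => //.
- exact: subspace_homog.
- exact: subspace_generated.
- move=> x hx; split=> [->|gx]; first by case: subspace_generated.
  exact: generated_homog0 gx hx lt.
- by move=> x hx; exists x => //; rewrite subrr; case: subspace_generated.
Qed.

End Generated.

End Graded.

Lemma quot_dim_sdim (F : fieldType) (V W : {mpoly F[3]} -> Prop) n :
  quot_dim (@mpolyC 3 F) V W n <-> sdim V W n.
Proof.
have e (c : 'I_n -> F) (v : 'I_n -> {mpoly F[3]}) :
    \sum_i (c i)%:MP * v i = \sum_i c i *: v i.
  by apply: eq_bigr => i _; rewrite mul_mpolyC.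
split=> -[v [Vv iv gv]]; exists v; split=> // [c|x /gv[c hc]].
- by rewrite -e; apply: iv.
- by exists c; rewrite -e.
- by rewrite e; apply: iv.
- by exists c; rewrite e.
Qed.

(** * The resolution in terms of the partial derivatives *)

Section Resolution.

Variable F : fieldType.
Notation S := {mpoly F[3]}.

Definition gradient (f : S) : 'cV[S]_3 := \col_i f^`M(i).

(** The resolution in coordinates adapted to the partial derivatives: the rows
    of [A] are the generating syzygies of the gradient, [l] their relation. *)
Definition syzygy_resolution (f : S) (e m : nat) (A : 'M[S]_3) (l : 'rV[S]_3) :=
  [/\ forall i j, A i j \is e.-homog,
      forall j, l ord0 j \is m.-homog,
      forall v : 'rV[S]_3, v *m gradient f = 0 <-> exists u : 'rV[S]_3, v = u *m A,
      forall u : 'rV[S]_3, u *m A = 0 <-> exists c : S, u = c *: l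
    & l != 0].

Lemma zhomogE (z : int) k (p : S) : z = Posz k -> zhomog z p -> p \is k.-homog.
Proof. by move=> ->. Qed.

Lemma homog0_const (p : S) : p \is 0.-homog -> p = (p@_0%MM)%:MP.
Proof.
move=> hp; apply/mpolyP => mm; rewrite mcoeffC.
have [->|ne] := eqVneq mm 0%MM; first by rewrite mulr1.
by rewrite mulr0 (dhomog_nemf_coeff hp) // mdeg_eq0.
Qed.

Lemma mx11_eq (x y : 'M[S]_1) : x ord0 ord0 = y ord0 ord0 -> x = y.
Proof. by move=> h; rewrite [x]mx11_scalar [y]mx11_scalar h. Qed.

Lemma homog_deriv n (p : S) i : p \is n.+1.-homog -> p^`M(i) \is n.-homog.
Proof.
move=> hp; apply/dhomogP => mm; rewrite mcoeff_msupp mcoeff_deriv => h.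
have : p@_(mm + U_(i)) != 0 by apply: contraNneq h => ->; rewrite mul0rn.
rewrite -mcoeff_msupp => /(dhomog_mf hp) e.
have {}e : mdeg (mm + U_(i)) = n.+1 := e.
by move: e; rewrite mdegD mdeg1 addn1 => -[].
Qed.

Lemma mulmx_cv (v : 'rV[S]_3) (w : 'cV[S]_3) :
  (v *m w) ord0 ord0 = \sum_j v ord0 j * w j ord0.
Proof. by rewrite mxE. Qed.

(** The first map of the resolution and the gradient express each other by
    matrices of constants. These are inverse to each other, because a constant
    matrix killing the first map has its rows in the image of the second, whose
    entries have positive degree. *)
Lemma syzygy_resolution_exists d e f ds b : d = (2 * e)%N -> (0 < e)%N ->
  f \is d.-homog -> has_min_resolution d f ds b -> (forall i, ds i = e%:Z) ->
  exists m A l, [/\ syzygy_resolution f e m A l, (0 < m)%N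
     & b = m%:Z + 1 - e%:Z].
Proof.
move=> dE e0 hf [A1 [A2 [A3 [[h1 h2 h3] [_ _ m3] inj3 [ex32 ex21] im1]]]] dsE.
pose n := (d - 1)%N.
have dn : d = n.+1 by rewrite /n dE; lia.
have {}h1 i j : A1 i j \is n.-homog.
  by apply: (zhomogE _ (h1 i j)); rewrite dn; lia.
have {}h2 i j : A2 i j \is e.-homog.
  by apply: (zhomogE _ (h2 i j)); rewrite dsE; lia.
have A30 : A3 != 0.
  apply/eqP => A30; have /inj3/matrixP/(_ ord0 ord0)/eqP : 1%:M *m A3 = 0.
    by rewrite A30 mulmx0.
  by rewrite !mxE eqxx oner_eq0.
have [j0 A3j] : exists j, A3 ord0 j != 0 by case/rV0Pn: A30 => j; exists j.
pose z := b + 2 * (d%:Z - 1) - (e%:Z + (d%:Z - 1)).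
have {}h3 i j : zhomog z (A3 i j) by have := h3 i j; rewrite dsE.
have [m zm] : exists m, z = Posz m.
  move: (h3 ord0 j0); case: (z) => [m _|k]; first by exists m.
  by move=> /= h; rewrite h eqxx in A3j.
have {}h3 i j : A3 i j \is m.-homog by apply: zhomogE (h3 i j).
have m0 : (0 < m)%N.
  rewrite lt0n; apply: contraNneq A3j => m0.
  by have := h3 ord0 j0; rewrite m0 => /homog0_const->; rewrite m3 mpolyC0.
have hG i : f^`M(i) \is n.-homog by apply: homog_deriv; rewrite -dn.
have /choice[B hB] i : exists v : 'rV[S]_3,
    (forall j, v ord0 j \is 0.-homog) /\ f^`M(i)%:M = v *m A1.
  have /im1[v ev] : jacobian f f^`M(i).
    exact: (generated_gen (fun i => f^`M(i))).
  exists (map_mx (pihomog mdeg 0) v); split=> [j|]; first by rewrite mxE; apply: pihomogP.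
  apply: mx11_eq; rewrite mulmx_cv mxE eqxx mulr1n -[LHS](pihomog_dE (hG i)).
  have -> : f^`M(i) = (v *m A1) ord0 ord0 by rewrite -ev mxE eqxx mulr1n.
  rewrite mulmx_cv raddf_sum /=; apply: eq_bigr => j _; rewrite mxE.
  by rewrite -(homog_compM (v ord0 j) 0 (h1 j ord0)) add0n.
have /choice[B' hB'] i : exists h : 'I_3 -> S,
    (forall j, h j \is 0.-homog) /\ A1 i ord0 = \sum_j h j * f^`M(j).
  have /im1 : exists v : 'rV[S]_3, (A1 i ord0)%:M = v *m A1.
    exists (delta_mx ord0 i); rewrite -rowE; apply: mx11_eq.
    by rewrite !mxE eqxx mulr1n.
  move=> gA; have [h hh e'] := generated_homog hG (k := 0) gA (h1 i ord0).
  by exists h.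
pose BM : 'M[S]_3 := \matrix_(i, j) B i ord0 j.
pose BM' : 'M[S]_3 := \matrix_(i, j) B' i j.
have GB : gradient f = BM *m A1.
  apply/colP => i; rewrite !mxE; have [_ /matrixP/(_ ord0 ord0)] := hB i.
  rewrite mulmx_cv mxE eqxx mulr1n => ->; apply: eq_bigr => j _.
  by rewrite !mxE.
have AB : A1 = BM' *m gradient f.
  apply/colP => i; rewrite !mxE (hB' i).2; apply: eq_bigr => j _.
  by rewrite !mxE.
have hom0 (C : 'M[S]_3) : C *m A1 = 0 -> (forall i j, C i j \is 0.-homog) -> C = 0.
  move=> CA hC; apply/row_matrixP => i.
  have /ex21[u eu] : row i C *m A1 = 0 by rewrite -row_mul CA row0.
  apply/rowP => j; rewrite !mxE -[LHS](pihomog_dE (hC i j)).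
  have -> : C i j = (u *m A2) ord0 j by rewrite -eu mxE.
  rewrite mxE raddf_sum /= big1 // => k _; exact: homog_compM0 (h2 k j) e0.
have BB : BM' *m BM = 1%:M.
  apply/eqP; rewrite -subr_eq0; apply/eqP; apply: hom0.
    by rewrite mulmxBl mul1mx -mulmxA -GB -AB subrr.
  move=> i j; rewrite !mxE; apply: rpredB.
    apply: rpred_sum => k _; rewrite !mxE; apply: (dhomogM (d := 0) (e := 0)).
      exact: (hB' i).1.
    exact: (hB k).1.
  by rewrite -mulr_natr mul1r; case: (i == j); [apply: dhomog1|apply: dhomog0].
have BB' := mulmx1C BB.
exists m, (A2 *m BM'), A3; split=> //; last first.
  by move: zm; rewrite /z; lia.
split=> //.
- move=> i j; rewrite mxE; apply: rpred_sum => k _; rewrite mxE -[e]addn0.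
  by apply: dhomogM; [apply: h2|apply: (hB' k).1].
- move=> v; rewrite GB mulmxA ex21; split=> -[u eu]; exists u.
    by rewrite mulmxA -eu -mulmxA BB' mulmx1.
  by rewrite eu -!mulmxA BB mulmx1.
- move=> u; have -> : u *m (A2 *m BM') = 0 <-> u *m A2 = 0.
    split=> [h|h]; last by rewrite mulmxA h mul0mx.
    by rewrite -[u *m A2]mulmx1 -BB !mulmxA -(mulmxA u) h mul0mx.
  rewrite ex32; split=> [[w ->]|[c ->]].
    by exists (w ord0 ord0); rewrite [w]mx11_scalar mul_scalar_mx mxE eqxx mulr1n.
  by exists c%:M; rewrite mul_scalar_mx.
Qed.

End Resolution.

(** * Hilbert functions of complete intersections and of the Milnor algebra *)

Lemma bin_square k : (2 * 'C(k + 2, k) = (k + 1) * (k + 2))%N.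
Proof.
rewrite -{2}[k](addnK 2) bin_sub ?leq_addl // bin2 mul2n -divn2.
have -> : ((k + 2) * (k + 2).-1 = (k + 1) * (k + 2))%N by rewrite addn2 /=; lia.
have : ~~ odd ((k + 1) * (k + 2)) by rewrite oddM !oddD /= addbF addbT andNb.
by rewrite divn2 => h; rewrite -[RHS]odd_double_half (negPf h).
Qed.

(** Up to a constant, 2 c is (2 m - 2) j, and [j] exceeds that constant and the
    bound [B]. *)
Lemma hilbert_growth (c e m B k0 : nat) (e0 : (0 < e)%N) (m2 : (1 < m)%N) j
 (hj : j = (k0 + B + 3 * (e + m + 2) * (e + m + 2))%N) (s1 s2 s3 s4 : nat)
 (h1 : (2 * s1 = (j + m + e + 1) * (j + m + e + 2))%N)
 (h2 : (2 * s2 = (j + 1) * (j + 2))%N)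
 (h3 : (2 * s3 = (j + m + e + (2 * e - 1) + 1) * (j + m + e + (2 * e - 1) + 2))%N)
 (h4 : (2 * s4 = (j + m + 1) * (j + m + 2))%N)
 (h5 : (c + 3 * s1 + s2 = s3 + 3 * s4)%N) : (B < c)%N.
Proof.
have he : (j + m + e + (2 * e - 1) + 1 = j + m + 3 * e)%N by lia.
have he2 : (j + m + e + (2 * e - 1) + 2 = j + m + 3 * e + 1)%N by lia.
rewrite he he2 in h3.
have [m' em] : exists m', m = m'.+2 by exists (m - 2)%N; lia.
have E : (2 * c + 3 * ((e + m + 1) * (e + m + 2)) + 2 + 2 * j = 2 * (m * j) + (3 * e + m) * (3 * e + m + 1) + 3 * ((m + 1) * (m + 2)))%N by lia.
have L : (2 * j + 2 * j <= 2 * (m * j))%N by rewrite em; lia.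
have L2 : ((e + m + 1) * (e + m + 2) <= (e + m + 2) * (e + m + 2))%N by apply: leq_mul; lia.
lia.
Qed.

Section Hilbert.

Variable F : fieldType.
Notation S := {mpoly F[3]}.

(** For a homogeneous ideal: the projective scheme that it defines is finite. *)
Definition bounded_codim (I : S -> Prop) := exists B k0 : nat,
  forall k, (k0 <= k)%N -> forall v : 'I_B.+1 -> S,
    (forall i, v i \is k.-homog) ->
    exists2 c : 'I_B.+1 -> F, (exists i, c i != 0) & I (\sum_i c i *: v i).

Lemma bounded_codimS (I I' : S -> Prop) : (forall p, I p -> I' p) ->
  bounded_codim I -> bounded_codim I'.
Proof.
move=> II' [B [k0 h]]; exists B, k0 => k le v hv.
by have [c c0 Ic] := h k le v hv; exists c => //; apply: II'.
Qed.

Lemma bounded_codim_sdim (I : S -> Prop) B k0 : subspace I ->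
  (forall k, (k0 <= k)%N -> sdim (fun p : S => p \is k.-homog) I B) ->
  bounded_codim I.
Proof.
move=> sI dI; exists B, k0 => k le v hv.
exact: sdim_dependent sI (dI k le) _ v (ltnSn B) hv.
Qed.

Lemma homog_divisor (p q : S) m k : p != 0 -> p \is m.-homog ->
  q * p \is (k + m).-homog -> pihomog mdeg k q = q.
Proof.
move=> p0 hp hqp; apply: (mulIf p0).
by rewrite -(homog_compM q k hp) pihomog_dE.
Qed.

Lemma homog_divisor0 (p q : S) m k : p != 0 -> p \is m.-homog ->
  q * p \is k.-homog -> (k < m)%N -> q = 0.
Proof.
move=> p0 hp hqp lt; apply: (mulIf p0).
by rewrite mul0r -[LHS](pihomog_dE hqp) (homog_compM0 q hp lt).
Qed.

(** The syzygies of a coprime pair are the multiples of the Koszul one, and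
    the Hilbert function of the quotient is eventually the Bezout number. *)
Lemma coprime_bounded (a b : S) n : a != 0 -> a \is n.-homog -> b \is n.-homog ->
  coprime_elt a b ->
  bounded_codim (generated (fun i : 'I_2 => if i == ord0 then a else b)).
Proof.
move=> a0 ha hb cop; set g := fun i : 'I_2 => if i == ord0 then a else b.
have hg i : g i \is n.-homog by rewrite /g; case: ifP.
have sumg (h : 'I_2 -> S) : \sum_i h i * g i = h ord0 * a + h ord_max * b.
  by rewrite !big_ord_recl big_ord0 addr0 /g /=; congr (_ + h _ * _); apply: val_inj.
apply: (bounded_codim_sdim (B := (n * n)%N) (k0 := (n + n)%N)).
  exact: subspace_generated.
move=> k le; pose j := (k - (n + n))%N.
have -> : k = (j + n + n)%N by rewrite /j; lia.
pose phi (c : S) : {ffun 'I_2 -> S} := [ffun i => if i == ord0 then - (c * b) else c * a].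
have lphi : linear phi.
  move=> c x y; apply/ffunP => i; rewrite !ffunE; case: ifP => _.
    by rewrite mulrDl -scalerAl opprD scalerN.
  by rewrite mulrDl -scalerAl.
pose phiL : {linear S -> {ffun 'I_2 -> S}} :=
  HB.pack phi (GRing.isLinear.Build F S {ffun 'I_2 -> S} _ phi lphi).
have dz : sdim (fun h : {ffun 'I_2 -> S} =>
    (forall i, h i \is (j + n).-homog) /\ \sum_i h i * g i = 0)
    (fun h => h = 0) 'C(j + 2, j).
  apply: (sdim_transfer (phi := phiL)) (sdim_homog F 2 j).
  - exact: subspace_homog.
  - exact: subspace_zero.
  - move=> c hc; split=> [i|]; last by rewrite sumg !ffunE /=; ring.
    by rewrite ffunE; case: ifP => _; [rewrite dhomogN|]; apply: dhomogM.
  - move=> c hc; split=> [->|]; first by rewrite linear0.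
    move/ffunP/(_ ord_max); rewrite !ffunE /= => /eqP.
    by rewrite mulf_eq0 (negPf a0) orbF => /eqP.
  - move=> h [hh]; rewrite sumg => e.
    have [c ec] : divides a (h ord_max).
      apply: (coprime_divides (@factorial_mpoly F 3) a0 cop).
      exists (- h ord0); apply/eqP; rewrite -subr_eq0 mulNr opprK addrC.
      exact/eqP.
    have hc : c \is j.-homog.
      rewrite homog_piE; apply/eqP; apply: (homog_divisor a0 ha).
      by rewrite -ec.
    exists c => //; apply/eqP; rewrite subr_eq0; apply/eqP/ffunP => i.
    rewrite ffunE; case: eqP => [->|/eqP ne].
      apply: (mulIf a0); apply/eqP; rewrite -subr_eq0 mulNr opprK.
      by rewrite mulrAC -ec e.
    rewrite -ec; congr (h _); apply: val_inj; case: i ne => -[|[|//]] //.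
have [c dc ec] := sdim_quotient hg dz.
have -> : (n * n)%N = c; last exact: dc.
have h1 := bin_square (j + n); have h2 := bin_square (j + n + n).
have h3 := bin_square j; nia.
Qed.

Section Milnor.

Variables (f : S) (e m : nat) (A : 'M[S]_3) (l : 'rV[S]_3).
Hypothesis e0 : (0 < e)%N.
Hypothesis hf : f \is (2 * e).-homog.
Hypothesis res : syzygy_resolution f e m A l.

Let n := (2 * e - 1)%N.

Lemma partial_homog i : f^`M(i) \is n.-homog.
Proof. by apply: homog_deriv; rewrite (_ : n.+1 = 2 * e)%N // /n; lia. Qed.

Definition homog_syzygy k (h : {ffun 'I_3 -> S}) :=
  (forall i, h i \is k.-homog) /\ \sum_i h i * f^`M(i) = 0.

Lemma syzygyE (h : 'I_3 -> S) : \sum_i h i * f^`M(i) = 0 <->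
  exists u : 'rV[S]_3, \row_i h i = u *m A.
Proof.
case: res => _ _ <- _ _; split=> [h0|/matrixP/(_ ord0 ord0)].
  apply: mx11_eq; rewrite mulmx_cv mxE -[RHS]h0; apply: eq_bigr => i _.
  by rewrite !mxE.
rewrite mulmx_cv mxE => h0; rewrite -[RHS]h0; apply: eq_bigr => i _.
by rewrite !mxE.
Qed.

Lemma syzygy_small k h : (k < e)%N -> homog_syzygy k h -> h = 0.
Proof.
move=> lt [hh /syzygyE[u eu]]; apply/ffunP => i; rewrite ffunE.
have := congr1 (fun M : 'rV[S]_3 => M ord0 i) eu; rewrite !mxE => ei.
rewrite -[LHS](pihomog_dE (hh i)) ei raddf_sum /= big1 // => j _.
by apply: homog_compM0 lt; case: res.
Qed.

Lemma sdim_syzygy_small k : (k < e)%N -> sdim (homog_syzygy k) (fun h => h = 0) 0.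
Proof.
move=> lt; apply: sdim0 => [h|]; first exact: syzygy_small.
split=> [i|]; first by rewrite ffunE; apply: dhomog0.
by rewrite big1 // => i _; rewrite ffunE mul0r.
Qed.

Definition mulA (u : {ffun 'I_3 -> S}) : {ffun 'I_3 -> S} :=
  [ffun j => \sum_i u i * A i j].

Lemma mulA_linear : linear mulA.
Proof.
move=> c x y; apply/ffunP => j; rewrite !ffunE scaler_sumr -big_split /=.
by apply: eq_bigr => i _; rewrite !ffunE mulrDl scalerAl.
Qed.

Definition mulAL : {linear {ffun 'I_3 -> S} -> {ffun 'I_3 -> S}} :=
  HB.pack mulA (GRing.isLinear.Build F {ffun 'I_3 -> S} {ffun 'I_3 -> S} _ mulA mulA_linear).

Lemma mulAE (u : {ffun 'I_3 -> S}) : (\row_i u i) *m A = \row_j mulA u j.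
Proof.
by apply/rowP => j; rewrite !mxE ffunE; apply: eq_bigr => i _; rewrite mxE.
Qed.

Lemma sdim_syzygy j z :
  sdim (fun u : {ffun 'I_3 -> S} => (forall i, u i \is j.-homog) /\ mulA u = 0)
    (fun u => u = 0) z ->
  (z <= 3 * 'C(j + 2, j))%N /\
  sdim (homog_syzygy (j + e)) (fun h => h = 0) (3 * 'C(j + 2, j) - z).
Proof.
case: res => hA _ _ _ _ dz.
have [lez dI] := sdim_image (phi := mulAL) (subspace_tuple 3 (subspace_homog F 2 j))
  (sdim_tuple 3 (subspace_homog F 2 j) (sdim_homog F 2 j)) dz.
split=> //; apply: sdim_ext dI => // h; split=> [[u hu ->]|[hh /syzygyE[u eu]]].
  split=> [i|].
    rewrite ffunE; apply: rpred_sum => k _; exact: dhomogM.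
  by apply/syzygyE; exists (\row_i u i); rewrite mulAE.
exists [ffun i => pihomog mdeg j (u ord0 i)] => [i|].
  by rewrite ffunE; apply: pihomogP.
apply/ffunP => i; rewrite ffunE.
have := congr1 (fun M : 'rV[S]_3 => M ord0 i) eu; rewrite !mxE => ei.
rewrite -[LHS](pihomog_dE (hh i)) ei raddf_sum /=; apply: eq_bigr => k _.
by rewrite ffunE (homog_compM _ _ (hA k i)).
Qed.

Lemma relationE (u : {ffun 'I_3 -> S}) : mulA u = 0 <-> exists c, u = [ffun i => c * l ord0 i].
Proof.
case: res => _ _ _ ker _; have := ker (\row_i u i); rewrite mulAE => h.
split=> [u0|[c eu]].
  have [|c ec] := h.1; first by apply/rowP => i; rewrite u0 !mxE ffunE.
  exists c; apply/ffunP => i; have := congr1 (fun M : 'rV[S]_3 => M ord0 i) ec.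
  by rewrite !mxE ffunE.
have /rowP uA : (\row_i u i) *m A = 0.
  apply/ker; exists c; apply/rowP => i; rewrite !mxE eu ffunE //.
apply/ffunP => i; have := uA i; rewrite mulAE !mxE => ->.
by rewrite ffunE.
Qed.

Lemma relation_homog j (u : {ffun 'I_3 -> S}) : (forall i, u i \is j.-homog) -> mulA u = 0 ->
  (j < m)%N -> u = 0.
Proof.
case: res => _ hl _ _ l0 hu /relationE[c eu] lt.
have [i0 li] : exists i, l ord0 i != 0 by case/rV0Pn: l0 => i; exists i.
have c0 : c = 0.
  apply: (homog_divisor0 li (hl i0) _ lt).
  by have := hu i0; rewrite eu ffunE.
by apply/ffunP => i; rewrite eu !ffunE c0 mul0r.
Qed.

Lemma sdim_relation_small j : (j < m)%N ->
  sdim (fun u : {ffun 'I_3 -> S} => (forall i, u i \is j.-homog) /\ mulA u = 0)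
    (fun u => u = 0) 0.
Proof.
move=> lt; apply: sdim0 => [u [hu u0]|]; first exact: relation_homog lt.
split=> [i|]; first by rewrite ffunE; apply: dhomog0.
by apply/relationE; exists 0; apply/ffunP => i; rewrite !ffunE mul0r.
Qed.

Lemma sdim_relation j :
  sdim (fun u : {ffun 'I_3 -> S} => (forall i, u i \is (j + m).-homog) /\ mulA u = 0)
    (fun u => u = 0) 'C(j + 2, j).
Proof.
case: res => _ hl _ _ l0.
have [i0 li] : exists i, l ord0 i != 0 by case/rV0Pn: l0 => i; exists i.
pose phi (c : S) : {ffun 'I_3 -> S} := [ffun i => c * l ord0 i].
have lphi : linear phi.
  by move=> c x y; apply/ffunP => i; rewrite !ffunE mulrDl -scalerAl.
pose phiL : {linear S -> {ffun 'I_3 -> S}} :=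
  HB.pack phi (GRing.isLinear.Build F S {ffun 'I_3 -> S} _ phi lphi).
apply: (sdim_transfer (phi := phiL)) (sdim_homog F 2 j).
- exact: subspace_homog.
- exact: subspace_zero.
- move=> c hc; split=> [i|]; first by rewrite ffunE; apply: dhomogM.
  by apply/relationE; exists c.
- move=> c hc; split=> [->|]; first by rewrite linear0.
  move/ffunP/(_ i0); rewrite !ffunE => /eqP.
  by rewrite mulf_eq0 (negPf li) orbF => /eqP.
- move=> u [hu /relationE[c eu]]; exists c; last by rewrite eu subrr.
  rewrite homog_piE; apply/eqP; apply: (homog_divisor li (hl i0)).
  by have := hu i0; rewrite eu ffunE.
Qed.

Let J := generated (fun i : 'I_3 => f^`M(i)).

Lemma milnor_tiny k : (k < n)%N ->
  sdim (fun p => p \is k.-homog) J 'C(k + 2, k).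
Proof. by move=> lt; apply: (sdim_quotient_small partial_homog lt). Qed.

Lemma milnor_small k : (k < e)%N ->
  exists2 c, sdim (fun p => p \is (k + n).-homog) J c &
    (c + 3 * 'C(k + 2, k) = 'C(k + n + 2, k + n))%N.
Proof.
move=> lt; have [c dc ec] := sdim_quotient partial_homog (sdim_syzygy_small lt).
by exists c => //; rewrite ec addn0.
Qed.

Lemma milnor_middle j : (j < m)%N ->
  exists2 c, sdim (fun p => p \is (j + e + n).-homog) J c &
    (c + 3 * 'C(j + e + 2, j + e) = 'C(j + e + n + 2, j + e + n) + 3 * 'C(j + 2, j))%N.
Proof.
move=> lt; have [_ dz] := sdim_syzygy (sdim_relation_small lt).
have [c dc ec] := sdim_quotient partial_homog dz.
by exists c => //; rewrite ec subn0.
Qed.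

Lemma milnor_large j :
  exists2 c, sdim (fun p => p \is (j + m + e + n).-homog) J c &
    (c + 3 * 'C(j + m + e + 2, j + m + e) + 'C(j + 2, j)
      = 'C(j + m + e + n + 2, j + m + e + n) + 3 * 'C(j + m + 2, j + m))%N.
Proof.
have [lez dz] := sdim_syzygy (sdim_relation j).
have [c dc ec] := sdim_quotient partial_homog dz.
exists c => //; rewrite ec -addnA subnK //.
Qed.

(** The Hilbert function grows like (m - 1) k. *)
Lemma bounded_linear_relation : (0 < m)%N -> bounded_codim J -> m = 1%N.
Proof.
move=> m0 [B [k0 bd]]; apply/eqP; rewrite eqn_leq m0 andbT leqNgt; apply/negP => m2.
pose j := (k0 + B + 3 * (e + m + 2) * (e + m + 2))%N.
have [c dc ec] := milnor_large j.
suff le : (B < c)%N.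
  have [v [hv iv _]] := dc.
  have [|a [i /eqP ai]] := bd (j + m + e + n)%N _ (fun i => v (widen_ord le i)) (fun i => hv _).
    by rewrite /j; lia.
  move=> Ja; apply: ai.
  pose a' (i : 'I_c) := if insub (val i) is Some i' then a i' else 0.
  have a'w i' : a' (widen_ord le i') = a i'.
    by rewrite /a' insubT //= => hi; congr a; apply: val_inj.
  rewrite -a'w; apply: (iv a').
  rewrite (bigID (fun i : 'I_c => (i < B.+1)%N)) /= [X in _ + X]big1 => [|i' hi].
    rewrite addr0 (big_ord_narrow le).
    by under eq_bigr do rewrite a'w.
  by rewrite /a' insubN // scale0r.
exact: (hilbert_growth e0 m2 (erefl j) (bin_square _) (bin_square _) (bin_square _)
  (bin_square _) ec).
Qed.

End Milnor.

End Hilbert.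

(** * Reduced curves have finite singular scheme *)

Section Derivatives.

Variables (F : numFieldType) (n : nat).
Notation S := {mpoly F[n]}.

Lemma euler d (f : S) : f \is d.-homog -> \sum_i 'X_i * f^`M(i) = d%:R *: f.
Proof.
move=> hf; rewrite [in RHS](mpolyE f) scaler_sumr.
under eq_bigr do rewrite {1}(mpolyE f) raddf_sum mulr_sumr /=.
rewrite exchange_big /= big_seq [RHS]big_seq; apply: eq_bigr => m hm.
have dm : mdeg m = d by apply: (dhomog_mf hf).
transitivity (\sum_(i < n) (m i)%:R *: (f@_m *: 'X_[m] : S)).
  apply: eq_bigr => i _; rewrite mderivZ mderivX.
  have [->|mi] := eqVneq (m i) 0%N; first by rewrite !scale0r scaler0 mulr0.
  rewrite -!scalerAr scalerA mulrC -scalerA; congr (_ *: (_ *: _)).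
  by rewrite -mpolyXD addmC submK // lep1mP.
by rewrite -scaler_suml -natr_sum -mdegE dm.
Qed.

Lemma msize_deriv (p : S) i : p != 0 -> (msize p^`M(i) < msize p)%N.
Proof.
move=> p0; have [->|q0] := eqVneq (p^`M(i)) 0.
  by rewrite msize0 lt0n msize_poly_eq0.
have : (mdeg (mlead p^`M(i) + U_(i)) < msize p)%N; last first.
  by rewrite mdegD mdeg1 addn1 mlead_deg.
apply: msize_mdeg_lt; have := mlead_supp q0; rewrite !mcoeff_msupp mcoeff_deriv.
by apply: contraNneq => ->; rewrite mul0rn.
Qed.

Lemma divides_deriv0 (p : S) i : p != 0 -> divides p p^`M(i) -> p^`M(i) = 0.
Proof.
move=> p0 [c e]; apply: contraTeq isT => q0 /=.
have c0 : c != 0 by apply: contraNneq q0 => c0; rewrite e c0 mul0r.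
have := msize_deriv i p0; rewrite e msizeM // (mpolySpred mdeg c0) addSn /=.
by rewrite ltnNge leq_addl.
Qed.

Lemma deriv0_const (p : S) : (forall i, p^`M(i) = 0) -> p = (p@_0%MM)%:MP.
Proof.
move=> dp; apply/mpolyP => m; rewrite mcoeffC.
have [->|m0] := eqVneq m 0%MM; first by rewrite mulr1.
rewrite mulr0; have [i mi] : exists i, m i != 0%N.
  apply: contrapT => h; case/eqP: m0; apply/mnmP => i; rewrite mnm0E.
  by apply: contrapT => /eqP mi; apply: h; exists i.
have := congr1 (mcoeff (m - U_(i))%MM) (dp i).
rewrite mcoeff_deriv mcoeff0 submK ?lep1mP // => /eqP.
by rewrite -mulr_natl mulf_eq0 pnatr_eq0 => /eqP.
Qed.

Lemma natr_unit_mpoly (k : nat) : (0 < k)%N -> k%:R \is a @GRing.unit S.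
Proof.
move=> k0; rewrite -mpolyC_nat; apply: rmorph_unit.
by rewrite unitfE pnatr_eq0 -lt0n.
Qed.

End Derivatives.

Section Reduced.

Variable F : numFieldType.
Notation S := {mpoly F[3]}.

Definition no_common_factor (f : S) :=
  forall p : S, prime_elt p -> ~ forall i, divides p f^`M(i).

(** If a prime [h] divides all partials it divides [f] by Euler's relation,
    and then twice, since it cannot divide all of its own partials. *)
Lemma reduced_no_common_factor d (f : S) : reduced_curve d f -> no_common_factor f.
Proof.
move=> [d0 hf f0 sqf] h hp hd; have [h0 hu hprime] := hp.
have dS : d%:R \is a @GRing.unit S by apply: natr_unit_mpoly.
have [u fu] : divides h f.
  have : divides h (d%:R * f).
    rewrite mulr_natl -scaler_nat -(euler hf) !big_ord_recl big_ord0 addr0.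
    by apply: dividesD; [|apply: dividesD]; apply: dividesMl.
  move/(dividesMl d%:R^-1); by rewrite mulrA mulVr // mul1r.
have [v uv] : divides h u.
  apply: contrapT => nhu.
  have hi i : h^`M(i) = 0.
    apply: divides_deriv0 => //.
    have : divides h (u * h^`M(i)).
      have -> : u * h^`M(i) = f^`M(i) - u^`M(i) * h by rewrite fu mderivM; ring.
      by apply: dividesB => //; exists u^`M(i).
    by case/hprime.
  case/negP: hu; rewrite (deriv0_const hi); apply: rmorph_unit.
  by rewrite unitfE; apply: contraNneq h0 => e; rewrite (deriv0_const hi) e.
have [c hc] : exists c : F, h = c%:MP by apply: (sqf h v); rewrite fu uv; ring.
case/negP: hu; rewrite hc; apply: rmorph_unit.
by rewrite unitfE; apply: contraNneq h0 => e; rewrite hc e.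
Qed.

Lemma coprime_pair (f : S) i : f^`M(i) != 0 -> no_common_factor f ->
  exists t : nat, coprime_elt f^`M(i) (f^`M(lift i ord0) + t%:R * f^`M(lift i ord_max)).
Proof.
move=> fi nc; apply: coprime_combination => //.
- exact: factorial_mpoly.
- exact: natr_unit_mpoly.
move=> p pp p0 p1 p2; apply: (nc p pp) => j.
case: (unliftP i j) => [k|] -> //; case: k => -[|[|//]] hk.
  by rewrite (_ : Ordinal hk = ord0) //; apply: val_inj.
by rewrite (_ : Ordinal hk = ord_max) //; apply: val_inj.
Qed.

Lemma jacobian_bounded n (f : S) i : (forall j, f^`M(j) \is n.-homog) ->
  f^`M(i) != 0 -> no_common_factor f -> bounded_codim (jacobian f).
Proof.
move=> hp fi nc; have [t cop] := coprime_pair fi nc.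
have hb : f^`M(lift i ord0) + t%:R * f^`M(lift i ord_max) \is n.-homog.
  by apply: rpredD => //; rewrite mulr_natl; apply: rpredMn.
apply: bounded_codimS (coprime_bounded fi (hp i) hb cop) => p [h ->].
rewrite !big_ord_recl big_ord0 addr0 /=.
have g0 := generated_gen (fun i => f^`M(i)).
have gD := @generatedD F 2 3 (fun i => f^`M(i)).
have gM := @generatedM F 2 3 (fun i => f^`M(i)).
by apply: (gD); apply: (gM); [apply: g0|apply: (gD); [apply: g0|apply: gM]].
Qed.

Lemma reduced_partial_neq0 d (f : S) : reduced_curve d f -> exists i, f^`M(i) != 0.
Proof.
move=> [d0 hf f0 _]; apply: contrapT => h; case/eqP: f0.
have h0 i : f^`M(i) = 0 by apply: contrapT => /eqP hi; apply: h; exists i.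
have := euler hf; rewrite big1 => [/esym/eqP|i _]; last by rewrite h0 mulr0.
by rewrite scaler_eq0 pnatr_eq0 -leqn0 leqNgt d0 => /eqP.
Qed.

End Reduced.

(** * Exactness of the Koszul complex of the variables *)

Definition i0 : 'I_3 := @Ordinal 3 0 isT.
Definition i1 : 'I_3 := @Ordinal 3 1 isT.
Definition i2 : 'I_3 := @Ordinal 3 2 isT.

Lemma ord3P (P : 'I_3 -> Prop) : P i0 -> P i1 -> P i2 -> forall i, P i.
Proof.
move=> h0 h1 h2 [[|[|[|//]]] hi].
- by rewrite (_ : Ordinal hi = i0) //; apply: val_inj.
- by rewrite (_ : Ordinal hi = i1) //; apply: val_inj.
- by rewrite (_ : Ordinal hi = i2) //; apply: val_inj.
Qed.

Lemma sum3 (V : nmodType) (G : 'I_3 -> V) : \sum_i G i = G i0 + G i1 + G i2.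
Proof.
rewrite !big_ord_recl big_ord0 addr0 addrA.
by congr (G _ + G _ + G _); apply: val_inj.
Qed.

Section Koszul.

Variable F : fieldType.
Notation S := {mpoly F[3]}.

Definition ideal_closed (n : nat) (I : {mpoly F[n]} -> Prop) :=
  [/\ I 0, forall p q, I p -> I q -> I (p + q) & forall c p, I p -> I (c * p)].

Definition subst n k (s : 'I_n -> {mpoly F[k]}) : {mpoly F[n]} -> {mpoly F[k]} :=
  comp_mpoly [tuple s i | i < n].

HB.instance Definition _ n k (s : 'I_n -> {mpoly F[k]}) :=
  GRing.RMorphism.on (subst s).

Lemma substX n k (s : 'I_n -> {mpoly F[k]}) i : subst s 'X_i = s i.
Proof. by rewrite /subst comp_mpolyXU -tnth_nth tnth_mktuple. Qed.

Lemma substC n k (s : 'I_n -> {mpoly F[k]}) c : subst s c%:MP = c%:MP.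
Proof. exact: comp_mpolyC. Qed.

(** The substitution is the identity modulo the ideal, since it is so on the
    variables. *)
Lemma subst_congr n (I : {mpoly F[n]} -> Prop) (s : 'I_n -> {mpoly F[n]}) :
  ideal_closed I -> (forall i, I ('X_i - s i)) -> forall p, I (p - subst s p).
Proof.
move=> [I0 ID IM] Is; elim/mpoly_ind_ring => [c|p q hp hq|i p hp].
- by rewrite substC subrr.
- by rewrite rmorphD opprD addrACA; apply: ID.
rewrite rmorphM /= substX.
have -> : 'X_i * p - s i * subst s p = p * ('X_i - s i) + s i * (p - subst s p) by ring.
by apply: ID; apply: IM.
Qed.

Lemma ideal_divides n (a : {mpoly F[n]}) : ideal_closed (divides a).
Proof.
split; first by exists 0; rewrite mul0r.
- by move=> p q [x ->] [y ->]; exists (x + y); rewrite mulrDl.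
- by move=> c p [x ->]; exists (c * x); rewrite mulrA.
Qed.

(** The substitution solves the equation of the linear form for ['X_i]; it kills
    the left side of the last hypothesis, hence [b], but not [d]. *)
Lemma linear_form_divides n (i : 'I_n) (s : 'I_n -> {mpoly F[n]}) (a b d : {mpoly F[n]}) :
  (forall j, j != i -> s j = 'X_j) -> subst s ('X_i - s i) = 0 -> subst s d != 0 ->
  ('X_i - s i) * a = d * b -> divides ('X_i - s i) b.
Proof.
move=> sj si sd e; have : subst s d * subst s b = 0.
  by rewrite -rmorphM -e rmorphM /= si mul0r.
move/eqP; rewrite mulf_eq0 (negPf sd) /= => /eqP sb.
rewrite -[b]subr0 -sb; apply: (subst_congr (ideal_divides _)) => j.
have [->|/sj->] := eqVneq j i; first by exists 1; rewrite mul1r.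
by rewrite subrr; exists 0; rewrite mul0r.
Qed.

Lemma variable_divides n (i j : 'I_n) (a b : {mpoly F[n]}) : i != j ->
  'X_i * a = 'X_j * b -> divides 'X_i b.
Proof.
move=> ij e; pose s k := if k == i then 0 else 'X_k : {mpoly F[n]}.
have := @linear_form_divides n i s a b 'X_j; rewrite /s eqxx subr0; apply => //.
- by move=> k /negPf->.
- by rewrite substX eqxx.
- rewrite substX (eq_sym j) (negPf ij); apply/eqP => /(congr1 (mcoeff U_(j)))/eqP.
  by rewrite mcoeffXU eqxx mcoeff0 oner_eq0.
Qed.

Lemma mpolyX_neq0 n (i : 'I_n) : 'X_i != 0 :> {mpoly F[n]}.
Proof.
apply/eqP => /(congr1 (mcoeff U_(i)))/eqP.
by rewrite mcoeffXU eqxx mcoeff0 oner_eq0.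
Qed.

Definition Xcol : 'cV[S]_3 := \col_i 'X_i.
Definition Xrow : 'rV[S]_3 := \row_i 'X_i.

(** The matrix of the cross product with [w]. *)
Definition cross (w : 'I_3 -> S) : 'M[S]_3 :=
  \matrix_(i, j) (nth [::] [:: [:: 0; - w i2; w i1];
                              [:: w i2; 0; - w i0];
                              [:: - w i1; w i0; 0]] i)`_j.

Definition koszul := cross (fun i => 'X_i).

Lemma koszulX : koszul *m Xcol = 0.
Proof.
apply/colP; apply: ord3P; rewrite mxE sum3 !mxE /=; ring.
Qed.

Lemma Xkoszul : Xrow *m koszul = 0.
Proof. by apply/rowP; apply: ord3P; rewrite mxE sum3 !mxE /=; ring. Qed.

Lemma cross_swap (c : 'I_3 -> F) :
  koszul *m (\col_i (c i)%:MP) = - (cross (fun i => (c i)%:MP) *m Xcol).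
Proof.
by apply/colP; apply: ord3P; rewrite [LHS]mxE [RHS]mxE mxE !sum3 !mxE /=; ring.
Qed.

Lemma koszul_exact0 (w : 'cV[S]_3) : koszul *m w = 0 -> exists p, w = p *: Xcol.
Proof.
move/colP => h; have := h i1; have := h i2.
rewrite !mxE !sum3 !mxE /= => h2 h1.
have [p ep] : divides 'X_i0 (w i0 ord0).
  apply: (@variable_divides _ i0 i1 (w i1 ord0)) => //; apply/eqP.
  by rewrite -subr_eq0 -h2; apply/eqP; ring.
exists p; apply/colP; apply: ord3P; rewrite !mxE //.
- apply: (mulfI (mpolyX_neq0 i0)); apply/eqP; rewrite -subr_eq0 -h2; apply/eqP.
  by rewrite ep; ring.
- apply: (mulfI (mpolyX_neq0 i0)); apply/eqP; rewrite -subr_eq0.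
  rewrite -[X in _ == X]oppr0 -h1; apply/eqP.
  by rewrite ep; ring.
Qed.

(** Modulo the first two variables the relation says that the third entry
    vanishes, so it is X0 a + X1 b; what remains is a relation between X0 and X1
    alone. *)
Lemma koszul_exact1 (w : 'cV[S]_3) : Xrow *m w = 0 -> exists h, w = koszul *m h.
Proof.
move/matrixP/(_ ord0 ord0); rewrite mxE sum3 !mxE => e.
pose s k := if k == i2 then 'X_i2 else 0 : S.
pose I (p : S) := exists a b, p = 'X_i0 * a + 'X_i1 * b.
have [a [b ew]] : I (w i2 ord0).
  have sw : subst s (w i2 ord0) = 0.
    have := congr1 (subst s) e; rewrite !rmorphD !rmorphM /= !substX /s /= !mul0r !add0r.
    by rewrite rmorph0 => /eqP; rewrite mulf_eq0 (negPf (mpolyX_neq0 _)) => /eqP.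
  rewrite -[w i2 ord0]subr0 -sw; apply: subst_congr.
    split; first by exists 0, 0; ring.
    - by move=> p q [x [y ->]] [x' [y' ->]]; exists (x + x'), (y + y'); ring.
    - by move=> c p [x [y ->]]; exists (c * x), (c * y); ring.
  apply: ord3P; rewrite /s /= ?subr0 ?subrr.
  - by exists 1, 0; ring.
  - by exists 0, 1; ring.
  - by exists 0, 0; ring.
have e' : 'X_i1 * - (w i1 ord0 + 'X_i2 * b) = 'X_i0 * (w i0 ord0 + 'X_i2 * a).
  by apply/eqP; rewrite eq_sym -subr_eq0 -e ew; apply/eqP; ring.
have [c ec] := variable_divides (isT : i1 != i0) e'.
have ec1 : w i1 ord0 + 'X_i2 * b = - (c * 'X_i0).
  apply: (mulfI (mpolyX_neq0 i1)); apply: oppr_inj; rewrite -mulrN e' ec; ring.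
exists (\col_i [:: - b; a; c]`_i).
apply/colP; apply: ord3P; rewrite !mxE !sum3 !mxE /=.
- by rewrite -[LHS](addrK ('X_i2 * a)) ec; ring.
- by rewrite -[LHS](addrK ('X_i2 * b)) ec1; ring.
- by rewrite ew; ring.
Qed.

Lemma koszul_exact_col n (W : 'M[S]_(3, n)) : Xrow *m W = 0 ->
  exists H, W = koszul *m H.
Proof.
move=> h; have /choice[H hH] j : exists h, col j W = koszul *m h.
  by apply: koszul_exact1; rewrite colE mulmxA h mul0mx.
exists (\matrix_(i, j) H j i ord0); apply/matrixP => i j.
have := congr1 (fun M : 'cV[S]_3 => M i ord0) (hH j); rewrite !mxE => ->.
by apply: eq_bigr => k _; rewrite mxE.
Qed.

Lemma koszul_exact0_col n (W : 'M[S]_(3, n)) : koszul *m W = 0 ->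
  exists w : 'rV[S]_n, W = Xcol *m w.
Proof.
move=> h; have /choice[p hp] j : exists p, col j W = p *: Xcol.
  by apply: koszul_exact0; rewrite colE mulmxA h mul0mx.
exists (\row_j p j); apply/matrixP => i j.
have := congr1 (fun M : 'cV[S]_3 => M i ord0) (hp j); rewrite !mxE => ->.
by rewrite big_ord1 !mxE mulrC.
Qed.

Lemma koszul_exact1_row (w : 'rV[S]_3) : w *m Xcol = 0 -> exists h, w = h *m koszul.
Proof.
move=> h; have [|g eg] := @koszul_exact1 w^T.
  by rewrite -[Xrow]trmxK -trmx_mul (_ : Xrow^T = Xcol) ?h ?trmx0 //;
     apply/colP => i; rewrite !mxE.
exists (- g^T); apply: trmx_inj; rewrite eg trmx_mul.
have -> : (- g^T)^T = - g by apply/matrixP => i j; rewrite !mxE.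
rewrite mulmxN -mulNmx.
by congr (_ *m _); apply/matrixP; apply: ord3P; apply: ord3P; rewrite !mxE /=; ring.
Qed.

(** Substituting zero for the variables changes a polynomial by a combination of
    them. *)
Lemma const_term_split (p : S) : exists c : 'I_3 -> S,
  p = (p@_0%MM)%:MP + \sum_i c i * 'X_i.
Proof.
pose s (_ : 'I_3) := 0 : S.
have [|i|c ec] := @subst_congr 3 (generated (fun i : 'I_3 => 'X_i)) s _ _ p.
- split; first by case: (subspace_generated (fun i : 'I_3 => 'X_i : S)).
    exact: generatedD.
  exact: generatedM.
- by rewrite subr0; apply: generated_gen.
exists c; rewrite -ec; suff -> : subst s p = (p@_0%MM)%:MP by rewrite addrC subrK.
elim/mpoly_ind_ring: {ec} p => [b|p q hp hq|i p hp].
- by rewrite substC mcoeffC eqxx mulr1.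
- by rewrite rmorphD /= hp hq mcoeffD mpolyCD.
rewrite rmorphM /= substX /s mul0r.
have -> : ('X_i * p)@_0%MM = 0; last by rewrite mpolyC0.
apply/memN_msupp_eq0/negP; rewrite mulrC (perm_mem (msuppMX p U_(i))) => /mapP[k _].
by move/eqP; rewrite eq_sym mnmD_eq0 mnm1_eq0.
Qed.

End Koszul.

(** * The saturation of the Jacobian ideal *)

Section Saturation.

Variable F : fieldType.
Notation S := {mpoly F[3]}.
Notation Xc := (Xcol F).
Notation Xr := (Xrow F).
Notation K := (koszul F).

Lemma homog_coeff0 k (q : S) : q \is k.-homog -> (0 < k)%N -> q@_0%MM = 0.
Proof.
move=> hq k0; have h : mdeg (0%MM : 'X_{1..3}) != k by rewrite mdeg0 neq_ltn k0.
exact: (dhomog_nemf_coeff hq h).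
Qed.

Lemma homogM_eq s t u (q r : S) : (s + t = u)%N ->
  q \is s.-homog -> r \is t.-homog -> q * r \is u.-homog.
Proof. by move=> <-; apply: dhomogM. Qed.

Lemma X_homog (i : 'I_3) : 'X_i \is [in F[3], 1.-homog].
Proof. by rewrite dhomogX; apply/eqP; apply: mdeg1. Qed.

Lemma linear_form_row (l : 'rV[S]_3) : (forall j, l ord0 j \is 1.-homog) ->
  exists L : 'M[F]_3, l = Xr *m map_mx (@mpolyC 3 F) L.
Proof.
move=> hl; exists (\matrix_(i, j) (l ord0 j)@_U_(i)).
apply/rowP => j; rewrite mxE.
apply/mpolyP => m; rewrite raddf_sum /=.
under eq_bigr do rewrite !mxE mulrC mul_mpolyC mcoeffZ mcoeffX.
have [hm|hm] := eqVneq (mdeg m) 1%N; last first.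
  rewrite (dhomog_nemf_coeff (hl j)) // big1 // => i _.
  by case: eqP => [e|]; rewrite ?mulr0 //; rewrite -e mdeg1 eqxx in hm.
have /mdeg1P[k /eqP ->] : mdeg m == 1%N by apply/eqP.
rewrite (bigD1 k) //= eqxx mulr1 big1 ?addr0 // => i ne.
by rewrite eq_mnm1 (negPf ne) mulr0.
Qed.

(** If the entries of the relation were spanned by two linear forms y1, y2, the
    relation would read y1 u + y2 v = 0 for two syzygies u, v. Then y1 divides v,
    the quotient is again a syzygy, hence a combination of the rows of [A], and
    comparing constant terms shows that v was the zero combination of them. *)
Lemma linear_relation_unit f e A l (L : 'M[F]_3) :
  l = Xr *m map_mx (@mpolyC 3 F) L -> syzygy_resolution f e 1 A l -> L \in unitmx.
Proof.
move=> lL [hA hl syz ker l0].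
rewrite -row_free_unit -kermx_eq0; apply: contraT => /rowV0Pn[w /sub_kermxP wL w0].
have [k wk] : exists k, w ord0 k != 0 by case/rV0Pn: w0 => k; exists k.
case/eqP: l0.
pose LL := map_mx (@mpolyC 3 F) L.
pose p := lift k ord0; pose q := lift k (ord_max : 'I_2).
have sumk (V : nmodType) (G : 'I_3 -> V) : \sum_i G i = G k + (G p + G q).
  rewrite (bigD1_ord k) //= !big_ord_recl big_ord0 addr0.
  by congr (_ + (G _ + G _)); apply: val_inj.
have pk : p != k by rewrite eq_sym; apply: neq_lift.
have qk : q != k by rewrite eq_sym; apply: neq_lift.
have pq : p != q by rewrite (inj_eq lift_inj).
have [a La] : exists a : 'I_3 -> F, forall j, L k j = - (a p * L p j + a q * L q j).
  exists (fun i => w ord0 i / w ord0 k) => j.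
  have := congr1 (fun M : 'rV[F]_3 => M ord0 j) wL; rewrite !mxE sumk => h.
  have e' : w ord0 k * L k j = - (w ord0 p * L p j + w ord0 q * L q j).
    by apply/eqP; rewrite -subr_eq0 opprK h.
  by apply: (mulfI wk); rewrite e'; field.
pose y i : S := 'X_i - (a i)%:MP * 'X_k.
have lE : l = y p *: row p LL + y q *: row q LL.
  have Lk j : LL k j = - ((a p)%:MP * LL p j + (a q)%:MP * LL q j).
    by rewrite !mxE La mpolyCN mpolyCD !mpolyCM.
  apply/rowP => j; rewrite lL !mxE sumk !mxE; move: (Lk j); rewrite !mxE => ->.
  by rewrite /y; ring.
have lA : l *m A = 0 by apply/ker; exists 1; rewrite scale1r.
(* the quotient [t] of a row by [y r] is a syzygy [v *m A], so the row minus
   [y r *: v] is a multiple of [l] and vanishes in degree zero *)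
have rowL (r r' : 'I_3) : r != k -> r' != k -> r != r' ->
    y r *: (row r LL *m A) = - (y r' *: (row r' LL *m A)) -> row r' LL = 0.
  move=> rk r'k rr' h.
  pose s j := if j == r then (a r)%:MP * 'X_k else 'X_j : S.
  have sr : s r = (a r)%:MP * 'X_k by rewrite /s eqxx.
  have sE j : j != r -> s j = 'X_j by move/negPf => h'; rewrite /s h'.
  have kr : k != r by rewrite eq_sym.
  have r'r : r' != r by rewrite eq_sym.
  have /choice[t ht] j : divides (y r) ((row r' LL *m A) ord0 j).
    rewrite /y -sr; apply: (linear_form_divides (s := s)
      (a := (row r LL *m A) ord0 j) (d := - y r')).
    - exact: sE.
    - by rewrite rmorphB /= substX sr rmorphM /= substX substC sE // subrr.
    - rewrite rmorphN rmorphB rmorphM /= !substX substC !sE //.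
      rewrite oppr_eq0; apply/eqP => /(congr1 (mcoeff U_(r')))/eqP.
      rewrite mcoeffB mcoeffCM !mcoeffXU eqxx (eq_sym k) (negPf r'k) mulr0 subr0.
      by rewrite mcoeff0 oner_eq0.
    - have := congr1 (fun M : 'rV[S]_3 => M ord0 j) h; rewrite !mxE sr /y => ->.
      by rewrite mulNr.
  pose tv : 'rV[S]_3 := \row_j t j.
  have uE : row r' LL *m A = y r *: tv.
    by apply/rowP => j; rewrite ht !mxE mulrC.
  have y0 : y r != 0.
    apply/eqP => /(congr1 (mcoeff U_(r)))/eqP.
    rewrite mcoeffB mcoeffCM !mcoeffXU eqxx (eq_sym k) (negPf rk) mulr0 subr0.
    by rewrite mcoeff0 oner_eq0.
  have /syz[v ev] : tv *m gradient f = 0.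
    have : (y r *: tv) *m gradient f = 0.
      by rewrite -uE; apply/syz; exists (row r' LL).
    rewrite -scalemxAl => /matrixP/(_ ord0 ord0); rewrite mxE => e0.
    by apply: mx11_eq; apply: (mulfI y0); rewrite e0 !mxE mulr0.
  have /ker[c ec] : (row r' LL - y r *: v) *m A = 0.
    by rewrite mulmxBl uE -scalemxAl -ev subrr.
  apply/rowP => j; have := congr1 (fun M : 'rV[S]_3 => (M ord0 j)@_0%MM) ec.
  rewrite !mxE mcoeffB !(rmorphM (mcoeff 0%MM)) /=.
  have y00 : (y r)@_0%MM = 0.
    apply: (@homog_coeff0 1) => //.
    by rewrite rpredB // ?mul_mpolyC ?rpredZ // X_homog.
  rewrite y00 mul0r subr0 (homog_coeff0 (hl j)) // mulr0.
  by rewrite mpolyCK => ->; rewrite mpolyC0.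
have hpq : y p *: (row p LL *m A) = - (y q *: (row q LL *m A)).
  apply/eqP; rewrite -subr_eq0 opprK.
  by rewrite !scalemxAl -mulmxDl -lE lA.
have rq := rowL p q pk qk pq hpq.
have qp : q != p by rewrite eq_sym.
have hqp : y q *: (row q LL *m A) = - (y p *: (row p LL *m A)).
  by rewrite hpq opprK.
have rp := rowL q p qk pk qp hqp.
by rewrite lE rq rp !scaler0 addr0.
Qed.

Lemma normalize_relation f e A (l : 'rV[S]_3) : syzygy_resolution f e 1 A l ->
  exists A', syzygy_resolution f e 1 A' Xr.
Proof.
move=> res; have [hA hl syz ker l0] := res.
have [L lE] := linear_form_row hl.
have uL : L \in unitmx := linear_relation_unit lE res.
pose LL := map_mx (@mpolyC 3 F) L; pose LV := map_mx (@mpolyC 3 F) (invmx L).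
have LK : LL *m LV = 1%:M by rewrite -map_mxM mulmxV // map_mx1.
have KL : LV *m LL = 1%:M by rewrite -map_mxM mulVmx // map_mx1.
exists (LL *m A); split.
- move=> i j; rewrite mxE; apply: rpred_sum => k _.
  by rewrite mxE mul_mpolyC rpredZ.
- by move=> j; rewrite mxE; apply: X_homog.
- move=> v; rewrite syz; split=> -[u ->].
    by exists (u *m LV); rewrite mulmxA -(mulmxA u) KL mulmx1.
  by exists (u *m LL); rewrite mulmxA.
- move=> u; rewrite mulmxA ker; split=> -[c ec]; exists c.
    by rewrite -[u]mulmx1 -LK mulmxA ec lE -scalemxAl -mulmxA LK mulmx1.
  by rewrite ec lE -scalemxAl.
- apply/eqP => /rowP/(_ i0); rewrite !mxE => /eqP.
  by rewrite (negPf (mpolyX_neq0 _ _)).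
Qed.

Section Socle.

Variables (f : S) (e : nat) (A : 'M[S]_3).
Hypothesis res : syzygy_resolution f e 1 A Xr.
Notation G := (gradient f).
Notation J := (jacobian f).

Lemma jacobianE p : J p <-> exists w : 'rV[S]_3, p%:M = w *m G.
Proof.
split=> [[h ->]|[w /matrixP/(_ ord0 ord0)]].
  exists (\row_i h i); apply: mx11_eq; rewrite mxE eqxx mulr1n mulmx_cv.
  by apply: eq_bigr => i _; rewrite !mxE.
rewrite mxE eqxx mulr1n mulmx_cv => ->; exists (fun i => w ord0 i).
by apply: eq_bigr => i _; rewrite mxE.
Qed.

Lemma gradient_relation (Q : 'M[S]_3) : Q *m G = 0 -> exists P, Q = P *m A.
Proof.
have [_ _ syz _ _] := res => h.
have /choice[P hP] i : exists u, row i Q = u *m A.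
  by apply/syz; rewrite -row_mul h row0.
exists (\matrix_(i, j) P i ord0 j); apply/row_matrixP => i.
by rewrite row_mul hP; congr (_ *m _); apply/rowP => j; rewrite !mxE.
Qed.

Lemma XA : Xr *m A = 0.
Proof. by have [_ _ _ ker _] := res; apply/ker; exists 1; rewrite scale1r. Qed.

Lemma kerA (u : 'rV[S]_3) : u *m A = 0 -> exists c, u = c *: Xr.
Proof. by have [_ _ _ ker _] := res => /ker. Qed.

(** The three generating syzygies are Koszul combinations of the rows of [H], and
    [H] carries the gradient to a multiple of the variables: this multiple
    generates the saturation. *)
Lemma socle_generator : exists (H : 'M[S]_3) p, A = K *m H /\ H *m G = p *: Xc.
Proof.
have [H AE] := koszul_exact_col XA.
have [|p hp] := @koszul_exact0 F (H *m G).
  have [_ _ syz _ _] := res; rewrite mulmxA -AE; apply/row_matrixP => i.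
  by rewrite row_mul row0; apply/syz; exists (row i 1%:M); rewrite -row_mul mul1mx.
by exists H, p.
Qed.

Variables (H : 'M[S]_3) (p : S).
Hypothesis AE : A = K *m H.
Hypothesis HG : H *m G = p *: Xc.

Lemma socle_annihilated i : J ('X_i * p).
Proof.
apply/jacobianE; exists (row i H); rewrite -row_mul HG; apply: mx11_eq.
by rewrite !mxE eqxx mulr1n mulrC.
Qed.

Lemma X_mulmx0 (c : S) : c *: Xc = 0 -> c = 0.
Proof.
move/colP/(_ i0); rewrite !mxE => /eqP.
by rewrite mulf_eq0 (negPf (mpolyX_neq0 _ _)) orbF => /eqP.
Qed.

(** If p = w G then H - X w consists of syzygies, say Q A. Multiplying by K gives
    (1 - K Q) A = 0, so the rows of 1 - K Q are multiples of the variables, which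
    fails for the constant terms. *)
Lemma socle_not_in_jacobian : ~ J p.
Proof.
move/jacobianE => [w ew].
have [|Q eQ] := @gradient_relation (H - Xc *m w).
  rewrite mulmxBl HG -mulmxA -ew mul_mx_scalar subrr //.
have : (1%:M - K *m Q) *m A = 0.
  rewrite mulmxBl mul1mx -mulmxA -eQ mulmxBr -AE mulmxA.
  by rewrite /Xcol koszulX mul0mx subr0 subrr.
move/(congr1 (row i0)); rewrite row_mul row0 => /kerA[c /rowP/(_ i0)].
move/(congr1 (mcoeff 0%MM)); rewrite !mxE sum3 !mxE /= mul0r add0r.
rewrite mcoeffB mcoeffD !(rmorphM (mcoeff 0%MM)) /= mcoeffN !mcoeffX.
by rewrite !mnm1_eq0 oppr0 !mul0r !mulr0 addr0 subr0 mcoeff1 eqxx => /eqP; rewrite oner_eq0.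
Qed.

(** From w H = 0 follows p (w X) = w H G = 0, so w = h K; then h A = w H = 0
    makes h a multiple of the variables, which K kills. *)
Lemma H_cancel (w : 'rV[S]_3) : w *m H = 0 -> w = 0.
Proof.
move=> wH.
have wX : w *m Xc = 0.
  have pwX : p *: (w *m Xc) = 0 by rewrite scalemxAr -HG mulmxA wH mul0mx.
  have : p * (w *m Xc) ord0 ord0 = 0.
    by transitivity ((p *: (w *m Xc)) ord0 ord0); [rewrite [RHS]mxE|rewrite pwX mxE].
  move/eqP; rewrite mulf_eq0 => /orP[/eqP p0|/eqP h].
    case: socle_not_in_jacobian; rewrite p0; exists (fun _ => 0).
    by rewrite big1 // => i _; rewrite mul0r.
  by apply: mx11_eq; rewrite h mxE.
have [h hE] := koszul_exact1_row wX.
have /kerA[c hc] : h *m A = 0 by rewrite AE mulmxA -hE.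
by rewrite hE hc -scalemxAl Xkoszul scaler0.
Qed.

(** Write q X = p C + U G with C constant. Multiplying by K yields syzygies
    K U - [C] H = Q A, and then X^T [C] = - X^T Q K, where the left side is linear
    and the right side has order two: so C = 0. Now K U is a matrix of syzygies,
    and two diagram chases in the Koszul complex turn U into
    b H + W K H + X w, which gives q = b p + w G. *)
Lemma socle_step (q : S) : (forall i, exists c : F, J ('X_i * q - c *: p)) ->
  exists c : F, J (q - c *: p).
Proof.
move=> /choice[c hc].
have /choice[U hU] i : exists u : 'rV[S]_3, ('X_i * q - c i *: p)%:M = u *m G.
  exact/jacobianE.
pose UM : 'M[S]_3 := \matrix_(i, j) U i ord0 j.
pose C : 'cV[S]_3 := \col_i (c i)%:MP.
have qX : q *: Xc = p *: C + UM *m G.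
  apply/colP => i; have := congr1 (fun M : 'M[S]_1 => M ord0 ord0) (hU i).
  rewrite !mxE eqxx mulr1n => h.
  have -> : \sum_j UM i j * G j ord0 = \sum_j U i ord0 j * G j ord0.
    by apply: eq_bigr => j _; rewrite mxE.
  rewrite -h -mul_mpolyC; ring.
pose CX := cross (fun i => (c i)%:MP : S).
have KUG : (K *m UM - CX *m H) *m G = 0.
  rewrite mulmxBl -!mulmxA HG.
  have -> : UM *m G = q *: Xc - p *: C by rewrite qX addrAC subrr add0r.
  rewrite mulmxBr -!scalemxAr koszulX scaler0 sub0r cross_swap scalerN opprK.
  by rewrite subrr.
have [Q eQ] := gradient_relation KUG.
have XCX : Xr *m CX = - (Xr *m Q *m K).
  apply/eqP; rewrite -subr_eq0 opprK; apply/eqP/H_cancel.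
  rewrite mulmxDl -(mulmxA _ K) -AE -(mulmxA _ Q) -eQ mulmxBr !mulmxA Xkoszul.
  by rewrite mul0mx sub0r addrN.
have c0 i : c i = 0.
  have XX j : (Xr *m CX) ord0 j = 0.
    rewrite -[LHS](@pihomog_dE _ _ mdeg 1); last first.
      rewrite mxE; apply: rpred_sum => k _; rewrite !mxE.
      apply: (@homogM_eq 1 0) => //; first exact: X_homog.
      have hcst t : (c t)%:MP \is [in F[3], 0.-homog].
        by rewrite -alg_mpolyC rpredZ // dhomog1.
      by move: k j; apply: ord3P; apply: ord3P; rewrite /= ?dhomogN ?dhomog0.
    have -> : (Xr *m CX) ord0 j = - \sum_k \sum_k' Q k' k * ('X_k' * K k j).
      rewrite XCX mxE [X in - X]mxE; congr (- _); apply: eq_bigr => k _.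
      rewrite [(Xr *m Q) _ _]mxE mulr_suml; apply: eq_bigr => k' _.
      by rewrite [Xr _ _]mxE; ring.
    rewrite pihomogN (raddf_sum (pihomog mdeg 1)) big1 ?oppr0 //= => k _.
    rewrite (raddf_sum (pihomog mdeg 1)) big1 //= => k' _; apply: (@homog_compM0 _ _ _ _ 2) => //.
    apply: (@homogM_eq 1 1) => //; first exact: X_homog.
    by rewrite mxE; move: k j; apply: ord3P; apply: ord3P;
      rewrite /= ?dhomogN ?dhomog0 ?X_homog.
  have E0 := XX i0; have E1 := XX i1.
  rewrite mxE sum3 !mxE /= in E0; rewrite mxE sum3 !mxE /= in E1.
  have cf (k : 'I_3) (P : S) : P = 0 -> P@_U_(k) = 0 by move=> ->; rewrite mcoeff0.
  have := cf i1 _ E0; have := cf i2 _ E0; have := cf i2 _ E1.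
  rewrite !mulr0 !add0r !addr0 !mulrN !(mulrC 'X_ _) !mul_mpolyC.
  rewrite !mcoeffD !mcoeffN !mcoeffZ !mcoeffXU /= !mulr0 !mulr1 ?oppr0 ?addr0 ?add0r.
  by move=> h0 h1 h2; move: i; apply: ord3P => //; apply/eqP; rewrite -oppr_eq0; apply/eqP.
have [Q' eQ'] : exists Q', K *m UM = Q' *m A.
  exists Q; rewrite -eQ (_ : CX = 0) ?mul0mx ?subr0 //.
  by apply/matrixP; apply: ord3P; apply: ord3P; rewrite !mxE /= ?c0 ?mpolyC0 ?oppr0.
have [b hb] : exists b, Xr *m Q' = b *: Xr.
  by apply: kerA; rewrite -mulmxA -eQ' mulmxA Xkoszul mul0mx.
have [W hW] : exists W, Q' - b%:M = K *m W.
  by apply: koszul_exact_col; rewrite mulmxBr hb mul_mx_scalar subrr.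
have [w hw] : exists w, UM - b *: H - W *m K *m H = Xc *m w.
  apply: koszul_exact0_col; rewrite !mulmxBr -scalemxAr -AE eQ' !mulmxA -hW.
  rewrite -!mulmxA -AE mulmxBl mul_scalar_mx.
  by rewrite subrr.
have qE : q = b * p + (w *m G) ord0 ord0.
  have : (q - (b * p + (w *m G) ord0 ord0)) *: Xc = 0.
    have UE : UM = b *: H + W *m K *m H + Xc *m w by rewrite -hw -(addrA UM) -opprD [RHS]addrC subrK.
    rewrite scalerBl qX (_ : C = 0); last by apply/colP => i; rewrite !mxE c0 mpolyC0.
    rewrite scaler0 add0r UE !mulmxDl -scalemxAl HG -!mulmxA HG -!scalemxAr koszulX.
    rewrite mulmx0 scaler0 addr0 scalerDl scalerA.
    by rewrite [X in Xc *m X]mx11_scalar mul_mx_scalar subrr.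
  by move/X_mulmx0/eqP; rewrite subr_eq0 => /eqP.
have [b' hb'] := const_term_split b.
exists (b@_0%MM).
have -> : q - b@_0%MM *: p = \sum_i b' i * ('X_i * p) + (w *m G) ord0 ord0.
  rewrite qE {1}hb' -mul_mpolyC mulrDl mulr_suml.
  under [in RHS]eq_bigr do rewrite mulrA.
  ring.
apply: generatedD.
  elim/big_ind: _ => [||i _].
  - by case: (subspace_generated (fun i => f^`M(i))).
  - exact: generatedD.
  - by apply: generatedM; apply: socle_annihilated.
apply/jacobianE; exists w; apply: mx11_eq.
by rewrite [LHS]mxE eqxx mulr1n.
Qed.

Lemma saturation_socle N q : (forall r : S, r \is N.-homog -> J (r * q)) ->
  exists c : F, J (q - c *: p).
Proof.
elim: N q => [|N IH] q hq.
  by exists 0; rewrite scale0r subr0 -[q]mul1r; apply: hq; apply: dhomog1.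
apply: socle_step => i; apply: IH => r hr; rewrite mulrA; apply: hq.
by apply: homogM_eq hr (X_homog i); apply: addn1.
Qed.

Lemma N_dim_one : N_dim f 1.
Proof.
apply/quot_dim_sdim; exists (fun _ => p); split.
- move=> _; exists 1%N => r hr; have [b hb] := const_term_split r.
  rewrite hb (homog_coeff0 hr) // mpolyC0 add0r mulr_suml.
  elim/big_ind: _ => [||i _].
  - by case: (subspace_generated (fun i => f^`M(i))).
  - exact: generatedD.
  - by rewrite -mulrA; apply: generatedM; apply: socle_annihilated.
- move=> c; rewrite big_ord1 => Jc i; rewrite ord1.
  have [//|c0] := eqVneq (c ord0) 0; case: socle_not_in_jacobian.
  rewrite -[p]scale1r -(mulVf c0) -scalerA -mul_mpolyC.
  exact: generatedM.
- move=> q [N /saturation_socle[c hc]]; exists (fun _ => c).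
  by rewrite big_ord1.
Qed.

End Socle.

End Saturation.

(** * A graded Nullstellensatz for finite schemes *)

Section BinaryForms.

Variables (F : fieldType).
Notation S := {mpoly F[3]}.
Variables l y : S.

(** The binary form of degree [B] in [l] and [y] with dehomogenisation [P]. *)
Definition binary_form B (P : {poly F}) : S :=
  \sum_(a < B.+1) P`_a *: (l ^+ a * y ^+ (B - a)).

Lemma binary_formD B P Q : binary_form B (P + Q) = binary_form B P + binary_form B Q.
Proof.
rewrite -big_split /=; apply: eq_bigr => a _.
by rewrite coefD scalerDl.
Qed.

Lemma binary_formZ B c P : binary_form B (c *: P) = c *: binary_form B P.
Proof. by rewrite scaler_sumr; apply: eq_bigr => a _; rewrite coefZ scalerA. Qed.

Lemma binary_formX B P : binary_form B.+1 (P * 'X) = l * binary_form B P.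
Proof.
rewrite /binary_form big_ord_recl coefMX /= scale0r add0r mulr_sumr.
apply: eq_bigr => a _; rewrite coefMX /= subSS exprS -scalerAr.
by rewrite mulrA.
Qed.

Lemma binary_formY B (P : {poly F}) : (size P <= B.+1)%N ->
  binary_form B.+1 P = y * binary_form B P.
Proof.
move=> sP; rewrite /binary_form big_ord_recr /= [P`_B.+1]nth_default //.
rewrite scale0r addr0 mulr_sumr; apply: eq_bigr => a _.
have le : (a <= B)%N by rewrite -ltnS.
by rewrite subSn // [y ^+ _.+1]exprS mulrCA scalerAr.
Qed.

Lemma binary_formYn B N (P : {poly F}) : (size P <= B.+1)%N ->
  binary_form (N + B) P = y ^+ N * binary_form B P.
Proof.
move=> sP; elim: N => [|N IH]; first by rewrite mul1r.
rewrite addSn binary_formY ?IH ?exprS ?mulrA //.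
by apply: leq_trans sP _; rewrite ltnS leq_addl.
Qed.

Lemma binary_form_root B c (P : {poly F}) : (size P <= B.+1)%N ->
  binary_form B.+1 (P * ('X - c%:P)) = (l - c *: y) * binary_form B P.
Proof.
have -> : P * ('X - c%:P) = P * 'X + (- c) *: P.
  by rewrite -mul_polyC polyCN; ring.
move=> sP; rewrite binary_formD binary_formX binary_formZ binary_formY //.
by rewrite mulrBl scaleNr scalerAl.
Qed.

Lemma binary_formC B c : binary_form B c%:P = c *: y ^+ B.
Proof.
rewrite /binary_form big_ord_recl coefC /= subn0 mul1r big1 ?addr0 // => a _.
by rewrite coefC /= scale0r.
Qed.

(** There are more monomials of large degree in [l] and [y] than the codimension
    allows. *)
Lemma bounded_binary_form (I : S -> Prop) D : (0 < D)%N -> ideal_closed I ->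
  l \is D.-homog -> y \is D.-homog -> bounded_codim I ->
  exists B (P : {poly F}), [/\ P != 0, (size P <= B.+1)%N & I (binary_form B P)].
Proof.
move=> D0 [I0 ID IM] hl hy [B [k0 bd]].
pose v (a : 'I_B.+1) := y ^+ k0 * (l ^+ a * y ^+ (B - a)).
have hv a : v a \is ((k0 + B) * D)%N.-homog.
  apply: (@homogM_eq F (D * k0) (D * a + D * (B - a))).
    by have := ltn_ord a; rewrite -mulnDr -mulnDr mulnC ltnS => h; rewrite subnKC.
  - exact: dhomogMn.
  - by apply: dhomogM; apply: dhomogMn.
have [|c [a ca] Ic] := bd _ _ v hv; first by nia.
pose P : {poly F} := \poly_(a < B.+1) (if insub a is Some a' then c a' else 0).
have PE (b : 'I_B.+1) : P`_b = c b.
  by rewrite coef_poly ltn_ord insubT //= => h; congr c; apply: val_inj.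
have sP : (size P <= B.+1)%N by apply: size_poly.
exists (k0 + B)%N, P.
split; last 1 first.
- rewrite binary_formYn //; move: Ic; congr I.
  rewrite mulr_sumr; apply: eq_bigr => b _.
  by rewrite PE scalerAr.
- by apply: contraNneq ca => P0; rewrite -PE P0 coef0.
- by apply: leq_trans sP _; rewrite ltnS leq_addl.
Qed.

End BinaryForms.

Section Nullstellensatz.

Variables (F : numClosedFieldType).
Notation S := {mpoly F[3]}.

Definition proper_at (i : 'I_3) (I : S -> Prop) := forall N, ~ I ('X_i ^+ N).

Definition add_gen (I : S -> Prop) (a : S) (q : S) := exists u, I (q - u * a).

Lemma add_gen_ideal I a : ideal_closed I -> ideal_closed (add_gen I a).
Proof.
move=> [I0 ID IM]; split; first by exists 0; rewrite mul0r subr0.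
- move=> p q [u hu] [v hv]; exists (u + v).
  have -> : p + q - (u + v) * a = (p - u * a) + (q - v * a) by ring.
  exact: ID.
- move=> c p [u hu]; exists (c * u).
  have -> : c * p - c * u * a = c * (p - u * a) by ring.
  exact: IM.
Qed.

Lemma add_genS (I : S -> Prop) a p : I p -> add_gen I a p.
Proof. by exists 0; rewrite mul0r subr0. Qed.

Lemma add_gen_gen (I : S -> Prop) a : ideal_closed I -> add_gen I a a.
Proof. by case=> I0 _ _; exists 1; rewrite mul1r subrr. Qed.

(** A binary form in the ideal splits into linear factors, and adjoining one of
    them keeps the ideal proper: otherwise powers of ['X_i] would lie in the
    ideal enlarged by each factor, hence in the ideal. *)
Lemma adjoin_linear (I : S -> Prop) i j B (P : {poly F}) : ideal_closed I ->
  proper_at i I -> P != 0 -> (size P <= B.+1)%N ->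
  I (binary_form 'X_j 'X_i B P) ->
  exists c : F, proper_at i (add_gen I ('X_j - c *: 'X_i)).
Proof.
move=> idI prI; have [_ ID IM] := idI.
have [n] := ubnP (size P); elim: n B P => // n IH B P; rewrite ltnS => lenP P0 sP IP.
have [sz1|sz1] := leqP (size P) 1.
  case: (prI B); have c0 : P`_0 != 0 by rewrite -polyC_eq0 -size1_polyC.
  move: IP; rewrite (size1_polyC sz1) binary_formC => /(IM (P`_0)^-1%:MP).
  by rewrite mul_mpolyC scalerA mulVf // scale1r.
have /closed_rootP[c /factor_theorem[Q PQ]] : size P != 1 by rewrite neq_ltn sz1 orbT.
have Q0 : Q != 0 by apply: contraNneq P0 => Q0; rewrite PQ Q0 mul0r.
have sPQ : size P = (size Q).+1.
  by rewrite PQ size_mul ?polyXsubC_eq0 // size_XsubC addn2.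
case: B sP IP => [|B] sP IP; first by move: sz1; rewrite ltnNge sP.
have sQ : (size Q <= B.+1)%N by rewrite -ltnS -sPQ.
have [pr|npr] := EM (proper_at i (add_gen I ('X_j - c *: 'X_i))); first by exists c.
have [N [u Iu]] : exists N, add_gen I ('X_j - c *: 'X_i) ('X_i ^+ N).
  by apply: contrapT => h; apply: npr => N hN; apply: h; exists N.
apply: (IH (N + B)%N Q) => //; first by rewrite -sPQ.
  by apply: leq_trans sQ _; rewrite ltnS leq_addl.
rewrite binary_formYn //.
have -> : 'X_i ^+ N * binary_form 'X_j 'X_i B Q
    = binary_form 'X_j 'X_i B Q * ('X_i ^+ N - u * ('X_j - c *: 'X_i))
      + u * binary_form 'X_j 'X_i B.+1 P.
  by rewrite PQ binary_form_root //; ring.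
by apply: ID; apply: IM.
Qed.

Lemma subst_line (c : 'I_3 -> F) (i : 'I_3) k (q : S) : q \is k.-homog ->
  subst (fun j => c j *: 'X_i : S) q = q.@[c] *: 'X_i ^+ k.
Proof.
move=> hq; rewrite {1}(mpolyE q) mevalE raddf_sum scaler_suml big_seq [RHS]big_seq.
apply: eq_bigr => m hm; have dm : mdeg m = k by apply: (dhomog_mf hq).
rewrite /= /subst comp_mpolyZ comp_mpolyX -scalerA; congr (_ *: _).
rewrite (eq_bigr (fun j => c j ^+ m j *: ('X_i : S) ^+ m j)) => [|j _].
  by rewrite scaler_prod prodrXr -mdegE dm.
by rewrite tnth_mktuple exprZn.
Qed.

(** After adjoining X_j - c_j X_i for each j the ideal still contains no power
    of X_i. A form of degree k is congruent to its value at c times X_i^k, so the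
    forms of the ideal vanish at c. *)
Lemma proper_zero (I : S -> Prop) i : ideal_closed I -> bounded_codim I ->
  proper_at i I -> exists2 p : 'rV[F]_3, p != 0 &
    forall k q, q \is k.-homog -> I q -> q.@[p ord0] = 0.
Proof.
move=> idI bdI prI.
have step (I' : S -> Prop) j : ideal_closed I' -> (forall q, I q -> I' q) -> proper_at i I' ->
    exists c : F, proper_at i (add_gen I' ('X_j - c *: 'X_i)).
  move=> idI' II' prI'.
  have [B [P [P0 sP IP]]] := bounded_binary_form (isT : 0 < 1)%N idI' (X_homog F j)
    (X_homog F i) (bounded_codimS II' bdI).
  exact: adjoin_linear P0 sP IP.
have [c0 pr0] := step I i0 idI (fun _ h => h) prI.
set I0 := add_gen I _ in pr0; have id0 : ideal_closed I0 by apply: add_gen_ideal.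
have II0 q : I q -> I0 q by apply: add_genS.
have [c1 pr1] := step I0 i1 id0 II0 pr0.
set I1 := add_gen I0 _ in pr1; have id1 : ideal_closed I1 by apply: add_gen_ideal.
have II1 q : I0 q -> I1 q by apply: add_genS.
have [c2 pr2] := step I1 i2 id1 (fun q h => II1 _ (II0 _ h)) pr1.
set I2 := add_gen I1 _ in pr2; have id2 : ideal_closed I2 by apply: add_gen_ideal.
have II2 q : I1 q -> I2 q by apply: add_genS.
pose c (j : 'I_3) : F := [:: c0; c1; c2]`_j.
have gc j : I2 ('X_j - c j *: 'X_i).
  move: j; apply: ord3P; rewrite /c /=.
  - by apply/II2/II1/add_gen_gen.
  - by apply/II2/add_gen_gen.
  - exact: add_gen_gen.
have [_ ID2 IM2] := id2.
have ci : c i = 1.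
  apply/eqP/negP => /negP ci1; apply: (pr2 1%N).
  have : I2 ((1 - c i)^-1%:MP * ('X_i - c i *: 'X_i)) by apply: IM2.
  rewrite -{1}['X_i]scale1r -scalerBl mul_mpolyC scalerA mulVf ?scale1r //.
  by rewrite subr_eq0 eq_sym.
exists (\row_j c j).
  by apply/eqP => /rowP/(_ i)/eqP; rewrite !mxE ci oner_eq0.
move=> k q hq Iq; rewrite (@meval_eq _ _ _ c); last by move=> j; rewrite mxE.
apply: contrapT => /eqP qc; apply: (pr2 k).
have Iq2 : I2 (q.@[c] *: 'X_i ^+ k).
  rewrite -(subst_line c i hq).
  have -> : subst (fun j => c j *: 'X_i : S) q = q + (-1) * (q - subst (fun j => c j *: 'X_i : S) q) by ring.
  apply: ID2; first by apply/II2/II1/II0.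
  by apply: IM2; apply: subst_congr.
have : I2 ((q.@[c])^-1%:MP * (q.@[c] *: 'X_i ^+ k)) by apply: IM2.
by rewrite mul_mpolyC scalerA mulVf // scale1r.
Qed.

Lemma ideal_sum (I : S -> Prop) (T : eqType) (r : seq T) (G : T -> S) :
  ideal_closed I -> (forall t, t \in r -> I (G t)) -> I (\sum_(t <- r) G t).
Proof.
by move=> [I0 ID _] h; rewrite big_seq; elim/big_ind: _.
Qed.

(** Forms of large degree are sums of monomials that are divisible by a large
    power of some variable. *)
Theorem nullstellensatz (I : S -> Prop) : ideal_closed I -> bounded_codim I ->
  (exists N, forall k q, (N <= k)%N -> q \is k.-homog -> I q) \/
  exists2 p : 'rV[F]_3, p != 0 & forall k q, q \is k.-homog -> I q -> q.@[p ord0] = 0.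
Proof.
move=> idI bdI; have [_ ID IM] := idI.
have [h|] := EM (forall i, exists N, I ('X_i ^+ N)); last first.
  move/existsNP => [i hi]; right; apply: (proper_zero (i := i)) => // N hN.
  by apply: hi; exists N.
left; have [N hN] := choice h; exists (\sum_i N i)%N => k q le hq.
rewrite (mpolyE q); apply: ideal_sum => // m hm; rewrite -mul_mpolyC; apply: (IM).
have dm : mdeg m = k by apply: (dhomog_mf hq).
have [i lei] : exists i, (N i <= m i)%N.
  apply: contrapT => hno; have lt i : (m i < N i)%N.
    by rewrite ltnNge; apply/negP => h'; apply: hno; exists i.
  move: le; rewrite -dm mdegE !sum3.
  by have := lt i0; have := lt i1; have := lt i2; lia.
have -> : 'X_[m] = 'X_[m - U_(i) *+ N i] * 'X_i ^+ N i :> S.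
  rewrite mpolyXn -mpolyXD submK //; apply/mnm_lepP => j.
  by rewrite mulmnE mnm1E; case: eqP => [<-|_]; rewrite ?mul1n.
exact: IM.
Qed.

(** The localisation of [J] at [p], pulled back to the homogeneous coordinate
    ring. *)
Definition local_ideal (J : S -> Prop) (p : 'rV[F]_3) (q : S) :=
  exists j (s : S), [/\ s \is j.-homog, s.@[p ord0] != 0 & J (s * q)].

Lemma local_ideal_ideal J (p : 'rV[F]_3) :
  ideal_closed J -> ideal_closed (local_ideal J p).
Proof.
move=> [J0 JD JM]; split.
- by exists 0%N, 1; rewrite dhomog1 meval1 oner_neq0 mulr0.
- move=> q r [i [s [hs sp Js]]] [j [t [ht tp Jt]]]; exists (i + j)%N, (s * t); split.
  + exact: dhomogM.
  + by rewrite mevalM mulf_neq0.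
  have -> : s * t * (q + r) = t * (s * q) + s * (t * r) by ring.
  by apply: JD; apply: JM.
- move=> c q [j [s [hs sp Js]]]; exists j, s; split=> //.
  have -> : s * (c * q) = c * (s * q) by ring.
  exact: JM.
Qed.

Lemma local_idealS (J : S -> Prop) (p : 'rV[F]_3) (q : S) : J q -> local_ideal J p q.
Proof. by exists 0%N, 1; rewrite dhomog1 meval1 oner_neq0 mul1r. Qed.

Lemma local_ideal_comp J (p : 'rV[F]_3) k (q : S) :
  (forall k q, J q -> J (pihomog mdeg k q)) ->
  local_ideal J p q -> local_ideal J p (pihomog mdeg k q).
Proof.
move=> hJ [j [s [hs sp Js]]]; exists j, s; split=> //.
by rewrite mulrC -(homog_compM q k hs) mulrC; apply: hJ.
Qed.

(** A binary form in [l] and [y] that lies in [J] is a power of [l] times a form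
    that does not vanish at [p]. *)
Lemma local_nilpotent (J : S -> Prop) (p : 'rV[F]_3) D (l y : S) : ideal_closed J ->
  bounded_codim J -> (0 < D)%N -> l \is D.-homog -> y \is D.-homog ->
  l.@[p ord0] = 0 -> y.@[p ord0] != 0 -> exists N, local_ideal J p (l ^+ N).
Proof.
move=> idJ bdJ D0 hl hy lp yp; have [_ _ JM] := idJ.
have [B [P [P0 sP JP]]] := bounded_binary_form D0 idJ hl hy bdJ.
have {JP} [N] : exists N, J (l ^+ N * binary_form l y B P).
  by exists 0%N; rewrite mul1r.
have [n] := ubnP (size P); elim: n N B P P0 sP => // n IH N B P P0 sP.
rewrite ltnS => lenP JP.
have [c0|c0] := eqVneq P`_0 0; last first.
  exists N, (D * B)%N, (binary_form l y B P); split; last by rewrite mulrC.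
    apply: rpred_sum => a _; apply: rpredZ.
    have le : (a <= B)%N by rewrite -ltnS.
    apply: (@homogM_eq F (D * a) (D * (B - a))); [|exact: dhomogMn..].
    by rewrite -mulnDr subnKC.
  rewrite /binary_form big_ord_recl mevalD mevalZ mevalM !rmorphXn /= ?expr0 mul1r.
  rewrite raddf_sum /= big1 ?addr0 => [|a _]; last first.
    by rewrite mevalZ mevalM !rmorphXn /= lp expr0n /= mul0r mulr0.
  by rewrite mulf_neq0 // expf_neq0.
have [Q PQ] : exists Q, P = Q * 'X.
  have /factor_theorem[Q] : root P 0 by rewrite /root horner_coef0 c0.
  by rewrite subr0 => PQ; exists Q.
have Q0 : Q != 0 by apply: contraNneq P0 => Q0; rewrite PQ Q0 mul0r.
have sPQ : size P = (size Q).+1 by rewrite PQ size_mulX.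
case: B sP JP => [|B] sP JP.
  by move: Q0; rewrite -size_poly_gt0; move: sP; rewrite sPQ; case: (size Q).
apply: (IH N.+1 B Q) => //.
- by rewrite -ltnS -sPQ.
- by rewrite -sPQ.
- by rewrite exprSr -mulrA -binary_formX -PQ.
Qed.

End Nullstellensatz.

(** * Finitely many points and the chinese remainder theorem *)

Section Points.

Variables (F : numClosedFieldType).
Notation S := {mpoly F[3]}.
Implicit Types p q r : 'rV[F]_3.

Lemma same_point_sym p q : same_point p q -> same_point q p.
Proof.
move=> [c c0 ->]; exists c^-1; first by rewrite invr_neq0.
by rewrite scalerA mulVf // scale1r.
Qed.

Lemma homog_evalZ k (g : S) (c : F) (v : 'I_3 -> F) : g \is k.-homog ->
  g.@[fun i => c * v i] = c ^+ k * g.@[v].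
Proof.
move=> hg; rewrite !mevalE mulr_sumr big_seq [RHS]big_seq; apply: eq_bigr => m hm.
have <- : mdeg m = k by apply: (dhomog_mf hg).
under eq_bigr do rewrite exprMn.
by rewrite big_split /= prodrXr -mdegE mulrCA.
Qed.

Lemma same_point_eval k (g : S) p q : g \is k.-homog -> same_point p q ->
  (g.@[p ord0] == 0) = (g.@[q ord0] == 0).
Proof.
move=> hg [c c0 ->]; rewrite (@meval_eq _ _ _ (fun i => c * q ord0 i)); last first.
  by move=> i; rewrite mxE.
by rewrite (homog_evalZ _ _ hg) mulf_eq0 expf_eq0 (negPf c0) andbF.
Qed.

(** One of the forms p_i X_j - p_j X_i does it. *)
Lemma separating_line p q : p != 0 -> q != 0 -> ~ same_point p q ->
  exists2 l : S, l \is 1.-homog & l.@[p ord0] = 0 /\ l.@[q ord0] != 0.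
Proof.
move=> p0 q0 npq; apply: contrapT => h; apply: npq.
have minor i j : p ord0 i * q ord0 j = p ord0 j * q ord0 i.
  apply: contrapT => /eqP ne; apply: h.
  exists ((p ord0 i) *: 'X_j - (p ord0 j) *: 'X_i).
    by rewrite rpredB // rpredZ // X_homog.
  rewrite !mevalB !mevalZ !mevalXU mulrC subrr; split=> //.
  by rewrite subr_eq0.
have [j qj] : exists j, q ord0 j != 0 by case/rV0Pn: q0 => j; exists j.
have [i pi] : exists i, p ord0 i != 0 by case/rV0Pn: p0 => i; exists i.
have pj : p ord0 j != 0.
  apply: contraNneq pi => pj; have /eqP := minor i j.
  by rewrite pj mul0r mulf_eq0 (negPf qj) orbF.
exists (p ord0 j / q ord0 j); first by rewrite mulf_neq0 ?invr_neq0.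
apply/rowP => k; rewrite !mxE; apply: (mulIf qj).
by rewrite minor mulrAC mulfVK.
Qed.

Lemma homog_prod1 n (G : 'I_n -> S) : (forall i, G i \is 1.-homog) ->
  \prod_i G i \is n.-homog.
Proof.
elim: n G => [|n IH] G hG; first by rewrite big_ord0 dhomog1.
rewrite big_ord_recr /=; apply: (@homogM_eq F n 1) => //; first exact: addn1.
by apply: IH.
Qed.

Lemma coordinate_neq0 p : p != 0 -> exists i, ('X_i : S).@[p ord0] != 0.
Proof. by case/rV0Pn => i pi; exists i; rewrite mevalXU. Qed.

Variable J : S -> Prop.
Hypothesis idJ : ideal_closed J.
Hypothesis hJ : forall k (g : S), J g -> J (pihomog mdeg k g).
Hypothesis bdJ : bounded_codim J.
(** In large degree [J] is saturated. *)
Hypothesis satJ : exists K, forall k (g : S), (K <= k)%N -> g \is k.-homog ->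
  (exists N, forall h : S, h \is N.-homog -> J (h * g)) -> J g.

Definition zero_point p := p != 0 /\ forall g, J g -> g.@[p ord0] = 0.

Lemma zero_pointP p : p != 0 ->
  (forall k g, g \is k.-homog -> J g -> g.@[p ord0] = 0) -> zero_point p.
Proof.
move=> p0 h; split=> // g Jg; rewrite (pihomog_partitionE (leqnn (msize g))).
rewrite raddf_sum big1 // => k _; apply: h (pihomogP _ _ _) _; exact: hJ.
Qed.

Definition distinct_zeros n (s : 'I_n -> 'rV[F]_3) :=
  (forall i, zero_point (s i)) /\ forall i j, same_point (s i) (s j) -> i = j.

(** Forms separating the points are independent modulo [J]. *)
Lemma zeros_bounded : exists B, forall n (s : 'I_n -> 'rV[F]_3),
  distinct_zeros s -> (n <= B)%N.
Proof.
have [B [k0 bd]] := bdJ; exists B => n s [zs ds].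
rewrite leqNgt; apply/negP => ltBn.
pose w := widen_ord ltBn.
have /choice[g hg] (j : 'I_B.+1) : exists g : S, [/\ g \is (k0 + B.+1).-homog,
    g.@[s (w j) ord0] != 0 & forall i, i != j -> g.@[s (w i) ord0] = 0].
  have [c hc] := coordinate_neq0 (zs (w j)).1.
  have /choice[m hm] (i : 'I_B.+1) : exists m : S, [/\ m \is 1.-homog,
      m.@[s (w j) ord0] != 0 & i != j -> m.@[s (w i) ord0] = 0].
    have [->|ij] := eqVneq i j; first by exists 'X_c; rewrite X_homog.
    have [|l hl [l0 lj]] := separating_line (zs (w i)).1 (zs (w j)).1.
      move=> /ds/(congr1 val)/= e; case/eqP: ij; exact: val_inj.
    by exists l.
  exists ('X_c ^+ k0 * \prod_i m i); split.
  - apply: dhomogM; last by apply: homog_prod1 => i; case: (hm i).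
    have := dhomogMn k0 (X_homog F c); rewrite mul1n; exact.
  - rewrite mevalM rmorphXn rmorph_prod mulf_neq0 ?expf_neq0 //.
    by apply/prodf_neq0 => i _; case: (hm i).
  - move=> i ij; rewrite mevalM rmorph_prod (bigD1 i) //=.
    by have [_ _ ->] := hm i; rewrite // mul0r mulr0.
have [||c [j cj] Jc] := bd (k0 + B.+1)%N _ g.
- exact: leq_addr.
- by move=> j; case: (hg j).
have := (zs (w j)).2 _ Jc; rewrite raddf_sum (bigD1 j) //= mevalZ big1.
  by rewrite addr0 => /eqP; rewrite mulf_eq0 (negPf cj); case: (hg j) => _ /negPf->.
by move=> i ij; rewrite mevalZ; case: (hg i) => _ _ -> //; rewrite ?mulr0 // eq_sym.
Qed.

(** A family of distinct zeros of maximal length is complete. *)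
Lemma zeros_list : exists n (s : 'I_n -> 'rV[F]_3), distinct_zeros s /\
  forall p, zero_point p -> exists i, same_point p (s i).
Proof.
have [B hB] := zeros_bounded.
pose P n := `[< exists s : 'I_n -> 'rV[F]_3, distinct_zeros s >].
have P0 : exists n, P n.
  by exists 0%N; apply/asboolP; exists (fun _ => 0); split=> -[].
have Pb n : P n -> (n <= B)%N by move=> /asboolP[s]; apply: hB.
have [n /asboolP[s [zs ds]] maxn] := ex_maxnP P0 Pb.
exists n, s; split=> // p zp; apply: contrapT => np.
have /maxn : P n.+1; last by rewrite ltnn.
apply/asboolP; exists (fcons p s); split=> [i|i j].
  by rewrite /fcons; case: unliftP.
case: (unliftP ord0 i) => [i'|] ->; case: (unliftP ord0 j) => [j'|] -> //;
  rewrite ?fcons0 ?fconsS.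
- by move/ds=> ->.
- by move=> h; case: np; exists i'; apply: same_point_sym.
- by move=> h; case: np; exists j'.
Qed.

Variables (n : nat) (s : 'I_n -> 'rV[F]_3).
Hypothesis ds : distinct_zeros s.
Hypothesis cs : forall p, zero_point p -> exists i, same_point p (s i).
Notation Q i := (local_ideal J (s i)).

(** A power of a line through the first point and not through the second. *)
Lemma local_separation i j : i != j ->
  exists k (g : S), [/\ g \is k.-homog, Q i g & g.@[s j ord0] != 0].
Proof.
move=> ij; have [zs dd] := ds.
have [|l hl [li lj]] := separating_line (zs i).1 (zs j).1.
  by move=> /dd e; rewrite e eqxx in ij.
have [c hc] := coordinate_neq0 (zs i).1.
have [N hN] := local_nilpotent idJ bdJ (isT : 0 < 1)%N hl (X_homog F c) li hc.
exists (1 * N)%N, (l ^+ N); split=> //; first exact: dhomogMn.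
by rewrite rmorphXn expf_neq0.
Qed.

Definition meets (k : nat) (g : S) := forall i : 'I_n, (i < k)%N -> Q i g.

Lemma meets_ideal k : ideal_closed (meets k).
Proof.
have idQ i := local_ideal_ideal (s i) idJ.
split=> [i _|p q hp hq i lt|c p hp i lt]; first by case: (idQ i).
  by case: (idQ i) => _ D _; apply: D; [apply: hp|apply: hq].
by case: (idQ i) => _ _ M; apply: M; apply: hp.
Qed.

(** The sum of the local ideal at one point and the intersection of those at
    the previous points has no zero, so it contains all forms of large degree. *)
Lemma local_comaximal (i : 'I_n) : exists N, forall k (g : S), (N <= k)%N ->
  g \is k.-homog -> exists b : S, [/\ b \is k.-homog, meets i b & Q i (g - b)].
Proof.
have idQ := local_ideal_ideal (s i) idJ; have idM := meets_ideal i.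
pose I (g : S) := exists2 b : S, meets i b & Q i (g - b).
have idI : ideal_closed I.
  have [M0 MD MM] := idM; have [Q0 QD QM] := idQ; split.
  - by exists 0; rewrite // subr0.
  - move=> p q [a Ma Qa] [b Mb Qb]; exists (a + b); first exact: MD.
    by rewrite opprD addrACA; apply: QD.
  - move=> c p [a Ma Qa]; exists (c * a); first exact: MM.
    by rewrite -mulrBr; apply: QM.
have JI g : J g -> I g.
  by exists 0; [case: idM|rewrite subr0; apply: local_idealS].
have [[N hN]|[p p0 zp]] := nullstellensatz idI (bounded_codimS JI bdJ).
  exists N => k g le hg; have [b Mb Qb] := hN k g le hg.
  exists (pihomog mdeg k b); split; first exact: pihomogP.
    by move=> j lt; apply: local_ideal_comp => //; apply: Mb.
  by rewrite -{1}(pihomog_dE hg) -pihomogB; apply: local_ideal_comp.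
have [|m pm] := cs (p := p).
  by apply: zero_pointP => // k g hg Jg; apply: zp hg (JI _ Jg).
exfalso; have [mi|mi] := eqVneq m i; last first.
  have im : i != m by rewrite eq_sym.
  have [k [g [hg Qg gm]]] := local_separation im.
  case/negP: gm; rewrite -(same_point_eval hg pm); apply/eqP/(zp k) => //.
  by exists 0; [case: idM|rewrite subr0].
have [k [g [hg Mg gm]]] : exists k (g : S), [/\ g \is k.-homog, meets i g & g.@[s i ord0] != 0].
  have : forall t, (t <= i)%N ->
      exists k (g : S), [/\ g \is k.-homog, meets t g & g.@[s i ord0] != 0].
    elim=> [|t IH] lt.
      by exists 0%N, 1; rewrite dhomog1 meval1 oner_neq0; split=> // j.
    have [k [g [hg Mg gi]]] := IH (ltnW lt).
    have ltn : (t < n)%N := ltn_trans lt (ltn_ord i).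
    have [|k' [g' [hg' Qg' gi']]] := @local_separation (Ordinal ltn) i.
      by rewrite -val_eqE /= ltn_eqF.
    exists (k + k')%N, (g * g'); split; first exact: dhomogM.
      move=> j; rewrite ltnS leq_eqVlt => /orP[/eqP jt|jt].
        have -> : j = Ordinal ltn by apply: val_inj.
        by case: (local_ideal_ideal (s (Ordinal ltn)) idJ) => _ _; apply.
      rewrite mulrC; case: (local_ideal_ideal (s j) idJ) => _ _; apply.
      exact: Mg.
    by rewrite mevalM mulf_neq0.
  by apply.
case/negP: gm; rewrite -mi -(same_point_eval hg pm); apply/eqP/(zp k) => //.
by exists g => //; rewrite subrr; case: idQ.
Qed.

(** The forms [h] with [h * g] in [J] have no common zero, so they include all
    forms of large degree. *)
Lemma local_to_global : exists N, forall k (g : S), (N <= k)%N -> g \is k.-homog ->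
  (forall i, Q i g) -> J g.
Proof.
have [K hK] := satJ; exists K => k g le hg Qg; apply: (hK k) => //.
have [J0 JD JM] := idJ.
pose I (h : S) := J (h * g).
have idI : ideal_closed I.
  split; rewrite /I; first by rewrite mul0r.
    by move=> p q hp hq; rewrite mulrDl; apply: JD.
  by move=> c p hp; rewrite -mulrA; apply: JM.
have JI h : J h -> I h by rewrite /I mulrC => Jh; apply: JM.
have [[N hN]|[p p0 zp]] := nullstellensatz idI (bounded_codimS JI bdJ).
  by exists N => h; apply: hN.
have [|m pm] := cs (p := p).
  by apply: zero_pointP => // k' h hh Jh; apply: zp hh (JI _ Jh).
have [j [h [hh hm Jh]]] := Qg m.
case/negP: hm; rewrite -(same_point_eval hh pm); apply/eqP.
exact: zp hh Jh.
Qed.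

Lemma ideal_subspace (I : S -> Prop) : ideal_closed I -> subspace I.
Proof.
move=> [I0 ID IM]; split=> // c x y Ix Iy.
by apply: ID => //; rewrite -mul_mpolyC; apply: IM.
Qed.

Lemma subspace_and (V W : S -> Prop) : subspace V -> subspace W ->
  subspace (fun x => V x /\ W x).
Proof.
move=> [V0 sV] [W0 sW]; split=> // c x y [Vx Wx] [Vy Wy].
by split; [apply: sV|apply: sW].
Qed.

(** The chinese remainder theorem: by comaximality, each further local ideal
    lowers the dimension of the intersection by its own codimension. *)
Theorem codim_sum : exists N, forall k t, (N <= k)%N ->
  sdim (fun g : S => g \is k.-homog) J t ->
  exists2 ts : 'I_n -> nat,
    forall i, sdim (fun g : S => g \is k.-homog) (Q i) (ts i) &
    t = (\sum_i ts i)%N.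
Proof.
have [N1 h1] := local_to_global.
have [N2 h2] := choice local_comaximal.
exists (maxn N1 (\max_i N2 i)) => k t; rewrite geq_max => /andP[le1 /bigmax_leqP le2] dJ.
have sH := subspace_homog F 2 k; have sJ := ideal_subspace idJ.
have sQ i := ideal_subspace (local_ideal_ideal (s i) idJ).
have sM m := ideal_subspace (meets_ideal m).
have JQ i g : J g -> Q i g by apply: local_idealS.
have fin (V W : S -> Prop) : subspace V -> subspace W ->
    (forall g, V g -> g \is k.-homog) -> (forall g, J g -> W g) -> exists c, sdim V W c.
  move=> sV sW VH JW.
  have [c _ dc] : exists2 c, (c <= t)%N & sdim V W c; last by exists c.
  apply: sdim_exists => // v Vv.
  have [c c0 Jc] := sdim_dependent sJ dJ (ltnSn t) (fun i => VH _ (Vv i)).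
  by exists c => //; apply: JW.
have /choice[ts dts] i : exists c, sdim (fun g : S => g \is k.-homog) (Q i) c.
  by apply: fin => // g; apply: JQ.
exists ts => //.
pose V m (g : S) := g \is k.-homog /\ meets m g.
have sV m : subspace (V m) by apply: subspace_and.
have VS m g : V m.+1 g -> V m g.
  by move=> [hg Mg]; split=> // i lt; apply: Mg; apply: ltnW.
have step (i : 'I_n) : sdim (V i) (V i.+1) (ts i).
  have [c dc] : exists c, sdim (V i) (meets i.+1) c.
    apply: fin => //; first by move=> g [].
    by move=> g Jg j _; apply: JQ.
  have dc' : sdim (V i) (V i.+1) c.
    apply: (sdim_transfer (phi := idfun)) dc => //.
      by move=> g [hg Mg]; split=> [M|[]].
    by move=> g Vg; exists g => //; rewrite subrr; case: (sV i.+1).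
  suff e : c = ts i by rewrite -e.
  apply: sdim_uniq (sQ i) _ (dts i).
  apply: (sdim_transfer (phi := idfun)) dc' => //.
  - by move=> g [].
  - move=> g [hg Mg]; split=> [[_]|Qg]; first by apply.
    split=> // j; rewrite ltnS leq_eqVlt => /orP[/eqP ji|]; last exact: Mg.
    by rewrite (_ : j = i) //; apply: val_inj.
  - move=> g hg; have [b [hb Mb Qb]] := h2 i k g (le2 i isT) hg.
    by exists b.
have tower m (lem : (m <= n)%N) : sdim (V 0%N) (V m) (\sum_(i < n | (i < m)%N) ts i).
  elim: m lem => [|m IH] lem.
    rewrite big_pred0 //; exists (fun _ => 0); split=> [[]//|c _ []//|g Vg].
    by exists (fun _ => 0); rewrite big_ord0 subr0.
  have -> : (\sum_(i < n | (i < m.+1)%N) ts i =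
      \sum_(i < n | (i < m)%N) ts i + ts (Ordinal lem))%N.
    rewrite (bigD1 (Ordinal lem)) //= addnC; congr (_ + _)%N.
    apply: eq_bigl => i; rewrite ltnS -val_eqE /=.
    by rewrite [in RHS]ltn_neqAle andbC.
  have V0 g : V m g -> V 0%N g by move=> [hg _]; split.
  exact: sdim_tower (sV m) (sV m.+1) V0 (@VS m) (IH (ltnW lem)) (step (Ordinal lem)).
have dV := tower n (leqnn n).
have <- : (\sum_(i < n | (i < n)%N) ts i = \sum_i ts i)%N.
  by apply: eq_bigl => i; rewrite ltn_ord.
apply: (sdim_uniq sJ dJ).
apply: (sdim_transfer (phi := idfun)) dV => //.
- by move=> g [].
- move=> g [hg _]; split=> [[_ Mg]|Jg]; last by split=> // i _; apply: JQ.
  by apply: (h1 k) => // i; apply: Mg.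
- by move=> g hg; exists g; [split|rewrite subrr; case: sJ].
Qed.

End Points.

(** * Affine charts and local Tjurina algebras *)

Section Dehomogenization.

Variables (F : numClosedFieldType) (i : 'I_3).
Notation S := {mpoly F[3]}.
Notation R2 := {mpoly F[2]}.

Definition chart (j : 'I_3) : R2 := if unlift i j is Some k then 'X_k else 1.

Lemma chart_self : chart i = 1.
Proof. by rewrite /chart unlift_none. Qed.

Lemma chart_lift k : chart (lift i k) = 'X_k.
Proof. by rewrite /chart liftK. Qed.

Lemma dehomogE (g : S) : dehomog i g = subst chart g.
Proof. by []. Qed.

Notation D := (subst chart).

Lemma dehomogZ (c : F) (g : S) : D (c *: g) = c *: D g.
Proof. by rewrite -!mul_mpolyC rmorphM /= substC. Qed.

Lemma dehomog_eval k (g : S) (p : 'rV[F]_3) : g \is k.-homog -> p ord0 i != 0 ->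
  g.@[p ord0] = p ord0 i ^+ k * (D g).@[affine_pt i p].
Proof.
move=> hg pi; rewrite /subst comp_mpoly_meval -(homog_evalZ _ _ hg).
apply: meval_eq => j; rewrite tnth_mktuple.
case: (unliftP i j) => [k' ->|->]; last by rewrite chart_self meval1 mulr1.
by rewrite chart_lift mevalXU /affine_pt mulrC mulfVK.
Qed.

Lemma dehomog_neq0 k (g : S) (p : 'rV[F]_3) : g \is k.-homog -> p ord0 i != 0 ->
  (g.@[p ord0] == 0) = ((D g).@[affine_pt i p] == 0).
Proof.
move=> hg pi; rewrite (dehomog_eval hg pi) mulf_eq0 expf_eq0 (negPf pi) andbF //.
Qed.

Definition drop_exponent (m : 'X_{1..3}) : 'X_{1..2} := [multinom m (lift i k) | k < 2].

Lemma dehomogX (m : 'X_{1..3}) : D 'X_[m] = 'X_[drop_exponent m].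
Proof.
rewrite /subst comp_mpolyX (bigD1_ord i) //= tnth_mktuple chart_self expr1n mul1r.
rewrite mpolyXE_id; apply: eq_bigr => k _.
by rewrite tnth_mktuple chart_lift mnmE.
Qed.

(** The exponent that is dropped is determined by the degree. *)
Lemma drop_exponent_inj m m' : mdeg m = mdeg m' -> drop_exponent m = drop_exponent m' ->
  m = m'.
Proof.
move=> em ed; have e k : m (lift i k) = m' (lift i k).
  by have := congr1 (fun M : 'X_{1..2} => M k) ed; rewrite !mnmE.
apply/mnmP => j; case: (unliftP i j) => [k ->|->] //.
move: em; rewrite !mdegE (bigD1_ord i) //= [in RHS](bigD1_ord i) //=.
rewrite [X in (_ + X)%N = _](eq_bigr (fun k => m' (lift i k))) => [|k _]; last exact: e.
by move/addIn.
Qed.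

Lemma dehomog_inj k (g : S) : g \is k.-homog -> D g = 0 -> g = 0.
Proof.
move=> hg; rewrite {1}(mpolyE g) raddf_sum /= => e.
apply/mpolyP => m; rewrite mcoeff0; apply: contrapT => /eqP gm.
have hm : m \in msupp g by rewrite mcoeff_msupp.
have := congr1 (mcoeff (drop_exponent m)) e; rewrite mcoeff0 raddf_sum /=.
rewrite (bigD1_seq m) //= dehomogZ dehomogX mcoeffZ mcoeffX eqxx mulr1.
rewrite big_seq_cond big1 => [|m' /andP[hm' mm']].
  by rewrite addr0 => /eqP; rewrite (negPf gm).
rewrite dehomogZ dehomogX mcoeffZ mcoeffX; case: eqP => [e'|]; last by rewrite mulr0.
case/eqP: mm'; apply: drop_exponent_inj => //.
by transitivity k; [|symmetry]; apply: (dhomog_mf hg).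
Qed.

Lemma homogenize (g : R2) : exists d0, forall d, (d0 <= d)%N ->
  exists2 G : S, G \is d.-homog & D G = g.
Proof.
elim/mpoly_ind_ring: g => [c|g h [d1 h1] [d2 h2]|k g [d1 h1]].
- exists 0%N => d _; exists (c *: 'X_i ^+ d).
    by apply: rpredZ; have := dhomogMn d (X_homog F i); rewrite mul1n.
  by rewrite dehomogZ rmorphXn /= substX chart_self expr1n -alg_mpolyC.
- exists (maxn d1 d2) => d; rewrite geq_max => /andP[/h1[G hG eG] /h2[H hH eH]].
  by exists (G + H); [apply: rpredD|rewrite rmorphD /= eG eH].
- exists d1.+1 => -[//|d]; rewrite ltnS => /h1[G hG eG].
  exists ('X_(lift i k) * G); first exact: homogM_eq (X_homog F _) hG.
  by rewrite rmorphM /= substX chart_lift eG.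
Qed.

Lemma mderivXU n (j k : 'I_n) : ('X_j : {mpoly F[n]})^`M(k) = (j == k)%:R.
Proof.
rewrite mderivX mnm1E; case: eqP => [->|_]; last by rewrite scale0r.
by rewrite scale1r (_ : (U_(k) - U_(k))%MM = 0%MM) ?mpolyX0 //;
   apply/mnmP => t; rewrite mnmBE mnm0E subnn.
Qed.

Lemma dehomog_deriv k (g : S) : D g^`M(lift i k) = (D g)^`M(k).
Proof.
elim/mpoly_ind_ring: g => [c|g h hg hh|j g hg].
- by rewrite mderivC rmorph0 substC mderivC.
- by rewrite mderivD !rmorphD /= mderivD hg hh.
rewrite mderivM rmorphD !rmorphM /= mderivM hg; congr (_ + _).
congr (_ * _); rewrite mderivXU substX; case: (unliftP i j) => [k' ->|->].
  by rewrite chart_lift mderivXU (inj_eq lift_inj) rmorph_nat.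
by rewrite chart_self (negPf (neq_lift _ _)) rmorph0 -mpolyC1 mderivC.
Qed.

End Dehomogenization.

Lemma clear_denominators3 (E : fieldType) (k0 q0 q1 w v u x y z : E) :
  w != 0 -> v != 0 -> u != 0 ->
  w * (v * u) * (k0 / w * x + (q0 / v * y + q1 / u * z))
  = k0 * (v * u) * x + (q0 * (w * u) * y + q1 * (w * v) * z).
Proof. by move=> w0 v0 u0; field; rewrite w0 v0 u0. Qed.

Lemma clear_fractions (A : idomainType) (k0 q0 q1 w v u x y z : A) :
  w != 0 -> v != 0 -> u != 0 ->
  tofrac (w * (v * u)) * (tofrac k0 / tofrac w * tofrac x +
    (tofrac q0 / tofrac v * tofrac y + tofrac q1 / tofrac u * tofrac z))
  = tofrac (k0 * (v * u) * x + (q0 * (w * u) * y + q1 * (w * v) * z)).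
Proof.
rewrite -!(tofrac_eq0 w) -!(tofrac_eq0 v) -!(tofrac_eq0 u) !(tofracD, tofracM).
exact: (@clear_denominators3 {fraction A}).
Qed.

Lemma factor_quotient (E : fieldType) (b h s u : E) : s != 0 ->
  h / s - b * (h * u) = h / s * (1 - b * (s * u)).
Proof. by move=> s0; field. Qed.

Lemma quotient_identity (A : idomainType) (b h s u : A) : s != 0 ->
  tofrac h / tofrac s - tofrac (b * (h * u))
  = tofrac h / tofrac s * (1 - tofrac (b * (s * u))).
Proof. rewrite -(tofrac_eq0 s) !tofracM; exact: (@factor_quotient {fraction A}). Qed.

Lemma telescope3 (V : zmodType) (x y z w : V) :
  x - w = (x - y) + ((y - z) + (z - w)).
Proof. by rewrite !addrA !subrK. Qed.

Section LocalRing.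

Variables (F : numClosedFieldType) (a : 'I_2 -> F) (g : {mpoly F[2]}).
Notation R2 := {mpoly F[2]}.
Notation O := (local_ring a).
Notation T := (tjurina_ideal g a).

Lemma neq0_eval n (s : {mpoly F[n]}) v : s.@[v] != 0 -> s != 0.
Proof. by apply: contraNneq => ->; rewrite meval0. Qed.

Lemma tofrac_neq0 (s : R2) : s.@[a] != 0 -> tofrac s != 0.
Proof. by move/neq0_eval; rewrite tofrac_eq0. Qed.

Lemma local_ring_poly (h : R2) : O (tofrac h).
Proof. by exists h, 1; rewrite meval1 oner_neq0 rmorph1 divr1. Qed.

Lemma local_ringD x y : O x -> O y -> O (x + y).
Proof.
move=> [h [s [sa ->]]] [k [t [ta ->]]]; exists (h * t + k * s), (s * t).
rewrite mevalM mulf_neq0 //; split=> //.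
by rewrite rmorphD !rmorphM /= addf_div // tofrac_neq0.
Qed.

Lemma local_ringM x y : O x -> O y -> O (x * y).
Proof.
move=> [h [s [sa ->]]] [k [t [ta ->]]]; exists (h * k), (s * t).
by rewrite mevalM mulf_neq0 // !rmorphM /= mulf_div.
Qed.

Lemma local_ringV (s : R2) : s.@[a] != 0 -> O (tofrac s)^-1.
Proof. by move=> sa; exists 1, s; rewrite rmorph1 div1r. Qed.

Lemma tjurinaD x y : T x -> T y -> T (x + y).
Proof.
move=> [h0 [h [O0 Oh ->]]] [k0 [k [P0 Pk ->]]].
exists (h0 + k0), (fun t => h t + k t); split; first exact: local_ringD.
  by move=> t; apply: local_ringD.
rewrite mulrDl addrACA -big_split /=; congr (_ + _).
by apply: eq_bigr => t _; rewrite mulrDl.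
Qed.

Lemma tjurinaM c x : O c -> T x -> T (c * x).
Proof.
move=> Oc [h0 [h [O0 Oh ->]]]; exists (c * h0), (fun t => c * h t); split.
- exact: local_ringM.
- by move=> t; apply: local_ringM.
by rewrite mulrDr mulrA mulr_sumr; under eq_bigr do rewrite mulrA.
Qed.

Lemma tjurina0 : T 0.
Proof.
exists 0, (fun _ => 0); rewrite mul0r add0r big1 => [|t _]; last by rewrite mul0r.
by split=> // [|_]; rewrite -tofrac0; apply: local_ring_poly.
Qed.

Lemma tjurina_eq : T (tofrac g).
Proof.
exists 1, (fun _ => 0); rewrite mul1r big1 => [|t _]; last by rewrite mul0r.
by rewrite addr0; split=> // [|_]; rewrite -?tofrac1 -?tofrac0; apply: local_ring_poly.
Qed.

Lemma tjurina_deriv k : T (tofrac g^`M(k)).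
Proof.
exists 0, (fun t => (k == t)%:R); rewrite mul0r add0r; split.
- by rewrite -tofrac0; apply: local_ring_poly.
- by move=> t; case: eqP => _; rewrite -?tofrac1 -?tofrac0; apply: local_ring_poly.
rewrite (bigD1 k) //= eqxx mul1r big1 ?addr0 // => t.
by rewrite eq_sym => /negPf->; rewrite mul0r.
Qed.

Lemma tjurinaN x : T x -> T (- x).
Proof.
move=> Tx; rewrite -mulN1r; apply: tjurinaM => //.
by rewrite -tofrac1 -tofracN; apply: local_ring_poly.
Qed.

Lemma tjurina_clear x : T x -> exists s h0 (h : 'I_2 -> R2), s.@[a] != 0 /\
  tofrac s * x = tofrac (h0 * g + \sum_k h k * g^`M(k)).
Proof.
move=> [_ [h [[k0 [s0 [sa0 ->]]] Oh ->]]].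
have /choice[k hk] t : exists ks : R2 * R2, ks.2.@[a] != 0 /\ h t = tofrac ks.1 / tofrac ks.2.
  by have [u [s [sa e]]] := Oh t; exists (u, s).
pose q t := (k t).1; pose s t := (k t).2.
have sa t : (s t).@[a] != 0 by case: (hk t).
exists (s0 * (s ord0 * s ord_max)), (k0 * (s ord0 * s ord_max)),
  (fun t => if t == ord0 then q t * (s0 * s ord_max) else q t * (s0 * s ord0)).
split; first by rewrite !mevalM !mulf_neq0.
rewrite !big_ord_recl !big_ord0 !addr0 /=.
have -> : lift ord0 ord0 = ord_max :> 'I_2 by apply: val_inj.
rewrite (hk ord0).2 (hk ord_max).2 -/(q ord0) -/(s ord0) -/(q ord_max) -/(s ord_max).
by apply: clear_fractions; apply: neq0_eval; [exact: sa0|exact: sa|exact: sa].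
Qed.

End LocalRing.

Section Comparison.

Variables (F : numClosedFieldType) (f : {mpoly F[3]}) (d : nat).
Notation S := {mpoly F[3]}.
Notation J := (jacobian f).
Hypothesis hf : f \is d.+1.-homog.
Hypothesis bdJ : bounded_codim J.
Variables (p : 'rV[F]_3) (i : 'I_3).
Hypothesis pi : p ord0 i != 0.
Notation D := (subst (chart F i)).
Notation a := (affine_pt i p).
Notation O := (local_ring a).
Notation T := (tjurina_ideal (dehomog i f) a).
Notation Q := (local_ideal J p).

Lemma jacobian_ideal : ideal_closed J.
Proof.
split; first by case: (subspace_generated (fun j => f^`M(j))).
- exact: generatedD.
- exact: generatedM.
Qed.

Lemma jacobian_self : J f.
Proof.
have d0 : d.+1%:R != 0 :> F by rewrite pnatr_eq0.
have e : (d.+1%:R^-1)%:MP * (\sum_j 'X_j * f^`M(j)) = f.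
  by rewrite (euler hf) mul_mpolyC scalerA mulVf // scale1r.
by rewrite -[X in jacobian _ X]e; apply: generatedM; exists (fun j => 'X_j).
Qed.

(** The partial in the direction of the chart is not a partial of the local
    equation; Euler's relation expresses it by the others and the equation. *)
Lemma chart_partial j : T (tofrac (D f^`M(j))).
Proof.
case: (unliftP i j) => [k ->|->]; first by rewrite dehomog_deriv; apply: tjurina_deriv.
have := congr1 D (euler hf); rewrite raddf_sum (bigD1_ord i) //= rmorphM /= substX chart_self.
rewrite mul1r dehomogZ => e.
have -> : D f^`M(i) = d.+1%:R *: D f - \sum_(k < 2) 'X_k * (D f)^`M(k).
  rewrite -e; under eq_bigr do rewrite rmorphM /= substX chart_lift dehomog_deriv.
  by rewrite addrK.
rewrite tofracB -mul_mpolyC tofracM; apply: tjurinaD.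
  by apply: tjurinaM; [apply: local_ring_poly|apply: tjurina_eq].
apply: tjurinaN; rewrite raddf_sum /=; elim/big_ind: _ => [||k _].
- exact: tjurina0.
- exact: tjurinaD.
by rewrite tofracM; apply: tjurinaM; [apply: local_ring_poly|apply: tjurina_deriv].
Qed.

Lemma chart_jacobian (h : S) : J h -> T (tofrac (D h)).
Proof.
move=> [c ->]; rewrite [D _]raddf_sum [tofrac _]raddf_sum /=; elim/big_ind: _ => [||j _].
- exact: tjurina0.
- exact: tjurinaD.
rewrite rmorphM tofracM; apply: tjurinaM; first exact: local_ring_poly.
exact: chart_partial.
Qed.

Lemma chart_local (h : S) : Q h -> T (tofrac (D h)).
Proof.
move=> [j [s [hs sp /chart_jacobian]]]; rewrite rmorphM tofracM => Ts.
have sa : (D s).@[a] != 0 by rewrite -(dehomog_neq0 hs pi).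
have -> : tofrac (D h) = (tofrac (D s))^-1 * (tofrac (D s) * tofrac (D h)).
  by rewrite mulrA mulVf ?mul1r //; apply: tofrac_neq0 sa.
by apply: tjurinaM => //; apply: local_ringV.
Qed.

(** After clearing denominators the relation is homogenised; both sides then have
    the same degree, so they agree because dehomogenisation is injective on forms. *)
Lemma chart_local_inv k (h : S) : h \is k.-homog -> T (tofrac (D h)) -> Q h.
Proof.
move=> hh /tjurina_clear[s [h0 [u [sa]]]]; rewrite -tofracM => /eqP.
rewrite tofrac_eq => /eqP e.
have [d1 H1] := homogenize i s; have [d2 H2] := homogenize i h0.
have [d3 H3] := homogenize i (u ord0); have [d4 H4] := homogenize i (u ord_max).
pose e0 := (d1 + d2 + d3 + d4)%N.
have [|s' hs es] := H1 (e0 + d.+1)%N; first by rewrite /e0; lia.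
have [|h0' hh0 eh0] := H2 (e0 + k)%N; first by rewrite /e0; lia.
have [|u0 hu0 eu0] := H3 (e0 + k.+1)%N; first by rewrite /e0; lia.
have [|u1 hu1 eu1] := H4 (e0 + k.+1)%N; first by rewrite /e0; lia.
have hp j : f^`M(j) \is d.-homog by apply: homog_deriv.
exists (e0 + d.+1)%N, s'; split=> //.
  by rewrite (dehomog_neq0 hs pi) es.
pose w := h0' * f + (u0 * f^`M(lift i ord0) + u1 * f^`M(lift i ord_max)).
have -> : s' * h = w.
  apply/eqP; rewrite -subr_eq0; apply/eqP.
  apply: (@dehomog_inj F i (e0 + d.+1 + k)%N).
    apply: rpredB; first exact: homogM_eq hs hh.
    apply: rpredD; first by apply: homogM_eq hh0 hf; lia.
    by apply: rpredD; [apply: homogM_eq hu0 (hp _)|apply: homogM_eq hu1 (hp _)]; lia.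
  rewrite /w rmorphB !rmorphD !rmorphM /= es eh0 eu0 eu1 !dehomog_deriv e dehomogE.
  rewrite !big_ord_recl big_ord0 addr0.
  by rewrite (_ : lift ord0 ord0 = ord_max :> 'I_2) ?subrr //; apply: val_inj.
have [J0 JD JM] := jacobian_ideal.
apply: (JD); first by apply: (JM); apply: jacobian_self.
by apply: (JD); apply: (JM); apply: (generated_gen (fun j => f^`M(j))).
Qed.

Notation c j := (p ord0 j / p ord0 i).

Lemma line_nilpotent j : exists N, Q (('X_j - c j *: 'X_i) ^+ N.+1).
Proof.
have [|||||N hN] := @local_nilpotent F J p 1 ('X_j - c j *: 'X_i) 'X_i jacobian_ideal bdJ.
- by [].
- by rewrite rpredB // ?rpredZ // X_homog.
- exact: X_homog.
- by rewrite mevalB mevalZ !mevalXU mulfVK // subrr.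
- by rewrite mevalXU.
exists N; have [_ _ QM] := local_ideal_ideal p jacobian_ideal.
by rewrite exprS; apply: QM.
Qed.

(** A monomial of large degree without X_i contains a large power of some other
    X_j, and X_j^n - (X_j - c_j X_i)^n is a multiple of X_i, the subtracted power
    being in the local ideal. *)
Lemma descend : exists K, forall k (h : S), (K <= k)%N -> h \is k.+1.-homog ->
  exists2 h' : S, h' \is k.-homog & Q (h - 'X_i * h').
Proof.
have [N hN] := choice line_nilpotent.
have [Q0 QD QM] := local_ideal_ideal p jacobian_ideal.
exists (\sum_j (N j).+1)%N => k h le hh.
pose W (g : S) := exists2 h' : S, h' \is k.-homog & Q (g - 'X_i * h').
suff Wm m : mdeg m = k.+1 -> W 'X_[m].
  rewrite -/(W h) (mpolyE h) big_seq; elim/big_ind: _ => [||m hm].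
  - by exists 0; [apply: dhomog0|rewrite mulr0 subr0].
  - move=> x y [x' hx Qx] [y' hy Qy]; exists (x' + y'); first exact: rpredD.
    by rewrite mulrDr opprD addrACA; apply: QD.
  - have [x' hx Qx] := Wm m (dhomog_mf hh hm); exists (h@_m *: x'); first exact: rpredZ.
    by rewrite -scalerAr -scalerBr -mul_mpolyC; apply: QM.
move=> dm; have [mi|mi] := eqVneq (m i) 0%N; last first.
  exists 'X_[m - U_(i)].
    rewrite dhomogX; apply/eqP; have /eqP := dm.
    by rewrite -{1}(submK (m := U_(i)%MM) (m' := m)) ?lep1mP // mdegD mdeg1 addn1 eqSS => /eqP.
  by rewrite -mpolyXD addmC submK ?lep1mP // subrr.
have [j lej] : exists j, ((N j).+1 <= m j)%N.
  apply: contrapT => hno; have lt j : (m j < (N j).+1)%N.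
    by rewrite ltnNge; apply/negP => h'; apply: hno; exists j.
  move: le; rewrite leqNgt => /negP; apply; rewrite -dm mdegE !sum3.
  by have := lt i0; have := lt i1; have := lt i2; lia.
set n := (N j).+1 in lej.
pose m' := (m - U_(j) *+ n)%MM.
have mE : m = (m' + U_(j) *+ n)%MM.
  rewrite submK //; apply/mnm_lepP => t.
  by rewrite mulmnE mnm1E; case: eqP => [<-|_]; rewrite ?mul1n.
have dm' : (mdeg m' + n = k.+1)%N by rewrite -dm [X in _ = mdeg X]mE mdegD mdegMn mdeg1 mul1n.
pose L : S := 'X_j - c j *: 'X_i.
pose G : S := \sum_(t < n) 'X_j ^+ (n.-1 - t) * L ^+ t.
have hL : L \is 1.-homog by rewrite rpredB // ?rpredZ // X_homog.
have hG : G \is (N j).-homog.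
  apply: rpred_sum => t _; have h1 := dhomogMn ((N j) - t)%N (X_homog F j).
  have h2 := dhomogMn t hL; rewrite mul1n in h1; rewrite mul1n in h2.
  by apply: homogM_eq h1 h2; rewrite subnK // -ltnS.
exists (c j *: ('X_[m'] * G)).
  apply: rpredZ; apply: homogM_eq hG; last by rewrite dhomogX.
  by apply/eqP; rewrite -eqSS -addnS dm'.
have -> : 'X_[m] - 'X_i * (c j *: ('X_[m'] * G)) = 'X_[m'] * L ^+ n.
  have := subrXX ('X_j : S) L n; rewrite -/G => eX.
  rewrite [X in 'X_[X]]mE mpolyXD -mpolyXn.
  have -> : 'X_j ^+ n = L ^+ n + ('X_j - L) * G.
    by rewrite -eX [RHS]addrC subrK.
  have -> : 'X_j - L = c j *: 'X_i by rewrite /L opprB addrC subrK.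
  by rewrite -!mul_mpolyC; ring.
by apply: QM; apply: hN.
Qed.

Lemma descend_many : exists K, forall k r (h : S), (K <= k)%N -> h \is (r + k).-homog ->
  exists2 h' : S, h' \is k.-homog & Q (h - 'X_i ^+ r * h').
Proof.
have [K hK] := descend; exists K => k r h le.
have [Q0 QD QM] := local_ideal_ideal p jacobian_ideal.
elim: r h => [|r IH] h hh; first by exists h; rewrite // mul1r subrr.
have [|h1 hh1 Q1] := hK (r + k)%N h _ hh; first exact: leq_trans le (leq_addl _ _).
have [h2 hh2 Q2] := IH _ hh1; exists h2 => //.
have -> : h - 'X_i ^+ r.+1 * h2 = (h - 'X_i * h1) + 'X_i * (h1 - 'X_i ^+ r * h2).
  by rewrite exprS; ring.
by apply: QD => //; apply: QM.
Qed.

(** A denominator is invertible modulo the ideal because one minus it, suitably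
    scaled and homogenised, is nilpotent. *)
Lemma local_ring_form x : O x ->
  exists k (h : S), h \is k.-homog /\ T (x - tofrac (D h)).
Proof.
move=> Ox; have [g [s [sa ex]]] := Ox.
have [d1 H1] := homogenize i s; have [d2 H2] := homogenize i g.
pose e := (d1 + d2).+1.
have [|s' hs es] := H1 e; first by rewrite /e; lia.
have [|g' hg eg] := H2 e; first by rewrite /e; lia.
pose b := (s.@[a])^-1.
have hX : 'X_i ^+ e \is [in F[3], e.-homog].
  by have := dhomogMn e (X_homog F i); rewrite mul1n.
pose l : S := 'X_i ^+ e - b *: s'.
have [|||||N hN] := @local_nilpotent F J p e l ('X_i ^+ e) jacobian_ideal bdJ.
- by [].
- by rewrite rpredB // rpredZ.
- exact: hX.
- rewrite mevalB mevalZ (dehomog_eval hs pi) es rmorphXn /= mevalXU.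
  by rewrite mulrCA mulVf // mulr1 subrr.
- by rewrite rmorphXn /= mevalXU expf_neq0.
have {}hN : Q (l ^+ N.+1).
  have [_ _ QM] := local_ideal_ideal p jacobian_ideal.
  by rewrite exprS; apply: QM.
pose U : S := \sum_(t < N.+1) ('X_i ^+ e) ^+ (N - t) * l ^+ t.
have hU : U \is (e * N).-homog.
  apply: rpred_sum => t _; have h1 := dhomogMn (N - t)%N hX.
  have hl : l \is e.-homog by rewrite rpredB // rpredZ.
  have h2 := dhomogMn t hl.
  by apply: homogM_eq h1 h2; rewrite -mulnDr subnK // -ltnS.
exists (e + e * N)%N, (b *: (g' * U)); split; first by rewrite rpredZ // dhomogM.
have DX : D ('X_i ^+ e) = 1 by rewrite rmorphXn /= substX chart_self expr1n.
have lE : l ^+ N.+1 = ('X_i ^+ e) ^+ N.+1 - b *: (s' * U).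
  have e1 : 'X_i ^+ e - l = b *: s' by rewrite /l opprB [LHS]addrC subrK.
  rewrite scalerAl -e1; have := subrXX ('X_i ^+ e : S) l N.+1; rewrite -/U => <-.
  by rewrite opprB [RHS]addrC subrK.
have eU : D (l ^+ N.+1) = 1 - b *: (s * D U).
  have DXN : D (('X_i ^+ e) ^+ N.+1) = 1 by rewrite [LHS]rmorphXn /= DX expr1n.
  by rewrite lE [LHS]rmorphB /= DXN dehomogZ [D (_ * _)]rmorphM /= es.
have -> : x - tofrac (D (b *: (g' * U))) = x * tofrac (D (l ^+ N.+1)).
  rewrite eU dehomogZ rmorphM /= eg tofracB tofrac1 -!mul_mpolyC ex.
  exact: quotient_identity (neq0_eval sa).
by apply: tjurinaM => //; apply: chart_local.
Qed.

(** Dehomogenisation maps the forms of degree [k], modulo the local ideal,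
    isomorphically onto the Tjurina algebra in the chart: any element of the local
    ring is represented by a form of some degree, which can be changed to [k] since
    X_i becomes 1. *)
Theorem local_tjurina_chart : exists K, forall k t, (K <= k)%N ->
  sdim (fun h : S => h \is k.-homog) Q t ->
  quot_dim (fun b : F => tofrac (b%:MP_[2])) O T t.
Proof.
have [K down] := descend_many; exists K => k t le [v [hv iv gv]].
have comb (b : 'I_t -> F) : \sum_j tofrac (b j)%:MP * tofrac (D (v j))
    = tofrac (D (\sum_j b j *: v j)).
  rewrite [D _]raddf_sum [tofrac _]raddf_sum /=; apply: eq_bigr => j _.
  by rewrite dehomogZ -mul_mpolyC tofracM.
exists (fun j => tofrac (D (v j))); split.
- by move=> j; apply: local_ring_poly.
- move=> b; rewrite comb => Tb; apply: iv; apply: (chart_local_inv (k := k)) => //.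
  by apply: rpred_sum => j _; apply: rpredZ; apply: hv.
- move=> x /local_ring_form[k' [h [hh Tx]]].
  have hX : 'X_i ^+ k \is [in F[3], k.-homog].
    by have := dhomogMn k (X_homog F i); rewrite mul1n.
  have [h' hh' Qh'] := down k k' _ le (homogM_eq (addnC k k') hX hh).
  have [b hb] := gv h' hh'; exists b; rewrite comb.
  have DB (u w : S) : D (u - w) = D u - D w by apply: rmorphB.
  have DM (u w : S) : D (u * w) = D u * D w by apply: rmorphM.
  have DX r : D ('X_i ^+ r) = 1 by rewrite rmorphXn /= substX chart_self expr1n.
  have e1 : tofrac (D h) - tofrac (D h') = tofrac (D ('X_i ^+ k * h - 'X_i ^+ k' * h')).
    by rewrite DB !DM !DX !mul1r tofracB.
  have e2 : tofrac (D h') - tofrac (D (\sum_j b j *: v j))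
      = tofrac (D (h' - \sum_j b j *: v j)).
    by rewrite DB tofracB.
  rewrite (telescope3 x (tofrac (D h)) (tofrac (D h'))) e1 e2.
  apply: tjurinaD => //; apply: tjurinaD; exact: chart_local.
Qed.

End Comparison.

(** * Smooth curves *)

Section Zeros.

Variables (F : numClosedFieldType) (n : nat).
Notation S := {mpoly F[n]}.

Lemma line_restriction (q : S) (v : 'I_n -> F) (i : 'I_n) : exists P : {poly F},
  (forall t, P.[t] = q.@[fun j => v j + t *+ (j == i)]) /\
  P^`().[0] = q^`M(i).@[v].
Proof.
elim/mpoly_ind_ring: q => [c|p q [P [hP dP]] [Q [hQ dQ]]|j p [P [hP dP]]].
- by exists c%:P; split=> [t|]; rewrite ?hornerC ?mevalC // derivC mderivC horner0 meval0.
- exists (P + Q); split=> [t|]; first by rewrite hornerD mevalD hP hQ.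
  by rewrite derivD hornerD mderivD mevalD dP dQ.
exists (((v j)%:P + 'X *+ (j == i)) * P); split=> [t|].
  by rewrite hornerM hP mevalM mevalXU hornerD hornerC hornerMn hornerX.
rewrite derivM hornerD !hornerM mderivM mevalD !mevalM dP mevalXU mderivXU.
rewrite derivD derivC add0r derivMn derivX hornerMn hornerC rmorph_nat.
rewrite hornerD hornerC hornerMn hornerX mul0rn addr0; congr (_ * _ + _).
rewrite (hP 0); apply: meval_eq => k; by rewrite mul0rn addr0.
Qed.

Lemma poly_eq0_of_roots (P : {poly F}) : (forall t, P.[t] = 0) -> P = 0.
Proof.
move=> h; apply: contrapT => /eqP P0.
have := @max_poly_roots F P [seq k%:R | k <- iota 0 (size P)] P0.
rewrite size_map size_iota ltnn => H; have : false; last by [].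
apply: H; first by apply/allP => _ /mapP[k _ ->]; rewrite /root h.
by rewrite map_inj_uniq ?iota_uniq // => x y /eqP; rewrite eqr_nat => /eqP.
Qed.

(** A polynomial that vanishes everywhere has derivatives that vanish everywhere,
    and some iterated derivative is a nonzero constant. *)
Lemma exists_nonzero_value (q : S) : q != 0 -> exists v, q.@[v] != 0.
Proof.
have [N] := ubnP (msize q); elim: N q => // N IH q; rewrite ltnS => leN q0.
have [h|/existsNP[i /eqP qi]] := EM (forall i, q^`M(i) = 0).
  exists (fun _ => 0); rewrite (deriv0_const h) mevalC.
  by apply: contraNneq q0 => e; rewrite (deriv0_const h) e.
have [v hv] := IH _ (leq_trans (msize_deriv i q0) leN) qi.
apply: contrapT => no; have [P [hP dP]] := line_restriction q v i.
case/eqP: hv; rewrite -dP (@poly_eq0_of_roots P) ?deriv0 ?horner0 // => t.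
by rewrite hP; apply: contrapT => /eqP e; apply: no; eexists; exact: e.
Qed.

End Zeros.

Section Smooth.

Variable F : numClosedFieldType.
Notation S := {mpoly F[3]}.

(** Along a line on which the derivative does not vanish identically a
    polynomial has a root; the line is chosen away from the origin. *)
Lemma nonconstant_zero (h : S) (j : 'I_3) : h^`M(j) != 0 ->
  exists2 p : 'rV[F]_3, p != 0 & h.@[p ord0] = 0.
Proof.
move=> hj; pose i := lift j ord0.
have [v] := exists_nonzero_value (mulf_neq0 hj (mpolyX_neq0 F i)).
rewrite mevalM mevalXU mulf_eq0 negb_or => /andP[hv vi].
have [P [hP dP]] := line_restriction h v j.
have /closed_rootP[t /eqP Pt] : size P != 1.
  apply: contraNneq hv => /eqP sP; rewrite -dP.
  by rewrite (size1_polyC (eq_leq (eqP sP))) derivC horner0.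
exists (\row_k (v k + t *+ (k == j))).
  apply/eqP => /rowP/(_ i)/eqP; rewrite !mxE.
  have -> : (i == j) = false by rewrite eq_sym; apply/negbTE/neq_lift.
  by rewrite mulr0n addr0 (negPf vi).
rewrite -[RHS]Pt hP; apply: meval_eq => k; by rewrite mxE.
Qed.

Lemma singular_zero d (f : S) p : f \is d.+1.-homog ->
  singular_point f p <-> zero_point (jacobian f) p.
Proof.
move=> hf; split=> [[p0 _ fp]|[p0 zp]].
  split=> // g [c ->]; rewrite raddf_sum big1 //= => j _.
  by rewrite mevalM fp mulr0.
split=> //; first by apply: zp; apply: jacobian_self hf.
by move=> i; apply: zp; apply: (generated_gen (fun j => f^`M(j))).
Qed.

Lemma prime_nonconstant (h : S) : prime_elt h -> exists j, h^`M(j) != 0.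
Proof.
move=> [h0 hu _]; apply: contrapT => no; case/negP: hu.
have hc j : h^`M(j) = 0 by apply: contrapT => /eqP e; apply: no; exists j.
rewrite (deriv0_const hc); apply: rmorph_unit.
by rewrite unitfE; apply: contraNneq h0 => e; rewrite (deriv0_const hc) e.
Qed.

(** A common factor would have a zero outside the origin, which is a singular
    point. *)
Lemma smooth_no_common_factor d (f : S) : f \is d.+1.-homog -> smooth_curve f ->
  no_common_factor f.
Proof.
move=> hf sf h hp hd; have [j hj] := prime_nonconstant hp.
have [p p0 hz] := nonconstant_zero hj.
apply: sf; exists p; apply/(singular_zero p hf); split=> // g [c ->].
rewrite raddf_sum big1 //= => i _; have [u ->] := hd i.
by rewrite !mevalM hz !mulr0.
Qed.

Lemma smooth_partial_neq0 d (f : S) : f \is d.+1.-homog -> smooth_curve f ->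
  exists i, f^`M(i) != 0.
Proof.
move=> hf sf; apply: contrapT => no; apply: sf.
have h0 i : f^`M(i) = 0 by apply: contrapT => /eqP e; apply: no; exists i.
exists (\row_j 1); apply/(singular_zero _ hf); split=> [|g [c ->]].
  by apply/eqP => /rowP/(_ i0)/eqP; rewrite !mxE oner_eq0.
by rewrite raddf_sum big1 //= => i _; rewrite h0 mulr0 meval0.
Qed.

Section CompleteIntersection.

Variables (a b : S).
Hypothesis a0 : a != 0.
Hypothesis cop : coprime_elt a b.

Definition pair_ideal (q : S) := exists u v, q = u * a + v * b.

Lemma pair_ideal_ideal : ideal_closed pair_ideal.
Proof.
split; first by exists 0, 0; ring.
- by move=> p q [u [v ->]] [u' [v' ->]]; exists (u + u'), (v + v'); ring.
- by move=> c p [u [v ->]]; exists (c * u), (c * v); ring.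
Qed.

(** With q X = a u + b v, multiplying by K gives a syzygy of the pair in each
    row, so K v = a T and K u = - b T. Then X^T T = 0, T = K V, and u + b V and
    v - a V are multiples of X. *)
Lemma pair_saturated_step (q : S) : (forall i, pair_ideal ('X_i * q)) -> pair_ideal q.
Proof.
move=> h; have /choice[U hU] i : exists uv : S * S, 'X_i * q = uv.1 * a + uv.2 * b.
  by have [u [v e]] := h i; exists (u, v).
pose u : 'cV[S]_3 := \col_i (U i).1; pose v : 'cV[S]_3 := \col_i (U i).2.
have quv : q *: Xcol F = a *: u + b *: v.
  by apply/colP => i; rewrite !mxE mulrC hU; ring.
have Kuv : a *: (koszul F *m u) + b *: (koszul F *m v) = 0.
  by rewrite !scalemxAr -mulmxDr -quv -scalemxAr koszulX scaler0.
have Kent i : a * (koszul F *m u) i ord0 + b * (koszul F *m v) i ord0 = 0.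
  have ent (x y : 'cV[S]_3) : (a *: x + b *: y) i ord0 = a * x i ord0 + b * y i ord0.
    by rewrite !mxE.
  by rewrite -ent Kuv mxE.
have /choice[t ht] i : exists t, (koszul F *m v) i ord0 = t * a.
  apply: (coprime_divides (@factorial_mpoly F 3) a0 cop).
  exists (- (koszul F *m u) i ord0).
  apply/eqP; rewrite -subr_eq0 mulNr opprK -(Kent i).
  by move: ((koszul F *m u) i ord0) ((koszul F *m v) i ord0) => s s'; apply/eqP; ring.
pose T : 'cV[S]_3 := \col_i t i.
have Kv : koszul F *m v = a *: T.
  apply/colP => i; have -> : (a *: T) i ord0 = a * t i by rewrite !mxE.
  by rewrite ht mulrC.
have Ku : koszul F *m u = - (b *: T).
  apply/colP => i; have -> : (- (b *: T)) i ord0 = - (b * t i) by rewrite !mxE.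
  apply: (mulfI a0); apply/eqP; rewrite -subr_eq0 -(Kent i) ht.
  by move: ((koszul F *m u) i ord0) => s; apply/eqP; ring.
have [V TV] : exists V, T = koszul F *m V.
  apply: koszul_exact1; have : a *: (Xrow F *m T) = 0.
    by rewrite scalemxAr -Kv mulmxA Xkoszul mul0mx.
  move/matrixP/(_ ord0 ord0); rewrite mxE [RHS]mxE => e0.
  by apply: mx11_eq; apply: (mulfI a0); rewrite e0 mxE mulr0.
have [x ux] : exists x, u + b *: V = x *: Xcol F.
  by apply: koszul_exact0; rewrite mulmxDr -scalemxAr -TV Ku addNr.
have [y vy] : exists y, v - a *: V = y *: Xcol F.
  by apply: koszul_exact0; rewrite mulmxBr -scalemxAr -TV Kv subrr.
exists x, y; have : q *: Xcol F = (x * a + y * b) *: Xcol F.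
  rewrite quv scalerDl -[x * a]mulrC -[y * b]mulrC -!scalerA -ux -vy.
  by rewrite scalerDr scalerBr !scalerA (mulrC b a) addrACA subrr addr0.
by move/colP/(_ i0); rewrite !mxE => /(mulIf (mpolyX_neq0 F i0)).
Qed.

Lemma pair_saturated N (q : S) : (forall r : S, r \is N.-homog -> pair_ideal (r * q)) ->
  pair_ideal q.
Proof.
elim: N q => [|N IH] q hq; first by rewrite -[q]mul1r; apply: hq; apply: dhomog1.
apply: pair_saturated_step => i; apply: IH => r hr; rewrite mulrA; apply: hq.
by apply: homogM_eq hr (X_homog F i); apply: addn1.
Qed.

End CompleteIntersection.

(** Modulo a coprime pair of combinations of the partials the third one is a
    nonzerodivisor, because the three together generate all large forms and the
    ideal of the pair is saturated. *)
Lemma smooth_no_syzygy n (f : S) k (h : {ffun 'I_3 -> S}) : (0 < n)%N ->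
  f \is n.+1.-homog -> smooth_curve f -> (k < n)%N -> homog_syzygy f k h -> h = 0.
Proof.
move=> n0 hf sf lt [hh hs].
have hp j : f^`M(j) \is n.-homog by apply: homog_deriv.
have [i fi] := smooth_partial_neq0 hf sf.
have nc := smooth_no_common_factor hf sf.
have [t cop] := coprime_pair fi nc.
have bdJ := jacobian_bounded hp fi nc.
have [[N hN]|[p p0 zp]] := nullstellensatz (jacobian_ideal f) bdJ; last first.
  case: sf; exists p; apply/(singular_zero p hf); split=> // g [c ->].
  rewrite raddf_sum big1 //= => j _; rewrite mevalM (zp n _ (hp j)) ?mulr0 //.
  exact: (generated_gen (fun j => f^`M(j))).
set a := f^`M(i) in fi cop; set fj := f^`M(lift i ord0) in cop.
set fk := f^`M(lift i ord_max) in cop; set b := fj + _ in cop.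
have hb : b \is n.-homog.
  by apply: rpredD; [apply: hp|rewrite mulr_natl; apply: rpredMn; apply: hp].
have rel : h i * a + (h (lift i ord0) * fj + h (lift i ord_max) * fk) = 0.
  rewrite -[RHS]hs (bigD1_ord i) //= !big_ord_recl big_ord0 addr0.
  by rewrite (_ : lift ord0 ord0 = ord_max :> 'I_2) //; apply: val_inj.
pose w := h (lift i ord_max) - t%:R * h (lift i ord0).
have rel2 : h i * a + h (lift i ord0) * b + w * fk = 0.
  by rewrite -[RHS]rel /b /w; ring.
have idP := pair_ideal_ideal a b; have [P0 PD PM] := idP.
have wc : pair_ideal a b (w * fk).
  exists (- h i), (- h (lift i ord0)); apply/eqP; rewrite -subr_eq0 -rel2.
  by apply/eqP; ring.
have wI : pair_ideal a b w.
  apply: (pair_saturated fi cop (N := N)) => r hr.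
  have [c ->] := hN N r (leqnn N) hr.
  have fP j : pair_ideal a b (f^`M(j) * w).
    case: (unliftP i j) => [l ->|->]; last by exists w, 0; rewrite -/a; ring.
    case: l => -[|[|//]] hl; last first.
      by rewrite (_ : Ordinal hl = ord_max) ?[_ * w]mulrC //; apply: val_inj.
    rewrite (_ : Ordinal hl = ord0); last by apply: val_inj.
    rewrite -/fj (_ : fj * w = w * b - t%:R * (w * fk)); last by rewrite /b; ring.
    rewrite -mulNr; apply: PD; last exact: PM.
    by exists 0, w; ring.
  rewrite mulr_suml; elim/big_ind: _ => // j _.
  by rewrite -mulrA; apply: PM.
have hw : w \is k.-homog.
  by apply: rpredB; [apply: hh|rewrite mulr_natl; apply: rpredMn; apply: hh].
have w0 : w = 0.
  have [u [v e]] := wI; rewrite -[w](pihomog_dE hw) e pihomogD.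
  by rewrite (homog_compM0 u (hp i) lt) (homog_compM0 v hb lt) addr0.
have hj0 : h (lift i ord0) = 0.
  have [c ec] : divides a (h (lift i ord0)).
    apply: (coprime_divides (@factorial_mpoly F 3) fi cop).
    exists (- h i); apply/eqP; rewrite -subr_eq0 mulNr opprK addrC -rel2 w0.
    by rewrite mul0r addr0.
  have c0 : c = 0.
    by apply: (homog_divisor0 fi (hp i) _ lt); rewrite -ec.
  by rewrite ec c0 mul0r.
have hi0 : h i = 0.
  apply: (mulIf fi); rewrite mul0r -[RHS]rel2 w0 hj0; ring.
have hk0 : h (lift i ord_max) = 0.
  by move: w0; rewrite /w hj0 mulr0 subr0.
apply/ffunP => j; rewrite [RHS]ffunE; case: (unliftP i j) => [l ->|-> //].
case: l => -[|[|//]] hl.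
  by rewrite (_ : Ordinal hl = ord0) //; apply: val_inj.
by rewrite (_ : Ordinal hl = ord_max) //; apply: val_inj.
Qed.

Lemma sdim_smooth n (f : S) k : (0 < n)%N -> f \is n.+1.-homog -> smooth_curve f ->
  (k < n)%N -> exists2 c, sdim (fun p => p \is (k + n).-homog) (jacobian f) c &
    (c + 3 * 'C(k + 2, k) = 'C(k + n + 2, k + n))%N.
Proof.
move=> n0 hf sf lt; have hp j : f^`M(j) \is n.-homog by apply: homog_deriv.
have dz : sdim (homog_syzygy f k) (fun h => h = 0) 0.
  apply: sdim0 => [h hh|]; first exact: smooth_no_syzygy n0 hf sf lt hh.
  split=> [j|]; first by rewrite ffunE; apply: dhomog0.
  by rewrite big1 //= => j _; rewrite ffunE mul0r.
have [c dc ec] := sdim_quotient hp dz.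
by exists c => //; rewrite ec addn0.
Qed.

End Smooth.

(** * The invariants of the curve *)

Lemma tjurina_value_at e c : (0 < e)%N ->
  (c + 3 * 'C((e - 1) + 2, e - 1)
    = 'C((e - 1) + (2 * e - 1) + 2, (e - 1) + (2 * e - 1)))%N ->
  c = (3 * (e * (e - 1)))%N.
Proof.
move=> e0 h; have h1 := bin_square (e - 1); have h2 := bin_square ((e - 1) + (2 * e - 1)).
have [e' ee] : exists e', e = e'.+1 by exists e.-1; rewrite prednK.
have E1 : (e - 1 = e')%N by lia.
have E2 : ((2 * e - 1) = 2 * e' + 1)%N by lia.
rewrite E1 E2 in h h1 h2 *; rewrite ee; nia.
Qed.

Lemma tjurina_value_before e c : (1 < e)%N ->
  (c + 3 * 'C((e - 2) + 2, e - 2)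
    = 'C((e - 2) + (2 * e - 1) + 2, (e - 2) + (2 * e - 1)))%N ->
  c = (3 * (e * (e - 1))).+1.
Proof.
move=> e0 h; have h1 := bin_square (e - 2); have h2 := bin_square ((e - 2) + (2 * e - 1)).
have [e' ee] : exists e', e = e'.+2 by exists (e - 2)%N; lia.
have E1 : (e - 2 = e')%N by lia.
have E2 : ((2 * e - 1) = 2 * e' + 3)%N by lia.
have E3 : (e - 1 = e'.+1)%N by lia.
rewrite E1 E2 in h h1 h2 *; rewrite E3 ee; nia.
Qed.

Lemma tjurina_value_next e c : (0 < e)%N ->
  (c + 3 * 'C(e + 2, e) = 'C(e + (2 * e - 1) + 2, e + (2 * e - 1)) + 3 * 'C(2, 0))%N ->
  c = (3 * (e * (e - 1)))%N.
Proof.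
move=> e0 h; have h1 := bin_square e; have h2 := bin_square (e + (2 * e - 1)).
rewrite bin0 in h.
have [e' ee] : exists e', e = e'.+1 by exists e.-1; rewrite prednK.
have E1 : (e - 1 = e')%N by lia.
have E2 : ((2 * e - 1) = 2 * e' + 1)%N by lia.
rewrite E2 in h h2 *; rewrite E1 ee in h h1 h2 *; nia.
Qed.

Lemma tjurina_value_large e j c : (0 < e)%N ->
  (c + 3 * 'C(j + 1 + e + 2, j + 1 + e) + 'C(j + 2, j)
    = 'C(j + 1 + e + (2 * e - 1) + 2, j + 1 + e + (2 * e - 1))
      + 3 * 'C(j + 1 + 2, j + 1))%N ->
  c = (3 * (e * (e - 1)))%N.
Proof.
move=> e0 h; have h1 := bin_square (j + 1 + e); have h2 := bin_square j.
have h3 := bin_square (j + 1 + e + (2 * e - 1)); have h4 := bin_square (j + 1).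
have [e' ee] : exists e', e = e'.+1 by exists e.-1; rewrite prednK.
have E1 : (e - 1 = e')%N by lia.
have E2 : ((2 * e - 1) = 2 * e' + 1)%N by lia.
rewrite E2 in h h3 *; rewrite E1 ee in h h1 h2 h3 h4 *; nia.
Qed.

Section Main.

Variables (F : numClosedFieldType) (f : {mpoly F[3]}) (e : nat) (A : 'M[{mpoly F[3]}]_3).
Notation S := {mpoly F[3]}.
Notation J := (jacobian f).
Notation n := (2 * e - 1)%N.
Notation tau := (3 * (e * (e - 1)))%N.
Hypothesis e0 : (0 < e)%N.
Hypothesis hf : f \is (2 * e).-homog.
Hypothesis res : syzygy_resolution f e 1 A (Xrow F).
Hypothesis bdJ : bounded_codim J.

Lemma hf1 : f \is n.+1.-homog.
Proof. by rewrite (_ : n.+1 = 2 * e)%N //; lia. Qed.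

Lemma hilbert_stable k : (3 * e - 2 <= k)%N -> sdim (fun p : S => p \is k.-homog) J tau.
Proof.
move=> le; have [k1|k1] := leqP k (3 * e - 2).
  have ek : k = ((e - 1) + n)%N by lia.
  have [|c dc ec] := milnor_small e0 hf res (k := (e - 1)%N); first by lia.
  by rewrite ek -(tjurina_value_at e0 ec).
have [k2|k2] := leqP k (3 * e - 1).
  have ek : k = (0 + e + n)%N by lia.
  have [c dc ec] := milnor_middle e0 hf res (isT : 0 < 1)%N.
  by rewrite ek -(tjurina_value_next e0 ec).
have ek : k = ((k - 3 * e) + 1 + e + n)%N by lia.
have [c dc ec] := milnor_large e0 hf res (k - 3 * e).
by rewrite {1}ek -(tjurina_value_large e0 ec).
Qed.

Lemma hilbert_before : sdim (fun p : S => p \is (3 * e - 3).-homog) J tau.+1.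
Proof.
have [e1|e1] := leqP e 1.
  have ee : e = 1%N by lia.
  have := milnor_tiny e0 hf (k := 0%N); rewrite bin0 ee; apply; lia.
have [|c dc ec] := milnor_small e0 hf res (k := (e - 2)%N); first by lia.
rewrite (_ : 3 * e - 3 = (e - 2) + n)%N; last by lia.
by rewrite -(tjurina_value_before e1 ec).
Qed.

Lemma jacobian_comp k g : J g -> J (pihomog mdeg k g).
Proof. by apply: generated_comp => i; apply: (partial_homog e0 hf). Qed.

(** The generator of the saturation modulo [J] has no component of large degree. *)
Lemma jacobian_saturated : exists K, forall k (g : S), (K <= k)%N -> g \is k.-homog ->
  (exists N, forall h : S, h \is N.-homog -> J (h * g)) -> J g.
Proof.
have [H [p [AE HG]]] := socle_generator res.
exists (msize p) => k g le hg [N /(saturation_socle res AE HG)[c]].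
move/(jacobian_comp k); rewrite pihomogB (pihomog_dE hg) linearZ /=.
have -> : pihomog mdeg k p = 0; last by rewrite scaler0 subr0.
rewrite pihomogE big_seq_cond big1 // => m /andP[/msize_mdeg_lt lt /eqP em].
by move: lt; rewrite [mdeg m]em ltnNge le.
Qed.

(** In one degree that is large for all singular points and all charts, the
    dimension of M(f) is the sum of the local ones. *)
Lemma total_tjurina_value : total_tjurina f tau.
Proof.
have [r [s [ds cs]]] := zeros_list bdJ.
have [N hN] := codim_sum (jacobian_ideal f) jacobian_comp bdJ jacobian_saturated ds cs.
have /choice[K hK] (ic : 'I_r * 'I_3) : exists K, s ic.1 ord0 ic.2 != 0 ->
    forall k t, (K <= k)%N ->
    sdim (fun h : S => h \is k.-homog) (local_ideal J (s ic.1)) t ->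
    quot_dim (fun b : F => tofrac (b%:MP_[2])) (local_ring (affine_pt ic.2 (s ic.1)))
      (tjurina_ideal (dehomog ic.2 f) (affine_pt ic.2 (s ic.1))) t.
  have [_|pi] := eqVneq (s ic.1 ord0 ic.2) 0; first by exists 0%N.
  by have [K hK] := local_tjurina_chart hf1 bdJ pi; exists K.
pose k := maxn (maxn N (\max_ic K ic)) (3 * e - 2).
have leN : (N <= k)%N by rewrite /k !leq_max leqnn.
have leK ic : (K ic <= k)%N.
  rewrite /k !leq_max; apply/orP; left; apply/orP; right.
  exact: (leq_bigmax_cond (F := K)).
have [|ts dts ets] := hN k tau leN; first by apply: hilbert_stable; rewrite /k leq_maxr.
exists r, s, ts; split=> //.
- by move=> i; apply/(singular_zero _ hf1); case: ds => zs _; apply: zs.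
- by case: ds.
- by move=> p /(singular_zero _ hf1); apply: cs.
- by move=> i c pc; apply: (hK (i, c) pc k) (leK (i, c)) (dts i).
Qed.

Lemma jacobian_subspace : subspace J.
Proof. exact: subspace_generated. Qed.

Lemma stability_threshold : is_st f (3 * e - 2).
Proof.
exists tau; first exact: total_tjurina_value.
split=> [k le|q hq]; first exact/quot_dim_sdim/hilbert_stable.
rewrite leqNgt; apply/negP => lt.
have /quot_dim_sdim dk : milnor_dim f (3 * e - 3) tau by apply: hq; lia.
have := sdim_uniq jacobian_subspace dk hilbert_before.
by move/eqP; rewrite ltn_eqF.
Qed.

(** A conic with this resolution is smooth: its partials span the linear forms. *)
Lemma singular_degree : (exists p, singular_point f p) -> (1 < e)%N.
Proof.
move=> [p /(singular_zero _ hf1)[p0 zp]]; rewrite ltnNge; apply/negP => e1.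
have ee : e = 1%N by lia.
have [|v [_ _ gv]] := @hilbert_stable 1; first by lia.
have [j pj] : exists j, p ord0 j != 0 by case/rV0Pn: p0 => j; exists j.
have [c] := gv _ (X_homog F j).
rewrite big1 ?subr0 => [/zp|t _]; last first.
  by have := ltn_ord t; rewrite [X in (_ < X)%N](_ : _ = 0%N) // ee.
by rewrite mevalXU => h; rewrite h eqxx in pj.
Qed.

Section Singular.

Hypothesis e1 : (1 < e)%N.

Lemma koszul_entry v j : koszul_syzygy f v -> J (v ord0 j).
Proof.
have [J0 JD JM] := jacobian_ideal f.
have Jg i : J f^`M(i) by apply: (generated_gen (fun i => f^`M(i))).
have JN i : J (- f^`M(i)) by rewrite -mulN1r; apply: JM.
move=> [a [b [c ->]]]; rewrite !mxE.
apply: (JD); [apply: (JD)|]; apply: (JM); move: j; apply: ord3P => //=.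
Qed.

(** A Koszul syzygy has its entries in the Jacobian ideal, which has no element of
    degree e < 2 e - 1. *)
Lemma minimal_syzygy_degree : is_mdr f e.
Proof.
have [hA _ syz ker _] := res; split.
  exists (row i1 A); split=> [j||/koszul_entry hk].
  - by rewrite mxE.
  - have /matrixP/(_ ord0 ord0) : row i1 A *m gradient f = 0.
      by apply/syz; exists (delta_mx ord0 i1); rewrite rowE.
    rewrite mulmx_cv mxE => h; rewrite -[RHS]h.
    by apply: eq_bigr => j _; rewrite [X in _ = _ * X]mxE.
  - have A0 j : A i1 j = 0.
      have hj : row i1 A ord0 j \is e.-homog by rewrite mxE.
      have := generated_homog0 (partial_homog e0 hf) (hk j) hj.
      by rewrite mxE; apply; lia.
    have /ker[c /rowP ec] : (delta_mx ord0 i1 : 'rV[S]_3) *m A = 0.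
      by rewrite -rowE; apply/rowP => j; rewrite !mxE A0.
    have := ec i0; rewrite !mxE /= => /esym/eqP.
    rewrite mulf_eq0 (negPf (mpolyX_neq0 _ _)) orbF => /eqP c0.
    by have := ec i1; rewrite !mxE c0 mul0r /= => /eqP; rewrite oner_eq0.
move=> q [v [hv sv nv]]; rewrite leqNgt; apply/negP => lt; apply: nv.
have v0 : v = 0.
  have h0 : [ffun j => v ord0 j] = 0 :> {ffun 'I_3 -> S}.
    apply: (syzygy_small res lt); split=> [j|]; first by rewrite ffunE.
    by rewrite -[RHS]sv; apply: eq_bigr => j _; rewrite ffunE.
  by apply/rowP => j; have := congr1 (fun h : {ffun 'I_3 -> S} => h j) h0; rewrite !ffunE mxE.
by exists 0, 0, 0; rewrite v0 !scale0r !addr0.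
Qed.

(** In degrees up to 3 e - 2 of the Milnor algebras no syzygy of either curve
    contributes; in degree 3 e - 1 only [f] has some, three of them. *)
Lemma coincidence_threshold (fs : S) : fs \is (2 * e).-homog -> smooth_curve fs ->
  is_ct f fs (3 * e - 2).
Proof.
move=> hfs sfs; have hfs1 : fs \is n.+1.-homog by rewrite (_ : n.+1 = 2 * e)%N //; lia.
have n0 : (0 < n)%N by lia.
split=> [k le|q hq].
  have [lt|ge] := ltnP k n.
    exists 'C(k + 2, k); apply/quot_dim_sdim.
      exact: (milnor_tiny e0 hf lt).
    exact: (milnor_tiny e0 hfs lt).
  have ek : k = ((k - n) + n)%N by lia.
  have [|c dc ec] := milnor_small e0 hf res (k := (k - n)%N); first by lia.
  have [|c' dc' ec'] := sdim_smooth n0 hfs1 sfs (k := (k - n)%N); first by lia.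
  rewrite -ek in dc ec dc' ec'.
  exists c; apply/quot_dim_sdim => //; rewrite (_ : c = c') //.
  by apply: (@addIn (3 * 'C(k - n + 2, k - n))); rewrite ec ec'.
rewrite leqNgt; apply/negP => lt.
have [c dc ec] := milnor_middle e0 hf res (isT : 0 < 1)%N.
have [|c' dc' ec'] := sdim_smooth n0 hfs1 sfs (k := e); first by lia.
have [|t /quot_dim_sdim d1 /quot_dim_sdim d2] := hq (e + n)%N; first by lia.
have s2 : subspace (jacobian fs) by apply: subspace_generated.
have ct := sdim_uniq jacobian_subspace dc d1.
have ct' := sdim_uniq s2 dc' d2.
move: ec ec'; rewrite ct ct' !add0n bin0 => -> /eqP.
by rewrite -[X in _ == X]addn0 eqn_add2l.
Qed.

End Singular.

End Main.

Theorem almost_free_of_resolution (F : numClosedFieldType) (d e : nat) (f : {mpoly F[3]})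
    (ds : 'I_3 -> int) (b : int) :
  d = (2 * e)%N -> reduced_curve d f -> has_min_resolution d f ds b ->
  (forall i, ds i = e%:Z) ->
  [/\ almost_free d f,
      b = 2 - e%:Z,
      total_tjurina f (3 * (e * (e - 1))),
      is_st f (3 * e - 2)
    & (exists p, singular_point f p) ->
      is_mdr f e /\
      (forall fs : {mpoly F[3]}, fs \is d.-homog -> smooth_curve fs ->
        is_ct f fs (3 * e - 2))].
Proof.
move=> hd hC hres hds; have [d0 hf _ _] := hC.
have e0 : (0 < e)%N by lia.
have [m [A [l [res m0 bE]]]] := syzygy_resolution_exists hd e0 hf hres hds.
rewrite hd in hf.
have [i fi] := reduced_partial_neq0 hC.
have bdJ := jacobian_bounded (partial_homog e0 hf) fi (reduced_no_common_factor hC).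
have m1 := bounded_linear_relation e0 hf res m0 bdJ.
rewrite m1 in res bE.
have [A' res'] := normalize_relation res.
have [H [p [AE HG]]] := socle_generator res'.
split.
- by rewrite /almost_free hd mul2n odd_double /=; apply: (N_dim_one res' AE HG).
- by rewrite bE; lia.
- exact: total_tjurina_value e0 hf res' bdJ.
- exact: stability_threshold e0 hf res' bdJ.
move=> sing; have e1 := singular_degree e0 hf res' sing.
split; first exact: minimal_syzygy_degree e0 hf res' e1.
by rewrite hd => fs hfs sfs; apply: coincidence_threshold e0 hf res' e1 _ hfs sfs.
Qed.

Theorem corollary3p3 (R : realType) (d e : nat) (f : {mpoly R[i][3]})
    (ds : 'I_3 -> int) (b : int)
    (hd : d = (2 * e)%N)
    (hC : reduced_curve d f)
    (hlines : ~ concurrent_lines f)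
    (hres : has_min_resolution d f ds b)
    (hds : forall i, ds i = e%:Z) :
  [/\ almost_free d f,
      b = 2 - e%:Z,
      total_tjurina f (3 * (e * (e - 1))),
      is_st f (3 * e - 2)
    & (exists p, singular_point f p) ->
      is_mdr f e /\
      (forall fs : {mpoly R[i][3]}, fs \is d.-homog -> smooth_curve fs ->
        is_ct f fs (3 * e - 2))].
Proof. exact: almost_free_of_resolution hd hC hres hds. Qed.
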